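(* For all type environments $\Gamma$, $n\in\mathbb N$ and systems $M\triangleright P$, $N\triangleright Q$: if $\Gamma\models(M\triangleright P)\sqsubseteq^n_{bis}(N\triangleright Q)$ then $\Gamma\models(M\triangleright P)\precsim^n(N\triangleright Q)$.
   Context: Calculus. Fix disjoint countably infinite sets $\mathcal C$ of channel names ($c,d$) and $\mathcal V$ of variables ($x,y,z,w$); identifiers $u,v$ range over $\mathcal C\cup\mathcal V$. Processes: $P,Q::= u!\langle\vec v\rangle.P \mid u?(\vec x).P\mid \mathbf 0\mid \mathsf{if}\ u=v\ \mathsf{then}\ P\ \mathsf{else}\ Q\mid \mathsf{rec}\,w.P\mid w\mid P\parallel Q\mid \mathsf{alloc}\,x.P\mid \mathsf{free}\,u.P$; input binds $\vec x$, $\mathsf{rec}$ binds $w$, $\mathsf{alloc}$ binds $x$ (no name restriction). A resource environment $M$ is a set of (allocated) channels, infinitely many channels being unallocated; $M,c$ denotes $M\cup\{c\}$ and presupposes $c\notin M$. A system $M\triangleright P$ pairs a resource environment with a closed process; $M\triangleright P\parallel R$ means $M\triangleright(P\parallel R)$. Structural equivalence $\equiv$: commutativity and associativity of $\parallel$, $P\parallel\mathbf 0\equiv P$, closed under contexts. Reduction. Costed reduction $M\triangleright P\to_k M'\triangleright P'$ ($k\in\mathbb Z$) is the least relation closed under parallel composition with an arbitrary process on either side and under $\equiv$, containing: $M,c\triangleright c!\langle\vec d\rangle.P\parallel c?(\vec x).Q\to_0 M,c\triangleright P\parallel Q\{\vec d/\vec x\}$; $M,c\triangleright\mathsf{if}\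 c=c\ \mathsf{then}\ P\ \mathsf{else}\ Q\to_0M,c\triangleright P$; $M,c,d\triangleright\mathsf{if}\ c=d\ \mathsf{then}\ P\ \mathsf{else}\ Q\to_0M,c,d\triangleright Q$ ($c\neq d$); $M\triangleright\mathsf{rec}\,w.P\to_0M\triangleright P\{\mathsf{rec}\,w.P/w\}$; $M\triangleright\mathsf{alloc}\,x.P\to_{+1}M,c\triangleright P\{c/x\}$; $M,c\triangleright\mathsf{free}\,c.P\to_{-1}M\triangleright P$. $\to^*_k$ denotes zero or more reductions with total cost $k$. Types. Attributes $a::=\omega\mid 1\mid \bullet i$ ($i\in\mathbb N$; $\bullet$ abbreviates $\bullet 0$). Types $T::=U\mid \mathsf{proc}$, $U::=[\vec U]^a\mid \mu X.U\mid X$, closed contractive, up to equi-recursive equality $\sim$. Type environments $\Gamma$ are finite multisets of assumptions $u:T$. Splitting: $[\vec T]^\omega=[\vec T]^\omega\circ[\vec T]^\omega$; $\mathsf{proc}=\mathsf{proc}\circ\mathsf{proc}$; $[\vec T]^{\bullet i}=[\vec T]^{1}\circ[\vec T]^{\bullet(i+1)}$. Subtyping generated by $\bullet i\preceq\bullet(i+1)$, $\bullet i\preceq\omega$, $\omega\preceq 1$, lifted to $[\vec T]^{a_1}\preceq[\vec T]^{a_2}$. The relation $\prec$ on environments is the least reflexive transitive relation with: $\Gamma,u:T\prec\Gamma,u:T_1,u:T_2$ and its converse when $T=T_1\circ T_2$; $\Gamma,u:T_1\prec\Gamma,u:T_2$ when $T_1\sim T_2$ or $T_1\preceq T_2$;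 $\Gamma,u:T\prec\Gamma$; $\Gamma,u:[\vec T_1]^\bullet\prec\Gamma,u:[\vec T_2]^\bullet$. Decrement $(u:[\vec T]^a-1)$: empty if $a=1$; $u:[\vec T]^\omega$ if $a=\omega$; $u:[\vec T]^{\bullet i}$ if $a=\bullet(i+1)$; undefined if $a=\bullet$. Typing $\Gamma\vdash P$ is given by the rules: $\Gamma,(u:[\vec T]^a-1)\vdash P\Rightarrow\Gamma,u:[\vec T]^a,\vec v:\vec T\vdash u!\langle\vec v\rangle.P$; $\Gamma,(u:[\vec T]^a-1),\vec x:\vec T\vdash P\Rightarrow\Gamma,u:[\vec T]^a\vdash u?(\vec x).P$; $\Gamma_1\vdash P,\Gamma_2\vdash Q\Rightarrow\Gamma_1,\Gamma_2\vdash P\parallel Q$; $u,v\in\mathrm{dom}(\Gamma)$, $\Gamma\vdash P,\Gamma\vdash Q\Rightarrow\Gamma\vdash\mathsf{if}\ u=v\ \mathsf{then}\ P\ \mathsf{else}\ Q$; $\Gamma^\omega,w:\mathsf{proc}\vdash P\Rightarrow\Gamma^\omega\vdash\mathsf{rec}\,w.P$ ($\Gamma^\omega$ only unrestricted assumptions); $w:\mathsf{proc}\vdash w$; $\Gamma\vdash P\Rightarrow\Gamma,u:[\vec T]^\bullet\vdash\mathsf{free}\,u.P$; $\Gamma,x:[\vec T]^\bullet\vdash P\Rightarrow\Gamma\vdash\mathsf{alloc}\,x.P$; $\emptyset\vdash\mathbf 0$; $\Gamma'\vdash P,\Gamma\prec\Gamma'\Rightarrow\Gamma\vdash P$. $\Gamma$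 is consistent if some $\Gamma'$ with each identifier occurring at most once satisfies $\Gamma'\prec\Gamma$. $\Gamma\vdash M\triangleright P$ iff $\Gamma\vdash P$, $\mathrm{dom}(\Gamma)\subseteq M$, $\Gamma$ consistent. A configuration $\Gamma\triangleleft M\triangleright P$: $\mathrm{dom}(\Gamma)\subseteq M$ and some $\Delta$ has $(\Gamma,\Delta)$ consistent and $\Delta\vdash M\triangleright P$. LTS. Pre-transitions $\Gamma\triangleleft M\triangleright P\xrightarrow{\mu}{}^{\mathrm{pre}}_k\Gamma'\triangleleft M'\triangleright P'$ ($\mu::=c!\vec d\mid c?\vec d\mid\tau\mid\mathsf{alloc}\mid\mathsf{free}\,c\mid\mathsf{env}$) are the least relation with: $\Gamma,c:[\vec T]^a\triangleleft M\triangleright c!\langle\vec d\rangle.P\xrightarrow{c!\vec d}_0\Gamma,(c:[\vec T]^a-1),\vec d:\vec T\triangleleft M\triangleright P$; $\Gamma,c:[\vec T]^a,\vec d:\vec T\triangleleft M\triangleright c?(\vec x).P\xrightarrow{c?\vec d}_0\Gamma,(c:[\vec T]^a-1)\triangleleft M\triangleright P\{\vec d/\vec x\}$; if $\Gamma_1\triangleleft M\triangleright P\xrightarrow{c!\vec d}_0\Gamma_1'\triangleleft M\triangleright P'$ and $\Gamma_2\triangleleft M\triangleright Q\xrightarrow{c?\vec d}_0\Gamma_2'\triangleleft M\triangleright Q'$ then for any $\Gamma$, $\Gamma\triangleleft M\triangleright P\parallel Q\xrightarrow{\tau}_0\Gamma\triangleleft M\triangleright P'\parallel Q'$ (and symmetrically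 for $Q\parallel P$); parallel closure on either side preserving $\mu,k$ and the resulting environment; $\Gamma\triangleleft M\triangleright P\xrightarrow{\mathsf{env}}_0\Gamma'\triangleleft M\triangleright P$ when $\Gamma\prec\Gamma'$; cost-0 $\tau$-steps for recursion unfolding and the two conditional axioms; $\Gamma\triangleleft M\triangleright\mathsf{alloc}\,x.P\xrightarrow{\tau}_{+1}\Gamma\triangleleft M,c\triangleright P\{c/x\}$; $\Gamma\triangleleft M\triangleright P\xrightarrow{\mathsf{alloc}}_{+1}\Gamma,c:[\vec T]^\bullet\triangleleft M,c\triangleright P$; $\Gamma\triangleleft M,c\triangleright\mathsf{free}\,c.P\xrightarrow{\tau}_{-1}\Gamma\triangleleft M\triangleright P$; $\Gamma,c:[\vec T]^\bullet\triangleleft M,c\triangleright P\xrightarrow{\mathsf{free}\,c}_{-1}\Gamma\triangleleft M\triangleright P$. A renaming modulo $\Gamma$, $\sigma_\Gamma$, is a bijection on channel names fixing every channel in $\mathrm{dom}(\Gamma)$. Transitions: $\Gamma\triangleleft M\triangleright P\xrightarrow{\mu}_kX$ iff $\Gamma\triangleleft(M\triangleright P)\sigma_\Gamma\xrightarrow{\mu}{}^{\mathrm{pre}}_kX$ for some $\sigma_\Gamma$. Weak transitions $\xRightarrow{\mu}_k$: $\tau$-transitions, one $\mu$-transition, $\tau$-transitions, total cost $k$; $\hat\mu=\mu$ if $\mu\neq\tau$, and $\xRightarrow{\hat\tau}_k$ is zero or more $\tau$-transitions with total cost $k$. Amortised typed relations are sets of quadruples $(\Gamma,n,S,T)$ with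 $n\in\mathbb N$ and $\Gamma\triangleleft S$, $\Gamma\triangleleft T$ configurations; write $\Gamma\models S\,\mathcal R^n\,T$. An amortised typed bisimulation: whenever $\Gamma\models(M\triangleright P)\mathcal R^n(N\triangleright Q)$, every $\Gamma\triangleleft M\triangleright P\xrightarrow{\mu}_k\Gamma'\triangleleft M'\triangleright P'$ is matched by some $\Gamma\triangleleft N\triangleright Q\xRightarrow{\hat\mu}_l\Gamma'\triangleleft N'\triangleright Q'$ with $\Gamma'\models(M'\triangleright P')\mathcal R^{n+l-k}(N'\triangleright Q')$, and every $\Gamma\triangleleft N\triangleright Q\xrightarrow{\mu}_l\Gamma'\triangleleft N'\triangleright Q'$ by some $\Gamma\triangleleft M\triangleright P\xRightarrow{\hat\mu}_k\Gamma'\triangleleft M'\triangleright P'$ with the same conclusion (credits stay in $\mathbb N$). $\Gamma\models S\sqsubseteq^n_{bis}T$ iff some amortised typed bisimulation contains $(\Gamma,n,S,T)$. Behavioural preorder. Barb: $\Gamma\triangleleft M\triangleright P\Downarrow c$ iff $M\triangleright P\to^*_k M'\triangleright P''$ for some $k$ with $P''\equiv P'\parallel c!\langle\vec d\rangle.P'''$ and $c\in\mathrm{dom}(\Gamma)$. $\precsim$ is the largest amortised typed relation $\mathcal R$ such that whenever $\Gamma\models(M\triangleright P)\mathcal R^n(N\triangleright Q)$: (barb preservation) for all $c$, $\Gamma\triangleleft M\triangleright P\Downarrow c$ iff $\Gamma\triangleleft N\triangleright Q\Downarrow c$; (cost improving) if $M\triangleright P\to_k M'\triangleright P'$ then $N\triangleright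 Q\to^*_l N'\triangleright Q'$ with $\Gamma\models(M'\triangleright P')\mathcal R^{n+l-k}(N'\triangleright Q')$, and if $N\triangleright Q\to_l N'\triangleright Q'$ then $M\triangleright P\to^*_k M'\triangleright P'$ with $\Gamma\models(M'\triangleright P')\mathcal R^{n+l-k}(N'\triangleright Q')$; (full contextuality) $\Gamma,c:[\vec T]^\bullet\models(M,c\triangleright P)\mathcal R^n(N,c\triangleright Q)$ for all channels $c\notin M\cup N$ and all $\vec T$, and whenever $\Gamma\prec\Gamma_1,\Gamma_2$ with $\Gamma_2\vdash R$, both $\Gamma_1\models(M\triangleright P\parallel R)\mathcal R^n(N\triangleright Q\parallel R)$ and $\Gamma_1\models(M\triangleright R\parallel P)\mathcal R^n(N\triangleright R\parallel Q)$. Write $\Gamma\models S\precsim^nT$ when $(\Gamma,n,S,T)\in\precsim$. *)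

(* Defs.v *)
From Stdlib Require Import ZArith Permutation Bool FinFun.
From Stdlib Require Import Ensembles Finite_sets Image.
(* [List] is imported last: an unqualified [In] is list membership. *)
From Stdlib Require Import List.
Import ListNotations.

(** * Processes *)

Definition channel := nat.

(* The variables come in two disjoint sorts: those that stand for channels
   (bound by input and alloc) and those that stand for processes (bound by
   rec).  A variable of one sort cannot occur in a position of the other, so
   that both kinds of substitution are total. *)
Definition var := nat.
Definition pvar := nat.

Inductive ident : Type :=
| Ch (c : channel)
| Var (x : var).

Inductive process : Type :=
| Out (u : ident) (vs : list ident) (P : process)
| Inp (u : ident) (xs : list var) (P : process)
| Nil
| If (u v : ident) (P Q : process)
| Rec (w : pvar) (P : process)
| PVar (w : pvar)
| Par (P Q : process)
| Alloc (x : var) (P : process)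
| Free (u : ident) (P : process).

Definition ident_closed (xs : list var) (u : ident) : Prop :=
  match u with Ch _ => True | Var x => In x xs end.

(* The free variables of [P] are among [xs] and [ws]. *)
Fixpoint closed_in (xs : list var) (ws : list pvar) (P : process) : Prop :=
  match P with
  | Out u vs P => ident_closed xs u /\ Forall (ident_closed xs) vs
                  /\ closed_in xs ws P
  | Inp u ys P => ident_closed xs u /\ closed_in (ys ++ xs) ws P
  | Nil => True
  | If u v P Q => ident_closed xs u /\ ident_closed xs v
                  /\ closed_in xs ws P /\ closed_in xs ws Q
  | Rec w P => closed_in xs (w :: ws) P
  | PVar w => In w ws
  | Par P Q => closed_in xs ws P /\ closed_in xs ws Q
  | Alloc x P => closed_in (x :: xs) ws P
  | Free u P => ident_closed xs u /\ closed_in xs ws P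
  end.

Definition closed : process -> Prop := closed_in [] [].

(** * Substitution

   Only channels and closed processes are ever substituted, so nothing can be
   captured and bound variables need no renaming. *)

Definition subst_ident (s : var -> ident) (u : ident) : ident :=
  match u with Ch c => Ch c | Var x => s x end.

Definition mask (xs : list var) (s : var -> ident) : var -> ident :=
  fun y => if in_dec Nat.eq_dec y xs then Var y else s y.

Fixpoint subst (s : var -> ident) (P : process) : process :=
  match P with
  | Out u vs P => Out (subst_ident s u) (map (subst_ident s) vs) (subst s P)
  | Inp u xs P => Inp (subst_ident s u) xs (subst (mask xs s) P)
  | Nil => Nil
  | If u v P Q =>
      If (subst_ident s u) (subst_ident s v) (subst s P) (subst s Q)
  | Rec w P => Rec w (subst s P)
  | PVar w => PVar w
  | Par P Q => Par (subst s P) (subst s Q)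
  | Alloc x P => Alloc x (subst (mask [x] s) P)
  | Free u P => Free (subst_ident s u) (subst s P)
  end.

(* The substitution {ds/xs}, for lists of the same length. *)
Fixpoint to_chans (xs : list var) (ds : list channel) (y : var) : ident :=
  match xs, ds with
  | x :: xs, d :: ds => if Nat.eq_dec x y then Ch d else to_chans xs ds y
  | _, _ => Var y
  end.

Fixpoint psubst (w : pvar) (R P : process) : process :=
  match P with
  | Out u vs P => Out u vs (psubst w R P)
  | Inp u xs P => Inp u xs (psubst w R P)
  | Nil => Nil
  | If u v P Q => If u v (psubst w R P) (psubst w R Q)
  | Rec w' P => Rec w' (if Nat.eq_dec w w' then P else psubst w R P)
  | PVar w' => if Nat.eq_dec w w' then R else PVar w'
  | Par P Q => Par (psubst w R P) (psubst w R Q)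
  | Alloc x P => Alloc x (psubst w R P)
  | Free u P => Free u (psubst w R P)
  end.

(** * Systems *)

Definition renv := Ensemble channel.

Record sys : Type := Sys { res : renv; prc : process }.
Notation "M |> P" := (Sys M P) (at level 65, no associativity).

Definition extend (M : renv) (c : channel) : renv := Ensembles.Add channel M c.

Definition is_system (S : sys) : Prop :=
  ~ Finite_sets.Finite channel (Complement channel (res S)) /\ closed (prc S).

Definition ren_ident (s : channel -> channel) (u : ident) : ident :=
  match u with Ch c => Ch (s c) | Var x => Var x end.

Fixpoint ren (s : channel -> channel) (P : process) : process :=
  match P with
  | Out u vs P => Out (ren_ident s u) (map (ren_ident s) vs) (ren s P)
  | Inp u xs P => Inp (ren_ident s u) xs (ren s P)
  | Nil => Nil
  | If u v P Q => If (ren_ident s u) (ren_ident s v) (ren s P) (ren s Q)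
  | Rec w P => Rec w (ren s P)
  | PVar w => PVar w
  | Par P Q => Par (ren s P) (ren s Q)
  | Alloc x P => Alloc x (ren s P)
  | Free u P => Free (ren_ident s u) (ren s P)
  end.

Definition ren_sys (s : channel -> channel) (S : sys) : sys :=
  Im channel channel (res S) s |> ren s (prc S).

Inductive struct : process -> process -> Prop :=
| struct_refl P : struct P P
| struct_sym P Q : struct P Q -> struct Q P
| struct_trans P Q R : struct P Q -> struct Q R -> struct P R
| struct_comm P Q : struct (Par P Q) (Par Q P)
| struct_assoc P Q R : struct (Par P (Par Q R)) (Par (Par P Q) R)
| struct_nil P : struct (Par P Nil) P
| struct_out u vs P P' : struct P P' -> struct (Out u vs P) (Out u vs P')
| struct_inp u xs P P' : struct P P' -> struct (Inp u xs P) (Inp u xs P')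
| struct_if u v P P' Q Q' :
    struct P P' -> struct Q Q' -> struct (If u v P Q) (If u v P' Q')
| struct_rec w P P' : struct P P' -> struct (Rec w P) (Rec w P')
| struct_par P P' Q Q' :
    struct P P' -> struct Q Q' -> struct (Par P Q) (Par P' Q')
| struct_alloc x P P' : struct P P' -> struct (Alloc x P) (Alloc x P')
| struct_free u P P' : struct P P' -> struct (Free u P) (Free u P').

Inductive red : sys -> Z -> sys -> Prop :=
| red_com (M : renv) c ds xs P Q :
    M c -> length ds = length xs ->
    red (M |> Par (Out (Ch c) (map Ch ds) P) (Inp (Ch c) xs Q)) 0
        (M |> Par P (subst (to_chans xs ds) Q))
| red_then (M : renv) c P Q :
    M c -> red (M |> If (Ch c) (Ch c) P Q) 0 (M |> P)
| red_else (M : renv) c d P Q :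
    M c -> M d -> c <> d -> red (M |> If (Ch c) (Ch d) P Q) 0 (M |> Q)
| red_rec M w P : red (M |> Rec w P) 0 (M |> psubst w (Rec w P) P)
| red_alloc M x P c :
    ~ M c ->
    red (M |> Alloc x P) 1 (extend M c |> subst (to_chans [x] [c]) P)
| red_free M c P :
    ~ M c -> red (extend M c |> Free (Ch c) P) (-1) (M |> P)
| red_par_l M P k M' P' R :
    red (M |> P) k (M' |> P') -> red (M |> Par P R) k (M' |> Par P' R)
| red_par_r M P k M' P' R :
    red (M |> P) k (M' |> P') -> red (M |> Par R P) k (M' |> Par R P')
| red_struct M P Q k M' P' Q' :
    struct P Q -> red (M |> Q) k (M' |> Q') -> struct Q' P' ->
    red (M |> P) k (M' |> P').

Inductive reds : sys -> Z -> sys -> Prop :=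
| reds_refl S : reds S 0 S
| reds_step S1 k S2 l S3 :
    red S1 k S2 -> reds S2 l S3 -> reds S1 (k + l) S3.

(** * Types *)

Inductive attr : Type :=
| Unr
| One
| Uniq (i : nat).

(* Raw types; type variables are de Bruijn indices. *)
Inductive uty : Type :=
| TChan (Us : list uty) (a : attr)
| TMu (U : uty)
| TVar (n : nat).

Fixpoint closed_ty (k : nat) (U : uty) : bool :=
  match U with
  | TChan Us _ => forallb (closed_ty k) Us
  | TMu U => closed_ty (S k) U
  | TVar n => Nat.ltb n k
  end.

(* [U] is not the variable [n] under a (possibly empty) string of binders. *)
Fixpoint head_free (n : nat) (U : uty) : bool :=
  match U with
  | TChan _ _ => true
  | TMu U => head_free (S n) U
  | TVar m => negb (Nat.eqb m n)
  end.

Fixpoint contractive (U : uty) : bool :=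
  match U with
  | TChan Us _ => forallb contractive Us
  | TMu U => head_free 0 U && contractive U
  | TVar _ => true
  end.

Definition wf_ty (U : uty) : bool := closed_ty 0 U && contractive U.

Record cty : Type := Cty { raw : uty; raw_wf : wf_ty raw = true }.

Lemma wf_chan (Ts : list cty) (a : attr) :
  wf_ty (TChan (map raw Ts) a) = true.
Proof.
  unfold wf_ty; simpl; apply andb_true_intro; split;
    apply forallb_forall; intros U HU; apply in_map_iff in HU;
    destruct HU as [[V HV] [<- _]]; simpl;
    apply andb_prop in HV; tauto.
Qed.

Definition chanT (Ts : list cty) (a : attr) : cty :=
  Cty (TChan (map raw Ts) a) (wf_chan Ts a).

(* No lifting of [V]: this is only used with [V] closed. *)
Fixpoint tsubst (k : nat) (V U : uty) : uty :=
  match U with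
  | TChan Us a => TChan (map (tsubst k V) Us) a
  | TMu U => TMu (tsubst (S k) V U)
  | TVar n =>
      match Nat.compare n k with
      | Eq => V
      | Lt => TVar n
      | Gt => TVar (pred n)
      end
  end.

Inductive unfolds : uty -> list uty -> attr -> Prop :=
| unfolds_chan Us a : unfolds (TChan Us a) Us a
| unfolds_mu U Us a :
    unfolds (tsubst 0 (TMu U) U) Us a -> unfolds (TMu U) Us a.

(* Equi-recursive equality: the infinite unfoldings are the same tree. *)
Definition teq (U V : uty) : Prop :=
  exists R : uty -> uty -> Prop,
    (forall U V, R U V -> exists Us Vs a,
        unfolds U Us a /\ unfolds V Vs a /\ Forall2 R Us Vs)
    /\ R U V.

Inductive ty : Type :=
| TU (U : cty)
| TProc.

Inductive ty_eq : ty -> ty -> Prop :=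
| ty_eq_chan U V : teq (raw U) (raw V) -> ty_eq (TU U) (TU V)
| ty_eq_proc : ty_eq TProc TProc.

Inductive ty_split : ty -> ty -> ty -> Prop :=
| split_unr Ts :
    ty_split (TU (chanT Ts Unr)) (TU (chanT Ts Unr)) (TU (chanT Ts Unr))
| split_proc : ty_split TProc TProc TProc
| split_uniq Ts i :
    ty_split (TU (chanT Ts (Uniq i)))
             (TU (chanT Ts One)) (TU (chanT Ts (Uniq (S i)))).

Inductive attr_sub : attr -> attr -> Prop :=
| asub_refl a : attr_sub a a
| asub_trans a b c : attr_sub a b -> attr_sub b c -> attr_sub a c
| asub_indx i : attr_sub (Uniq i) (Uniq (S i))
| asub_unr i : attr_sub (Uniq i) Unr
| asub_aff : attr_sub Unr One.

Inductive ty_sub : ty -> ty -> Prop :=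
| ty_sub_chan Ts a b :
    attr_sub a b -> ty_sub (TU (chanT Ts a)) (TU (chanT Ts b)).

(** * Type environments

   A multiset of assumptions is a list up to [Permutation]; every relation
   below is closed under permuting the environments it relates. *)

Inductive name : Type :=
| NId (u : ident)
| NPv (w : pvar).

Definition env := list (name * ty).

Definition dom (G : env) : list name := map fst G.

Definition bindings (us : list ident) (Ts : list cty) : env :=
  combine (map NId us) (map TU Ts).

(* The side condition of [bindings]: us : Ts presupposes equal lengths. *)
Definition same_length {A B : Type} (l : list A) (l' : list B) : Prop :=
  length l = length l'.

Definition assume (u : ident) (Ts : list cty) (a : attr) : name * ty :=
  (NId u, TU (chanT Ts a)).

Inductive prec : env -> env -> Prop :=
| prec_refl G G' : Permutation G G' -> prec G G'
| prec_trans G1 G2 G3 : prec G1 G2 -> prec G2 G3 -> prec G1 G3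
| prec_split G u T T1 T2 :
    ty_split T T1 T2 -> prec ((u, T) :: G) ((u, T1) :: (u, T2) :: G)
| prec_join G u T T1 T2 :
    ty_split T T1 T2 -> prec ((u, T1) :: (u, T2) :: G) ((u, T) :: G)
| prec_eq G u T1 T2 : ty_eq T1 T2 -> prec ((u, T1) :: G) ((u, T2) :: G)
| prec_sub G u T1 T2 : ty_sub T1 T2 -> prec ((u, T1) :: G) ((u, T2) :: G)
| prec_weak G u T : prec ((u, T) :: G) G
| prec_rev G u Ts1 Ts2 :
    prec ((u, TU (chanT Ts1 (Uniq 0))) :: G)
         ((u, TU (chanT Ts2 (Uniq 0))) :: G).

Definition decr (u : ident) (Ts : list cty) (a : attr) : option env :=
  match a with
  | One => Some []
  | Unr => Some [assume u Ts Unr]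
  | Uniq (S i) => Some [assume u Ts (Uniq i)]
  | Uniq O => None
  end.

(* Unrestricted types are those that split into two copies of themselves. *)
Definition unrestricted (G : env) : Prop :=
  Forall (fun b => snd b = TProc \/ exists Ts, snd b = TU (chanT Ts Unr)) G.

(* Bound variables are fresh for the environment.  As [prec] contains
   weakening, and every attribute is below [One], this makes typability
   independent of the choice of bound variables. *)
Inductive typed : env -> process -> Prop :=
| t_out G D u Ts a vs P :
    decr u Ts a = Some D -> same_length vs Ts ->
    typed (D ++ G) P ->
    typed (assume u Ts a :: bindings vs Ts ++ G) (Out u vs P)
| t_inp G D u Ts a xs P :
    decr u Ts a = Some D -> same_length xs Ts ->
    NoDup xs -> (forall x, In x xs -> ~ In (NId (Var x)) (dom (D ++ G))) ->
    typed (bindings (map Var xs) Ts ++ D ++ G) P ->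
    typed (assume u Ts a :: G) (Inp u xs P)
| t_par G1 G2 P Q : typed G1 P -> typed G2 Q -> typed (G1 ++ G2) (Par P Q)
| t_if G u v P Q :
    In (NId u) (dom G) -> In (NId v) (dom G) ->
    typed G P -> typed G Q -> typed G (If u v P Q)
| t_rec G w P :
    unrestricted G -> ~ In (NPv w) (dom G) ->
    typed ((NPv w, TProc) :: G) P -> typed G (Rec w P)
| t_pvar w : typed [(NPv w, TProc)] (PVar w)
| t_free G u Ts P : typed G P -> typed (assume u Ts (Uniq 0) :: G) (Free u P)
| t_alloc G x Ts P :
    ~ In (NId (Var x)) (dom G) ->
    typed (assume (Var x) Ts (Uniq 0) :: G) P -> typed G (Alloc x P)
| t_nil : typed [] Nil
| t_str G G' P : typed G' P -> prec G G' -> typed G P.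

Definition consistent (G : env) : Prop :=
  exists G', NoDup (dom G') /\ prec G' G.

Definition dom_sub (G : env) (M : renv) : Prop :=
  forall u, In u (dom G) -> exists c, u = NId (Ch c) /\ M c.

Definition sys_typed (G : env) (S : sys) : Prop :=
  typed G (prc S) /\ dom_sub G (res S) /\ consistent G.

Definition config (G : env) (S : sys) : Prop :=
  is_system S /\ dom_sub G (res S) /\
  exists D, consistent (G ++ D) /\ sys_typed D S.

(** * Labelled transitions *)

Inductive label : Type :=
| LOut (c : channel) (ds : list channel)
| LInp (c : channel) (ds : list channel)
| LTau
| LAlloc
| LFree (c : channel)
| LEnv.

Inductive pretrans : env -> sys -> label -> Z -> env -> sys -> Prop :=
| p_out G D c Ts a ds M P :
    decr (Ch c) Ts a = Some D -> same_length ds Ts ->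
    pretrans (assume (Ch c) Ts a :: G) (M |> Out (Ch c) (map Ch ds) P)
             (LOut c ds) 0
             (bindings (map Ch ds) Ts ++ D ++ G) (M |> P)
| p_inp G D c Ts a ds xs M P :
    decr (Ch c) Ts a = Some D -> same_length ds Ts -> same_length ds xs ->
    pretrans (assume (Ch c) Ts a :: bindings (map Ch ds) Ts ++ G)
             (M |> Inp (Ch c) xs P)
             (LInp c ds) 0
             (D ++ G) (M |> subst (to_chans xs ds) P)
| p_com_l G G1 G1' G2 G2' M c ds P P' Q Q' :
    pretrans G1 (M |> P) (LOut c ds) 0 G1' (M |> P') ->
    pretrans G2 (M |> Q) (LInp c ds) 0 G2' (M |> Q') ->
    pretrans G (M |> Par P Q) LTau 0 G (M |> Par P' Q')
| p_com_r G G1 G1' G2 G2' M c ds P P' Q Q' :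
    pretrans G1 (M |> P) (LOut c ds) 0 G1' (M |> P') ->
    pretrans G2 (M |> Q) (LInp c ds) 0 G2' (M |> Q') ->
    pretrans G (M |> Par Q P) LTau 0 G (M |> Par Q' P')
| p_par_l G M P mu k G' M' P' Q :
    pretrans G (M |> P) mu k G' (M' |> P') ->
    pretrans G (M |> Par P Q) mu k G' (M' |> Par P' Q)
| p_par_r G M P mu k G' M' P' Q :
    pretrans G (M |> P) mu k G' (M' |> P') ->
    pretrans G (M |> Par Q P) mu k G' (M' |> Par Q P')
| p_env G G' M P : prec G G' -> pretrans G (M |> P) LEnv 0 G' (M |> P)
| p_rec G M w P :
    pretrans G (M |> Rec w P) LTau 0 G (M |> psubst w (Rec w P) P)
| p_then G (M : renv) c P Q :
    M c -> pretrans G (M |> If (Ch c) (Ch c) P Q) LTau 0 G (M |> P)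
| p_else G (M : renv) c d P Q :
    M c -> M d -> c <> d ->
    pretrans G (M |> If (Ch c) (Ch d) P Q) LTau 0 G (M |> Q)
| p_alloc G M x P c :
    ~ M c ->
    pretrans G (M |> Alloc x P) LTau 1
             G (extend M c |> subst (to_chans [x] [c]) P)
| p_alloc_env G M P c Ts :
    ~ M c ->
    pretrans G (M |> P) LAlloc 1
             (assume (Ch c) Ts (Uniq 0) :: G) (extend M c |> P)
| p_free G M c P :
    ~ M c ->
    pretrans G (extend M c |> Free (Ch c) P) LTau (-1) G (M |> P)
| p_free_env G M c Ts P :
    ~ M c ->
    pretrans (assume (Ch c) Ts (Uniq 0) :: G) (extend M c |> P)
             (LFree c) (-1) G (M |> P)
| p_perm G1 G S mu k G' G1' S' :
    Permutation G1 G -> pretrans G S mu k G' S' -> Permutation G' G1' ->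
    pretrans G1 S mu k G1' S'.

Definition renaming (G : env) (s : channel -> channel) : Prop :=
  Bijective s /\ forall c, In (NId (Ch c)) (dom G) -> s c = c.

Definition trans (G : env) (S : sys) (mu : label) (k : Z)
    (G' : env) (S' : sys) : Prop :=
  exists s, renaming G s /\ pretrans G (ren_sys s S) mu k G' S'.

(* Zero steps leave the environment unchanged as a multiset. *)
Inductive wtau : env -> sys -> Z -> env -> sys -> Prop :=
| wtau_refl G G' S : Permutation G G' -> wtau G S 0 G' S
| wtau_step G1 S1 k G2 S2 l G3 S3 :
    trans G1 S1 LTau k G2 S2 -> wtau G2 S2 l G3 S3 ->
    wtau G1 S1 (k + l) G3 S3.

Inductive wtrans (G : env) (S : sys) (mu : label) (k : Z)
    (G' : env) (S' : sys) : Prop :=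
| wtrans_intro G1 S1 k1 G2 S2 k2 k3 :
    wtau G S k1 G1 S1 -> trans G1 S1 mu k2 G2 S2 -> wtau G2 S2 k3 G' S' ->
    k = (k1 + k2 + k3)%Z -> wtrans G S mu k G' S'.

Definition wtrans_hat (G : env) (S : sys) (mu : label) (k : Z)
    (G' : env) (S' : sys) : Prop :=
  match mu with
  | LTau => wtau G S k G' S'
  | _ => wtrans G S mu k G' S'
  end.

(** * Amortised typed relations *)

Definition arel := env -> nat -> sys -> sys -> Prop.

Definition amortised_typed (R : arel) : Prop :=
  (forall G n S T, R G n S T -> config G S /\ config G T) /\
  (forall G G' n S T, Permutation G G' -> R G n S T -> R G' n S T).

(* [R] relates the systems with credit [n], which has to be non-negative. *)
Definition at_credit (R : arel) (G : env) (n : Z) (S T : sys) : Prop :=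
  exists m : nat, Z.of_nat m = n /\ R G m S T.

Definition amortised_bisimulation (R : arel) : Prop :=
  amortised_typed R /\
  forall G n S T, R G n S T ->
    (forall mu k G' S', trans G S mu k G' S' ->
       exists l T', wtrans_hat G T mu l G' T' /\
         at_credit R G' (Z.of_nat n + l - k) S' T') /\
    (forall mu l G' T', trans G T mu l G' T' ->
       exists k S', wtrans_hat G S mu k G' S' /\
         at_credit R G' (Z.of_nat n + l - k) S' T').

Definition bis : arel := fun G n S T =>
  exists R, amortised_bisimulation R /\ R G n S T.

(** * The behavioural preorder *)

Definition barb (G : env) (S : sys) (c : channel) : Prop :=
  (exists k M P P1 ds P2,
     reds S k (M |> P) /\ struct P (Par P1 (Out (Ch c) (map Ch ds) P2)))
  /\ In (NId (Ch c)) (dom G).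

Definition barb_preserving (R : arel) : Prop :=
  forall G n S T, R G n S T -> forall c, barb G S c <-> barb G T c.

Definition cost_improving (R : arel) : Prop :=
  forall G n S T, R G n S T ->
    (forall k S', red S k S' ->
       exists l T', reds T l T' /\
         at_credit R G (Z.of_nat n + l - k) S' T') /\
    (forall l T', red T l T' ->
       exists k S', reds S k S' /\
         at_credit R G (Z.of_nat n + l - k) S' T').

Definition contextual (R : arel) : Prop :=
  forall G n M P N Q, R G n (M |> P) (N |> Q) ->
    (forall c Ts, ~ M c -> ~ N c ->
       R (assume (Ch c) Ts (Uniq 0) :: G) n
         (extend M c |> P) (extend N c |> Q)) /\
    (forall G1 G2 C, prec G (G1 ++ G2) -> typed G2 C ->
       R G1 n (M |> Par P C) (N |> Par Q C) /\
       R G1 n (M |> Par C P) (N |> Par C Q)).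

(* The largest relation with these properties: they are preserved by unions. *)
Definition behav : arel := fun G n S T =>
  exists R, amortised_typed R /\ barb_preserving R /\ cost_improving R /\
    contextual R /\ R G n S T.

(* Main.v *)
(** The relation [bis] itself is a witness for the behavioural preorder.

    Both transitions and [bis] are insensitive to renaming the channels that the
    observer does not know, so one may work with systems up to such renamings and
    up to structural equivalence.

    Parallel contexts: when the observer's environment splits as [G ++ G2] with
    [typed G2 C], every step of [Par P C] is a step of [P] that an observer with
    environment [G ++ G2] can provoke.  A step of [C] alone is answered by
    restructuring the environment, allocating or deallocating; this needs that
    two assumptions on one channel in a consistent environment agree on the
    object types, and that next to a unique assumption there are only affine
    ones, as many as its index allows, so that a communication is paid for by
    joining them.

    Fresh shared channels: the answer to the observer's allocation of [c] brings
    the second system, with [c] added from the start, to a state that matches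
    the first one, and weak answers absorb the steps that lead there.

    Barbs: consistency lets an observer that knows [c] receive whatever a
    configuration sends on it. *)

From Stdlib Require Import ZArith Permutation Bool FinFun Lia.
From Stdlib Require Import Ensembles Finite_sets Image Finite_sets_facts.
From Stdlib Require Import Classical FunctionalExtensionality PropExtensionality.
From Stdlib Require Import List.
Require Import Defs.
Import ListNotations.

(** * Equi-recursive equality *)

(** The premises of [p_com_l] may use any environments, so a silent step never depends on what the
    observer knows. [pretrans_inv] therefore separates a pre-transition into a step of [act], which
    mentions no types, and a change of environment read off the label. The delicate point is the
    choice of names. A renaming that fixes the observer's channels may still move those known only
    to a context, so contexts are renamed along with the systems, and this requires [zbis] to be
    stable under all bijections of channels. The same freedom resolves a clash between a channel
    that a system allocates privately and one added from outside. The two halves of a bisimulation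
    differ only in the sign with which costs enter the credit. Each closure argument is carried out
    once, for a [one_sided] relation with sign [e], and then used for [zbis] and for its
    converse. *)

Fixpoint uty_nested_ind (P : uty -> Prop)
    (HC : forall Us a, Forall P Us -> P (TChan Us a))
    (HM : forall U, P U -> P (TMu U)) (HV : forall n, P (TVar n))
    (U : uty) : P U :=
  match U with
  | TChan Us a =>
      HC Us a ((fix go (l : list uty) : Forall P l :=
                  match l with
                  | [] => Forall_nil P
                  | V :: l => Forall_cons V (uty_nested_ind P HC HM HV V) (go l)
                  end) Us)
  | TMu U => HM U (uty_nested_ind P HC HM HV U)
  | TVar n => HV n
  end.

Lemma forallb_Forall {A} (f : A -> bool) l :
  forallb f l = true <-> Forall (fun x => f x = true) l.
Proof. rewrite forallb_forall, Forall_forall; tauto. Qed.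

Lemma closed_ty_le U : forall k k',
  k <= k' -> closed_ty k U = true -> closed_ty k' U = true.
Proof.
  induction U as [Us a IH|U IH|n] using uty_nested_ind; intros k k' Hk; simpl.
  - rewrite !forallb_Forall, !Forall_forall. rewrite Forall_forall in IH. eauto.
  - apply IH; lia.
  - rewrite !Nat.ltb_lt; lia.
Qed.

Lemma closed_ty_head_free U : forall k, closed_ty k U = true -> head_free k U = true.
Proof.
  induction U as [Us a IH|U IH|n] using uty_nested_ind; intros k; simpl; auto.
  rewrite Nat.ltb_lt; intros; apply negb_true_iff, Nat.eqb_neq; lia.
Qed.

Lemma closed_ty_tsubst V U : closed_ty 0 V = true -> forall k,
  closed_ty (S k) U = true -> closed_ty k (tsubst k V U) = true.
Proof.
  intros HV; induction U as [Us a IH|U IH|n] using uty_nested_ind; intros k; simpl.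
  - rewrite !forallb_Forall, !Forall_forall. rewrite Forall_forall in IH.
    intros H x Hx; apply in_map_iff in Hx as (y & <- & Hy); auto.
  - auto.
  - rewrite Nat.ltb_lt; intros H.
    destruct (Nat.compare_spec n k); simpl; try (apply Nat.ltb_lt; lia).
    apply closed_ty_le with 0; auto; lia.
Qed.

Lemma head_free_tsubst V U : closed_ty 0 V = true -> forall n k, n < k ->
  head_free n U = true -> head_free n (tsubst k V U) = true.
Proof.
  intros HV; induction U as [Us a IH|U IH|m] using uty_nested_ind;
    intros n k Hn; simpl; auto.
  - apply IH; lia.
  - rewrite negb_true_iff, Nat.eqb_neq; intros H.
    destruct (Nat.compare_spec m k); simpl;
      try (apply negb_true_iff, Nat.eqb_neq; lia).
    apply closed_ty_head_free, closed_ty_le with 0; auto; lia.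
Qed.

Lemma contractive_tsubst V U :
  closed_ty 0 V = true -> contractive V = true -> forall k,
  contractive U = true -> contractive (tsubst k V U) = true.
Proof.
  intros HV HV'; induction U as [Us a IH|U IH|m] using uty_nested_ind;
    intros k; simpl.
  - rewrite !forallb_Forall, !Forall_forall. rewrite Forall_forall in IH.
    intros H x Hx; apply in_map_iff in Hx as (y & <- & Hy); auto.
  - rewrite !andb_true_iff; intros [H1 H2]; split; auto.
    apply head_free_tsubst; auto; lia.
  - intros _; destruct (Nat.compare_spec m k); auto.
Qed.

(** The termination measure for unfolding: in a contractive type the variable bound by a leading
    [TMu] is never at the head of the body, so substituting for it creates no leading binder and
    each unfolding removes one. *)
Fixpoint leading_mus (U : uty) : nat :=
  match U with TMu U => S (leading_mus U) | _ => 0 end.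

Lemma leading_mus_tsubst V U : forall k,
  head_free k U = true -> leading_mus (tsubst k V U) = leading_mus U.
Proof.
  induction U as [Us a|U IH|m]; intros k; simpl; auto.
  rewrite negb_true_iff, Nat.eqb_neq; intros H.
  destruct (Nat.compare_spec m k); simpl; auto; contradiction.
Qed.

Lemma wf_unfolds U : wf_ty U = true ->
  exists Us a, unfolds U Us a /\ Forall (fun V => wf_ty V = true) Us.
Proof.
  remember (leading_mus U) as n eqn:Hn; revert U Hn.
  induction n as [|n IH]; intros [Us a|U|m] Hn H; simpl in Hn; try discriminate;
    unfold wf_ty in H; simpl in H; try discriminate.
  - exists Us, a; split; [constructor|].
    apply andb_true_iff in H as [H1 H2]; rewrite forallb_Forall in H1, H2.
    rewrite Forall_forall in *; intros V HV; apply andb_true_iff; auto.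
  - apply andb_true_iff in H as [H1 H2]. pose proof H2 as H3.
    apply andb_true_iff in H2 as [H2 H4].
    destruct (IH (tsubst 0 (TMu U) U)) as (Us & a & Hu & HUs).
    + rewrite leading_mus_tsubst; auto; lia.
    + apply andb_true_iff; split.
      * apply closed_ty_tsubst; auto.
      * apply contractive_tsubst; auto.
    + exists Us, a; split; auto; constructor; auto.
Qed.

Lemma unfolds_det U Us a Vs b : unfolds U Us a -> unfolds U Vs b -> Us = Vs /\ a = b.
Proof.
  intros H; revert Vs b; induction H; intros Vs b H'; inversion H'; subst; auto.
Qed.

Lemma teq_unfolds U V : teq U V ->
  exists Us Vs a, unfolds U Us a /\ unfolds V Vs a /\ Forall2 teq Us Vs.
Proof.
  intros (R & HR & H). destruct (HR _ _ H) as (Us & Vs & a & H1 & H2 & H3).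
  exists Us, Vs, a; repeat split; auto.
  eapply Forall2_impl; [|exact H3]. intros; exists R; auto.
Qed.

(** Coinduction up to [teq]: one pair is added to the relation [teq], and its components are already
    related there. *)
Lemma teq_fold U V Us Vs a :
  unfolds U Us a -> unfolds V Vs a -> Forall2 teq Us Vs -> teq U V.
Proof.
  intros H1 H2 H3. exists (fun X Y => teq X Y \/ (X = U /\ Y = V)); split; auto.
  intros X Y [H|[-> ->]].
  - destruct (teq_unfolds _ _ H) as (Xs & Ys & b & ? & ? & HF).
    exists Xs, Ys, b; repeat split; auto. eapply Forall2_impl; [|exact HF]; auto.
  - exists Us, Vs, a; repeat split; auto. eapply Forall2_impl; [|exact H3]; auto.
Qed.

(** Well-formedness is what provides an unfolding: [TMu (TVar 0)], for instance, has none and is not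
    [teq] to itself. *)
Lemma teq_refl U : wf_ty U = true -> teq U U.
Proof.
  intros H; exists (fun X Y => X = Y /\ wf_ty X = true); split; auto.
  intros X Y [<- HX]. destruct (wf_unfolds X HX) as (Us & a & Hu & HUs).
  exists Us, Us, a; repeat split; auto.
  clear Hu; induction HUs; constructor; auto.
Qed.

Lemma teq_sym U V : teq U V -> teq V U.
Proof.
  intros H; exists (fun X Y => teq Y X); split; auto.
  intros X Y HXY; destruct (teq_unfolds _ _ HXY) as (Us & Vs & a & ? & ? & HF).
  exists Vs, Us, a; repeat split; auto. apply Forall2_flip; auto.
Qed.

Lemma Forall2_compose {A} (R1 R2 R3 : A -> A -> Prop) l1 l2 l3 :
  (forall x y z, R1 x y -> R2 y z -> R3 x z) ->
  Forall2 R1 l1 l2 -> Forall2 R2 l2 l3 -> Forall2 R3 l1 l3.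
Proof.
  intros H H1; revert l3; induction H1; intros l3 H2; inversion H2; subst;
    constructor; eauto.
Qed.

Lemma teq_trans U V W : teq U V -> teq V W -> teq U W.
Proof.
  intros H1 H2; exists (fun X Y => exists Z, teq X Z /\ teq Z Y); split; eauto.
  intros X Y (Z & H3 & H4).
  destruct (teq_unfolds _ _ H3) as (Us & Vs & a & ? & ? & HF).
  destruct (teq_unfolds _ _ H4) as (Us' & Vs' & a' & ? & ? & HF').
  destruct (unfolds_det Z Vs a Us' a') as [-> ->]; auto.
  exists Us, Vs', a'; repeat split; auto.
  eapply Forall2_compose; eauto; simpl; eauto.
Qed.

Lemma Forall2_teq_sym Us Vs : Forall2 teq Us Vs -> Forall2 teq Vs Us.
Proof.
  intros H; apply Forall2_flip; eapply Forall2_impl; [|exact H].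
  intros; apply teq_sym; auto.
Qed.

Lemma Forall2_teq_trans Us Vs Ws :
  Forall2 teq Us Vs -> Forall2 teq Vs Ws -> Forall2 teq Us Ws.
Proof. apply Forall2_compose, teq_trans. Qed.

(** * Type environments *)

Lemma name_eq_dec (u v : name) : {u = v} + {u <> v}.
Proof. repeat decide equality. Qed.

Lemma perm_skip_app {A} (a b t t' : list A) :
  Permutation t (a ++ t') -> Permutation (b ++ t) (a ++ b ++ t').
Proof.
  intros H; rewrite H, !app_assoc; apply Permutation_app_tail, Permutation_app_comm.
Qed.

Lemma perm_skip_cons {A} x (a t t' : list A) :
  Permutation t (a ++ t') -> Permutation (x :: t) (a ++ x :: t').
Proof. intros H; apply (perm_skip_app a [x] t t' H). Qed.

Lemma perm_cancel_app {A} (a l r r' : list A) :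
  Permutation r (a ++ r') -> Permutation l r' -> Permutation (a ++ l) r.
Proof. intros H1 H2; rewrite H1, H2; auto. Qed.

Lemma perm_cancel_cons {A} x (l r r' : list A) :
  Permutation r ([x] ++ r') -> Permutation l r' -> Permutation (x :: l) r.
Proof. intros H1 H2; rewrite H1, H2; auto. Qed.

Lemma perm_close {A} (l r : list A) :
  Permutation (l ++ []) (r ++ []) -> Permutation l r.
Proof. rewrite !app_nil_r; auto. Qed.

Ltac perm_find :=
  first [ apply Permutation_refl
        | apply perm_skip_app; perm_find
        | apply perm_skip_cons; perm_find ].

Ltac perm_cancel :=
  first [ apply Permutation_refl
        | eapply perm_cancel_app; [perm_find|]; perm_cancel
        | eapply perm_cancel_cons; [perm_find|]; perm_cancel ].

(** Cancels the leading component on one side, an appended list or a single element, wherever it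
    occurs on the other. The [[]] added by [perm_close] gives the last component the same shape as
    the others. *)
Ltac perm :=
  apply perm_close; repeat (rewrite <- app_assoc || rewrite <- app_comm_cons);
  cbn [app]; perm_cancel.

Lemma prec_perm_l G1 G G' : Permutation G1 G -> prec G G' -> prec G1 G'.
Proof. intros; eapply prec_trans; [apply prec_refl|]; eauto. Qed.

Lemma prec_perm_r G G' G1 : prec G G' -> Permutation G' G1 -> prec G G1.
Proof. intros; eapply prec_trans; [|apply prec_refl]; eauto. Qed.

Lemma prec_frame_r H G G' : prec G G' -> prec (G ++ H) (G' ++ H).
Proof.
  induction 1; simpl; try (constructor; auto; fail).
  - apply prec_refl, Permutation_app_tail; auto.
  - eapply prec_trans; eauto.
Qed.

Lemma prec_frame_l H G G' : prec G G' -> prec (H ++ G) (H ++ G').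
Proof.
  intros HP; eapply prec_perm_l; [apply Permutation_app_comm|].
  eapply prec_perm_r; [apply prec_frame_r; eauto|apply Permutation_app_comm].
Qed.

Lemma prec_cons b G G' : prec G G' -> prec (b :: G) (b :: G').
Proof. apply (prec_frame_l [b]). Qed.

Lemma prec_app G1 G1' G2 G2' :
  prec G1 G1' -> prec G2 G2' -> prec (G1 ++ G2) (G1' ++ G2').
Proof.
  intros; eapply prec_trans; [apply prec_frame_r|apply prec_frame_l]; eauto.
Qed.

Lemma prec_app_l G H : prec (G ++ H) H.
Proof.
  induction G as [|[u T] G IH]; [apply prec_refl; auto|].
  eapply prec_trans; [apply prec_weak|exact IH].
Qed.

Lemma prec_app_r G H : prec (G ++ H) G.
Proof.
  eapply prec_perm_l; [apply Permutation_app_comm|apply prec_app_l].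
Qed.

Lemma prec_dom G G' u : prec G G' -> In u (dom G') -> In u (dom G).
Proof.
  induction 1; simpl; auto; try tauto.
  unfold dom; apply Permutation_in, Permutation_map, Permutation_sym; auto.
Qed.

Lemma dom_app G H : dom (G ++ H) = dom G ++ dom H.
Proof. apply map_app. Qed.

Definition map_names (f : name -> name) (G : env) : env :=
  map (fun b => (f (fst b), snd b)) G.

Lemma dom_map_names f G : dom (map_names f G) = map f (dom G).
Proof. unfold dom, map_names; rewrite !map_map; reflexivity. Qed.

Lemma map_names_app f G H : map_names f (G ++ H) = map_names f G ++ map_names f H.
Proof. apply map_app. Qed.

Lemma map_names_ext_in f g G :
  (forall u, In u (dom G) -> f u = g u) -> map_names f G = map_names g G.
Proof.
  intros H; apply map_ext_in; intros [u T] Hb; simpl; f_equal; apply H.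
  apply (in_map fst _ _ Hb).
Qed.

Lemma map_names_id f G : (forall u, In u (dom G) -> f u = u) -> map_names f G = G.
Proof.
  intros H; rewrite (map_names_ext_in f (fun u => u)) by auto.
  unfold map_names; rewrite <- (map_id G) at 2; apply map_ext; intros []; auto.
Qed.

Lemma map_names_comp f g G :
  map_names f (map_names g G) = map_names (fun u => f (g u)) G.
Proof. unfold map_names; rewrite map_map; auto. Qed.

(** Each rule of [prec] acts on assumptions for one name, whichever it is, so it survives even an
    [f] that identifies names, as a substitution may do. *)
Lemma prec_map_names f G G' : prec G G' -> prec (map_names f G) (map_names f G').
Proof.
  induction 1; simpl; try (constructor; auto; fail).
  - apply prec_refl, Permutation_map; auto.
  - eapply prec_trans; eauto.
Qed.

Definition keep_names (p : name -> bool) (G : env) : env :=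
  filter (fun b => p (fst b)) G.

Lemma Permutation_filter {A} (f : A -> bool) l l' :
  Permutation l l' -> Permutation (filter f l) (filter f l').
Proof.
  induction 1; simpl; auto.
  - destruct (f x); auto.
  - destruct (f x), (f y); auto. apply perm_swap.
  - etransitivity; eauto.
Qed.

Lemma keep_names_app p G H : keep_names p (G ++ H) = keep_names p G ++ keep_names p H.
Proof. apply filter_app. Qed.

Lemma prec_keep_names p G G' : prec G G' -> prec (keep_names p G) (keep_names p G').
Proof.
  induction 1; simpl;
    try (destruct (p u); [econstructor; eauto|apply prec_refl; auto]; fail).
  - apply prec_refl, Permutation_filter; auto.
  - eapply prec_trans; eauto.
Qed.

Lemma in_dom_keep_names p G u : In u (dom (keep_names p G)) -> In u (dom G).
Proof.
  unfold dom; rewrite !in_map_iff; intros (b & <- & H); exists b; split; auto.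
  apply filter_In in H; tauto.
Qed.

Lemma prec_contract G : unrestricted G -> prec G (G ++ G).
Proof.
  induction 1 as [|[u T] G HT HG IH]; simpl; [apply prec_refl; auto|].
  apply prec_trans with ((u, T) :: (u, T) :: G ++ G).
  - eapply prec_trans; [|apply prec_cons, prec_cons, IH].
    apply prec_split; simpl in HT; destruct HT as [->|[Ts ->]]; constructor.
  - apply prec_refl; perm.
Qed.

(** * Consistency *)

(** A channel type may be written with leading binders, so its object types and attribute are read
    off its unfolding. *)
Definition shape (Us : list uty) (T : ty) (a : attr) : Prop :=
  exists U Vs, T = TU U /\ unfolds (raw U) Vs a /\ Forall2 teq Us Vs.

Definition uniq_indices (al : list attr) : list nat :=
  flat_map (fun a => match a with Uniq i => [i] | _ => [] end) al.

Definition count_attr (a : attr) (al : list attr) : nat :=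
  length (filter (fun b => match a, b with
                           | Unr, Unr | One, One => true
                           | _, _ => false end) al).

(** Splitting [Uniq 0] repeatedly, [j] times, leaves [Uniq j] and [j] assumptions [One], some of
    which weakening may discard; hence the bound by the index. Once subtyping has given up
    uniqueness, any number of [Unr] and [One] may coexist. *)
Definition compatible (al : list attr) : Prop :=
  match uniq_indices al with
  | [] => True
  | [j] => count_attr Unr al = 0 /\ count_attr One al <= j
  | _ => False
  end.

(* The types that one name can have in a consistent environment: [prec]
   preserves this, and a single assumption satisfies it. *)
Definition coherent (l : list ty) : Prop :=
  Forall (fun T => T = TProc) l \/
  exists Us al, Forall2 (shape Us) l al /\ compatible al.

Definition types_of (u : name) (G : env) : list ty :=
  map snd (keep_names (fun v => if name_eq_dec u v then true else false) G).

Lemma types_of_cons u v T G :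
  types_of u ((v, T) :: G)
  = if name_eq_dec u v then T :: types_of u G else types_of u G.
Proof. unfold types_of; simpl; destruct (name_eq_dec u v); auto. Qed.

Lemma compatible_perm al bl : Permutation al bl -> compatible al -> compatible bl.
Proof.
  intros H; unfold compatible, count_attr.
  assert (HU : Permutation (uniq_indices al) (uniq_indices bl))
    by (apply Permutation_flat_map; auto).
  rewrite <- !(Permutation_length (Permutation_filter _ _ _ H)).
  destruct (uniq_indices al) as [|i [|i' li]].
  - apply Permutation_nil in HU as ->; auto.
  - apply Permutation_length_1_inv in HU as ->; auto.
  - tauto.
Qed.

Lemma Forall2_perm_l {A B} (R : A -> B -> Prop) l l' m :
  Permutation l l' -> Forall2 R l m -> exists m', Permutation m m' /\ Forall2 R l' m'.
Proof.
  intros H; revert m; induction H; intros m HF.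
  - inversion HF; subst; exists []; auto.
  - inversion HF as [|? y ? m0 ? H1]; subst. destruct (IHPermutation _ H1) as (m' & ? & ?).
    exists (y :: m'); auto.
  - inversion HF as [|? b ? m0 ? H1]; subst. inversion H1 as [|? c ? m1 ? ?]; subst.
    exists (c :: b :: m1); split; [apply perm_swap|]; auto.
  - destruct (IHPermutation1 _ HF) as (m1 & ? & HF1).
    destruct (IHPermutation2 _ HF1) as (m2 & ? & ?). exists m2; split; auto.
    etransitivity; eauto.
Qed.

Lemma coherent_perm l l' : Permutation l l' -> coherent l -> coherent l'.
Proof.
  intros H [HF|(Us & al & HF & Hc)].
  - left; rewrite Forall_forall in *; intros T HT; apply HF.
    eapply Permutation_in; [symmetry|]; eauto.
  - right. destruct (Forall2_perm_l _ _ _ _ H HF) as (al' & Hp & HF').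
    exists Us, al'; split; auto; eapply compatible_perm; eauto.
Qed.

Ltac compat := unfold compatible, count_attr, uniq_indices in *; simpl in *;
  repeat match goal with
  | H : context [match ?l with _ => _ end] |- _ => destruct l; simpl in *
  | |- context [match ?l with _ => _ end] => destruct l; simpl in *
  end; try tauto; try lia.

(** Subtyping out of [Uniq i] either raises the bound on the affine assumptions or removes the only
    unique attribute, after which nothing is demanded. *)
Lemma compatible_sub a b al : attr_sub a b -> compatible (a :: al) -> compatible (b :: al).
Proof.
  intros H; revert al; induction H; intros al Hc; auto; compat.
Qed.

Lemma compatible_tail a al : compatible (a :: al) -> compatible al.
Proof. destruct a; intros H; compat. Qed.

Lemma shape_chan Us Ts a b :
  shape Us (TU (chanT Ts a)) b -> a = b /\ Forall2 teq Us (map raw Ts).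
Proof.
  intros (U & Vs & HU & Hu & HF). inversion HU; subst; simpl in Hu.
  inversion Hu; subst; auto.
Qed.

Lemma shape_chan_intro Us Ts a :
  Forall2 teq Us (map raw Ts) -> shape Us (TU (chanT Ts a)) a.
Proof.
  intros H; exists (chanT Ts a), (map raw Ts); repeat split; auto; constructor.
Qed.

Lemma shape_eq Us T1 T2 a : ty_eq T1 T2 -> shape Us T1 a -> shape Us T2 a.
Proof.
  intros [U V H|]; auto. intros (U' & Vs & HU & Hu & HF). inversion HU; subst U'.
  destruct (teq_unfolds _ _ H) as (Xs & Ys & b & H1 & H2 & H3).
  destruct (unfolds_det _ _ _ _ _ Hu H1) as [-> ->].
  exists V, Ys; repeat split; auto. eapply Forall2_teq_trans; eauto.
Qed.

Lemma coherent_singleton T : coherent [T].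
Proof.
  destruct T as [[U HU]|]; [right|left; auto].
  destruct (wf_unfolds U HU) as (Us & a & Hu & HUs).
  exists Us, [a]; split.
  - constructor; auto. exists (Cty U HU), Us; repeat split; auto.
    clear Hu; induction HUs; constructor; auto; apply teq_refl; auto.
  - destruct a; compat.
Qed.

Ltac inv_shapes := repeat match goal with
  | H : Forall2 (shape _) (_ :: _) _ |- _ => inversion H; clear H; subst
  | H : shape _ (TU (chanT _ _)) _ |- _ => apply shape_chan in H as [<- ?]
  | H : shape _ TProc _ |- _ => destruct H as (? & ? & ? & ?); discriminate
  | H : Forall (fun T => T = TProc) (_ :: _) |- _ => inversion H; clear H; subst
  end; try discriminate.

(** Splitting [Uniq i] adds one [One] and raises the index by one, and a join undoes both, so the
    bound in [compatible] is kept. Subtyping and weakening only relax it. *)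
Lemma coherent_prec G G' : prec G G' ->
  (forall u, coherent (types_of u G)) -> forall u, coherent (types_of u G').
Proof.
  induction 1; intros HG v.
  - eapply coherent_perm; [|apply HG]. apply Permutation_map, Permutation_filter; auto.
  - auto.
  - specialize (HG v); rewrite !types_of_cons in *; destruct (name_eq_dec v u); auto.
    destruct HG as [HF|(Us & al & HF & Hc)].
    + destruct H; inv_shapes. left; auto.
    + destruct H; inv_shapes; right.
      * exists Us, (Unr :: Unr :: l'); split;
          [repeat constructor; auto; apply shape_chan_intro; auto|compat].
      * exists Us, (One :: Uniq (S i) :: l'); split;
          [repeat constructor; auto; apply shape_chan_intro; auto|compat].
  - specialize (HG v); rewrite !types_of_cons in *; destruct (name_eq_dec v u); auto.
    destruct HG as [HF|(Us & al & HF & Hc)].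
    + destruct H; inv_shapes. left; auto.
    + destruct H; inv_shapes; right.
      * exists Us, (Unr :: l'0); split;
          [repeat constructor; auto; apply shape_chan_intro; auto|compat].
      * exists Us, (Uniq i :: l'0); split;
          [repeat constructor; auto; apply shape_chan_intro; auto|compat].
  - specialize (HG v); rewrite !types_of_cons in *; destruct (name_eq_dec v u); auto.
    destruct HG as [HF|(Us & al & HF & Hc)].
    + inversion HF; subst. inversion H; subst; left; auto.
    + right; inversion HF; subst. exists Us, (y :: l'); split; auto.
      constructor; auto; eapply shape_eq; eauto.
  - specialize (HG v); rewrite !types_of_cons in *; destruct (name_eq_dec v u); auto.
    destruct H; destruct HG as [HF|(Us & al & HF & Hc)]; inv_shapes.
    right; exists Us, (b :: l'); split; [|eapply compatible_sub; eauto].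
    constructor; auto; apply shape_chan_intro; auto.
  - specialize (HG v); rewrite !types_of_cons in *; destruct (name_eq_dec v u); auto.
    destruct HG as [HF|(Us & al & HF & Hc)]; inversion HF; subst.
    + left; auto.
    + right; exists Us, l'; split; auto; eapply compatible_tail; eauto.
  - specialize (HG v); rewrite !types_of_cons in *; destruct (name_eq_dec v u); auto.
    destruct HG as [HF|(Us & al & HF & Hc)]; inv_shapes.
    (* [prec_rev] changes the object types arbitrarily. Next to [Uniq 0], [compatible] admits no
       other assumption, so [Us] can be chosen anew. *)
    destruct l' as [|b l'].
    + inversion H3; subst; apply coherent_singleton.
    + destruct b; compat.
Qed.

Lemma consistent_coherent G u : consistent G -> coherent (types_of u G).
Proof.
  intros (G' & HN & HP); revert u; apply (coherent_prec _ _ HP); intros u.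
  assert (Hl : length (types_of u G') <= 1).
  { clear HP; induction G' as [|[v T] G' IH]; [simpl; auto|].
    inversion HN as [|? ? Hv HN']; subst. rewrite types_of_cons.
    destruct (name_eq_dec u v) as [->|]; auto. simpl.
    enough (types_of v G' = []) as ->; auto.
    clear -Hv; induction G' as [|[w T'] G' IH]; auto.
    rewrite types_of_cons; simpl in Hv.
    destruct (name_eq_dec v w) as [->|]; [|apply IH]; tauto. }
  destruct (types_of u G') as [|T [|]]; simpl in Hl; try lia.
  - left; constructor.
  - apply coherent_singleton.
Qed.

Lemma consistent_prec G G' : consistent G -> prec G G' -> consistent G'.
Proof. intros (H & ? & ?) ?; exists H; split; auto; eapply prec_trans; eauto. Qed.

(** [T1] is arbitrary because an observer's assumption on a channel need not be written as a
    [chanT]. The channel type beside it rules out [TProc] and determines the object types. *)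
Lemma consistent_pair u T1 Ts2 a2 G : consistent ((u, T1) :: (u, TU (chanT Ts2 a2)) :: G) ->
  exists a1, ty_eq T1 (TU (chanT Ts2 a1)) /\ shape (map raw Ts2) T1 a1
             /\ compatible [a1; a2].
Proof.
  intros H. apply (consistent_coherent _ u) in H. rewrite !types_of_cons in H.
  destruct (name_eq_dec u u) as [_|]; [|tauto].
  destruct H as [HF|(Us & al & HF & Hc)]; [inv_shapes|].
  inversion HF as [|? a1 ? al1 HT1 HF1]; subst.
  inversion HF1 as [|? b ? al2 HT2 HF2]; subst.
  apply shape_chan in HT2 as [<- HT2].
  destruct HT1 as (U & Vs & -> & Hu & HV). exists a1; split; [|split].
  - constructor. eapply teq_fold; [exact Hu|constructor|].
    eapply Forall2_teq_trans; [apply Forall2_teq_sym|]; eauto.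
  - exists U, Vs; repeat split; auto.
    eapply Forall2_teq_trans; [apply Forall2_teq_sym|]; eauto.
  - clear -Hc; induction al2 as [|b l IH]; auto.
    apply IH, compatible_tail with b. eapply compatible_perm; [|exact Hc]; perm.
Qed.

Lemma prec_bindings us Ts1 Ts2 G : Forall2 teq (map raw Ts1) (map raw Ts2) ->
  prec (bindings us Ts1 ++ G) (bindings us Ts2 ++ G).
Proof.
  intros H; apply prec_frame_r; revert us Ts2 H.
  induction Ts1 as [|T1 Ts1 IH]; intros us [|T2 Ts2] H; inversion H; subst.
  - apply prec_refl; auto.
  - destruct us as [|u us]; [apply prec_refl; auto|]. unfold bindings; simpl.
    eapply prec_trans; [apply prec_eq; constructor; eauto|].
    apply prec_cons, IH; auto.
Qed.

(* Both parties of a communication on [c] consume their assumption; if one of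
   them is unique the other is affine, and joining them pays for the decrement. *)
Lemma prec_com c Ts1 a1 D1 Ts2 a2 D2 us G :
  consistent (assume c Ts1 a1 :: assume c Ts2 a2 :: G) ->
  decr c Ts1 a1 = Some D1 -> decr c Ts2 a2 = Some D2 ->
  prec (assume c Ts1 a1 :: assume c Ts2 a2 :: bindings us Ts1 ++ G)
       (D1 ++ D2 ++ bindings us Ts2 ++ G).
Proof.
  intros HC H1 H2. destruct (consistent_pair _ _ _ _ _ HC) as (a & _ & Hs & Hc).
  apply shape_chan in Hs as [<- HT].
  assert (HB : prec (bindings us Ts1 ++ G) (bindings us Ts2 ++ G)).
  { apply prec_bindings, Forall2_teq_sym; auto. }
  assert (HE : forall a, ty_eq (TU (chanT Ts1 a)) (TU (chanT Ts2 a))).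
  { intros a; constructor. eapply teq_fold; [constructor..|].
    apply Forall2_teq_sym; auto. }
  assert (HE' : forall a, ty_eq (TU (chanT Ts2 a)) (TU (chanT Ts1 a))).
  { intros a; constructor. eapply teq_fold; [constructor..|]; auto. }
  eapply prec_trans; [apply prec_cons, prec_cons, HB|].
  (* [compatible] rules out a unique attribute next to [Unr] or to another unique one. If one party
     has [Uniq (S i)] and the other [One], their join is [Uniq i], exactly what the decrement
     leaves. The other cases need at most weakening. *)
  destruct a1 as [| |[|i]], a2 as [| |[|j]]; inversion H1; inversion H2; subst; simpl;
    try (exfalso; compat; fail).
  - apply prec_refl; auto.
  - apply prec_cons, prec_weak.
  - apply prec_weak.
  - eapply prec_trans; [apply prec_weak|apply prec_weak].
  - eapply prec_trans; [apply prec_eq, HE|]. apply prec_join; constructor.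
  - apply prec_trans with (assume c Ts1 One :: assume c Ts1 (Uniq (S i))
                             :: bindings us Ts2 ++ G).
    + eapply prec_perm_l; [apply perm_swap|]. apply prec_eq, HE'.
    + apply prec_join; constructor.
Qed.

(** * Typing *)

Lemma typed_out_inv G u vs P : typed G (Out u vs P) ->
  exists Ts a D G0, prec G (assume u Ts a :: bindings vs Ts ++ G0)
    /\ decr u Ts a = Some D /\ same_length vs Ts /\ typed (D ++ G0) P.
Proof.
  intros H; remember (Out u vs P) as X; induction H; inversion HeqX; subst.
  - exists Ts, a, D, G; repeat split; auto. apply prec_refl; auto.
  - destruct IHtyped as (Ts & a & D & G0 & ? & ? & ? & ?); auto.
    exists Ts, a, D, G0; repeat split; auto; eapply prec_trans; eauto.
Qed.

Lemma typed_inp_inv G u xs P : typed G (Inp u xs P) ->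
  exists Ts a D G0, prec G (assume u Ts a :: G0)
    /\ decr u Ts a = Some D /\ same_length xs Ts /\ NoDup xs
    /\ (forall x, In x xs -> ~ In (NId (Var x)) (dom (D ++ G0)))
    /\ typed (bindings (map Var xs) Ts ++ D ++ G0) P.
Proof.
  intros H; remember (Inp u xs P) as X; induction H; inversion HeqX; subst.
  - exists Ts, a, D, G; split; auto. apply prec_refl; auto.
  - destruct IHtyped as (Ts & a & D & G0 & ? & ?); auto.
    exists Ts, a, D, G0; split; auto; eapply prec_trans; eauto.
Qed.

Lemma typed_par_inv G P Q : typed G (Par P Q) ->
  exists G1 G2, prec G (G1 ++ G2) /\ typed G1 P /\ typed G2 Q.
Proof.
  intros H; remember (Par P Q) as X; induction H; inversion HeqX; subst.
  - exists G1, G2; repeat split; auto; apply prec_refl; auto.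
  - destruct IHtyped as (G1 & G2 & ? & ?); auto.
    exists G1, G2; split; auto; eapply prec_trans; eauto.
Qed.

Lemma typed_if_inv G u v P Q : typed G (If u v P Q) ->
  exists G', prec G G' /\ In (NId u) (dom G') /\ In (NId v) (dom G')
    /\ typed G' P /\ typed G' Q.
Proof.
  intros H; remember (If u v P Q) as X; induction H; inversion HeqX; subst.
  - exists G; repeat split; auto; apply prec_refl; auto.
  - destruct IHtyped as (G1 & ? & ?); auto.
    exists G1; split; auto; eapply prec_trans; eauto.
Qed.

Lemma typed_rec_inv G w P : typed G (Rec w P) ->
  exists G', prec G G' /\ unrestricted G' /\ ~ In (NPv w) (dom G')
    /\ typed ((NPv w, TProc) :: G') P.
Proof.
  intros H; remember (Rec w P) as X; induction H; inversion HeqX; subst.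
  - exists G; repeat split; auto; apply prec_refl; auto.
  - destruct IHtyped as (G1 & ? & ?); auto.
    exists G1; split; auto; eapply prec_trans; eauto.
Qed.

Lemma typed_free_inv G u P : typed G (Free u P) ->
  exists Ts G', prec G (assume u Ts (Uniq 0) :: G') /\ typed G' P.
Proof.
  intros H; remember (Free u P) as X; induction H; inversion HeqX; subst.
  - exists Ts, G; repeat split; auto; apply prec_refl; auto.
  - destruct IHtyped as (Ts & G1 & ? & ?); auto.
    exists Ts, G1; split; auto; eapply prec_trans; eauto.
Qed.

Lemma typed_alloc_inv G x P : typed G (Alloc x P) ->
  exists Ts G', prec G G' /\ ~ In (NId (Var x)) (dom G')
    /\ typed (assume (Var x) Ts (Uniq 0) :: G') P.
Proof.
  intros H; remember (Alloc x P) as X; induction H; inversion HeqX; subst.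
  - exists Ts, G; repeat split; auto; apply prec_refl; auto.
  - destruct IHtyped as (Ts & G1 & ? & ?); auto.
    exists Ts, G1; split; auto; eapply prec_trans; eauto.
Qed.

Lemma typed_perm G G' P : typed G P -> Permutation G G' -> typed G' P.
Proof. intros; eapply t_str; [eauto|]. apply prec_refl; symmetry; auto. Qed.

Lemma typed_nil G : typed G Nil.
Proof.
  eapply t_str; [apply t_nil|]. rewrite <- (app_nil_r G); apply prec_app_l.
Qed.

(** Typing is insensitive to the order and grouping of an environment, and the share that goes to
    [Nil] is discarded by weakening. *)
Lemma typed_struct P Q : struct P Q -> forall G, typed G P <-> typed G Q.
Proof.
  induction 1; intros G.
  - tauto.
  - symmetry; auto.
  - rewrite IHstruct1; auto.
  - assert (HC : forall P Q, typed G (Par P Q) -> typed G (Par Q P)).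
    { intros P' Q' (G1 & G2 & H & ? & ?)%typed_par_inv.
      eapply t_str; [apply t_par; eauto|]. eapply prec_perm_r; [exact H|perm]. }
    split; apply HC.
  - split.
    + intros (G1 & G2 & H & HP & HQ)%typed_par_inv.
      apply typed_par_inv in HQ as (G3 & G4 & H2 & ? & ?).
      eapply t_str; [apply t_par; [apply t_par|]; eauto|].
      rewrite <- app_assoc. eapply prec_trans; [exact H|apply prec_frame_l; auto].
    + intros (G1 & G2 & H & HP & HQ)%typed_par_inv.
      apply typed_par_inv in HP as (G3 & G4 & H2 & ? & ?).
      eapply t_str; [apply t_par; [|apply t_par]; eauto|].
      rewrite app_assoc. eapply prec_trans; [exact H|apply prec_frame_r; auto].
  - split.
    + intros (G1 & G2 & H & ? & ?)%typed_par_inv.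
      eapply t_str; [eauto|]. eapply prec_trans; [exact H|apply prec_app_r].
    + intros H; rewrite <- (app_nil_r G); apply t_par; [auto|apply t_nil].
  - split; intros (Ts & a & D & G0 & Hp & ? & ? & ?)%typed_out_inv;
      (eapply t_str; [eapply t_out|exact Hp]; eauto; apply IHstruct; auto).
  - split; intros (Ts & a & D & G0 & Hp & ? & ? & ? & ? & ?)%typed_inp_inv;
      (eapply t_str; [eapply t_inp|exact Hp]; eauto; apply IHstruct; auto).
  - split; intros (G' & Hp & ? & ? & ? & ?)%typed_if_inv;
      (eapply t_str; [apply t_if|exact Hp]; auto;
       solve [apply IHstruct1; auto|apply IHstruct2; auto]).
  - split; intros (G' & Hp & ? & ? & ?)%typed_rec_inv;
      (eapply t_str; [apply t_rec|exact Hp]; auto; apply IHstruct; auto).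
  - split; intros (G1 & G2 & Hp & ? & ?)%typed_par_inv;
      (eapply t_str; [apply t_par|exact Hp];
       solve [apply IHstruct1; auto|apply IHstruct2; auto]).
  - split; intros (Ts & G' & Hp & ? & ?)%typed_alloc_inv;
      (eapply t_str; [|exact Hp]; apply t_alloc with Ts; auto; apply IHstruct; auto).
  - split; intros (Ts & G' & Hp & ?)%typed_free_inv;
      (eapply t_str; [apply t_free|exact Hp]; apply IHstruct; auto).
Qed.

(** * Typing under substitution of channels and under renaming *)

Definition subst_name (f : var -> ident) (u : name) : name :=
  match u with NId u => NId (subst_ident f u) | NPv w => NPv w end.

Definition ren_name (s : channel -> channel) (u : name) : name :=
  match u with NId u => NId (ren_ident s u) | NPv w => NPv w end.

Definition ren_env (s : channel -> channel) : env -> env := map_names (ren_name s).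

Lemma map_names_bindings f g us Ts : (forall u, f (NId u) = NId (g u)) ->
  map_names f (bindings us Ts) = bindings (map g us) Ts.
Proof.
  intros H; revert Ts; induction us as [|u us IH]; intros [|T Ts]; auto.
  unfold bindings in *; simpl; rewrite H; f_equal; apply IH.
Qed.

Lemma map_names_decr f g u Ts a D : (forall u, f (NId u) = NId (g u)) ->
  decr u Ts a = Some D -> decr (g u) Ts a = Some (map_names f D).
Proof.
  intros H; destruct a as [| |[|i]]; simpl; intros HD; inversion HD; subst; simpl;
    rewrite ?H; auto.
Qed.

Lemma unrestricted_map_names f G : unrestricted G -> unrestricted (map_names f G).
Proof. intros H; apply Forall_map; eapply Forall_impl; [|exact H]; auto. Qed.

Lemma in_dom_map_names f G u : In u (dom G) -> In (f u) (dom (map_names f G)).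
Proof. rewrite dom_map_names; apply in_map. Qed.

Definition to_channels (f : var -> ident) : Prop :=
  forall x, f x = Var x \/ exists d, f x = Ch d.

Lemma to_channels_mask xs f : to_channels f -> to_channels (mask xs f).
Proof. intros H x; unfold mask; destruct (in_dec _ _ _); auto. Qed.

Lemma to_channels_fresh f G x : to_channels f ->
  In (NId (Var x)) (dom (map_names (subst_name f) G)) -> In (NId (Var x)) (dom G).
Proof.
  intros Hf; rewrite dom_map_names, in_map_iff.
  intros ([[d|y]|w] & Hu & HI); try discriminate. simpl in Hu.
  destruct (Hf y) as [E|[d E]]; rewrite E in Hu; inversion Hu; subst; auto.
Qed.

Lemma map_names_mask xs f G :
  (forall x, In x xs -> ~ In (NId (Var x)) (dom G)) ->
  map_names (subst_name (mask xs f)) G = map_names (subst_name f) G.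
Proof.
  intros H; apply map_names_ext_in; intros [[d|y]|w] HI; auto; simpl.
  unfold mask; destruct (in_dec _ _ _) as [Hy|]; auto. destruct (H y Hy HI).
Qed.

Lemma map_subst_mask xs f : map (subst_ident (mask xs f)) (map Var xs) = map Var xs.
Proof.
  rewrite map_map; apply map_ext_in; intros x Hx; simpl; unfold mask.
  destruct (in_dec _ _ _); tauto.
Qed.

(** Several variables may be sent to one channel: their assumptions then stand side by side in the
    multiset. Bound variables stay fresh because only channels enter the environment, and [mask]
    protects them in the body. *)
Lemma typed_subst G P : typed G P -> forall f, to_channels f ->
  typed (map_names (subst_name f) G) (subst f P).
Proof.
  induction 1; intros f Hf; simpl.
  - rewrite map_names_app, (map_names_bindings _ (subst_ident f)) by auto.
    eapply t_out with (D := map_names (subst_name f) D).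
    + apply map_names_decr; auto.
    + unfold same_length; rewrite length_map; auto.
    + rewrite <- map_names_app; auto.
  - eapply t_inp with (D := map_names (subst_name f) D); auto.
    + apply map_names_decr; auto.
    + intros x Hx HI; rewrite <- map_names_app in HI.
      apply to_channels_fresh in HI; auto. eapply H2; eauto.
    + specialize (IHtyped (mask xs f) (to_channels_mask _ _ Hf)).
      rewrite map_names_app, (map_names_bindings _ (subst_ident (mask xs f))) in IHtyped
        by auto.
      rewrite map_subst_mask, map_names_mask, map_names_app in IHtyped; auto.
  - rewrite map_names_app; apply t_par; auto.
  - apply t_if; auto; apply (in_dom_map_names (subst_name f) G (NId _)); auto.
  - apply t_rec; auto.
    + apply unrestricted_map_names; auto.
    + rewrite dom_map_names, in_map_iff; intros ([|] & Hu & HI); simpl in Hu; congruence.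
    + apply IHtyped; auto.
  - constructor.
  - apply t_free; auto.
  - apply t_alloc with Ts.
    + intros HI; apply to_channels_fresh in HI; auto.
    + specialize (IHtyped (mask [x] f) (to_channels_mask _ _ Hf)); simpl in IHtyped.
      rewrite map_names_mask in IHtyped; [|intros y [<-|[]]; auto].
      unfold mask at 1 in IHtyped. destruct (in_dec Nat.eq_dec x [x]) as [_|n]; auto.
      destruct n; simpl; auto.
  - constructor.
  - eapply t_str; [apply IHtyped; auto|apply prec_map_names; auto].
Qed.

Lemma to_chans_to_channels xs : forall ds, to_channels (to_chans xs ds).
Proof.
  induction xs as [|x xs IH]; intros [|d ds] y; simpl; auto.
  destruct (Nat.eq_dec x y); eauto. apply IH.
Qed.

Lemma to_chans_notin xs y : ~ In y xs -> forall ds, to_chans xs ds y = Var y.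
Proof.
  induction xs as [|x xs IH]; intros Hy [|d ds]; simpl in *; auto.
  destruct (Nat.eq_dec x y); [tauto|]. apply IH; tauto.
Qed.

Lemma map_to_chans xs : NoDup xs -> forall ds, length ds = length xs ->
  map (subst_ident (to_chans xs ds)) (map Var xs) = map Ch ds.
Proof.
  induction 1 as [|x xs Hx HN IH]; intros [|d ds] Hl; simpl in *; try discriminate; auto.
  destruct (Nat.eq_dec x x); [|tauto]. f_equal. rewrite <- IH by lia.
  rewrite !map_map; apply map_ext_in; intros y Hy; simpl.
  destruct (Nat.eq_dec x y); subst; tauto.
Qed.

Lemma typed_subst_chans xs ds Ts G P :
  NoDup xs -> length ds = length xs ->
  (forall x, In x xs -> ~ In (NId (Var x)) (dom G)) ->
  typed (bindings (map Var xs) Ts ++ G) P ->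
  typed (bindings (map Ch ds) Ts ++ G) (subst (to_chans xs ds) P).
Proof.
  intros HN Hl HF H. apply typed_subst with (f := to_chans xs ds) in H;
    [|apply to_chans_to_channels].
  rewrite map_names_app, (map_names_bindings _ (subst_ident (to_chans xs ds))) in H by auto.
  rewrite map_to_chans, (map_names_id _ G) in H; auto.
  intros [[d|y]|w] HI; auto; simpl. rewrite to_chans_notin; auto.
  intros Hy; eapply HF; eauto.
Qed.

Lemma typed_ren s G P : typed G P -> typed (ren_env s G) (ren s P).
Proof.
  unfold ren_env; induction 1; simpl.
  - rewrite map_names_app, (map_names_bindings _ (ren_ident s)) by auto.
    eapply t_out with (D := map_names (ren_name s) D).
    + apply map_names_decr; auto.
    + unfold same_length; rewrite length_map; auto.
    + rewrite <- map_names_app; auto.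
  - eapply t_inp with (D := map_names (ren_name s) D); auto.
    + apply map_names_decr; auto.
    + intros x Hx; rewrite <- map_names_app, dom_map_names, in_map_iff.
      intros ([[d|y]|w] & Hu & HI); inversion Hu; subst. eapply H2; eauto.
    + rewrite !map_names_app, (map_names_bindings _ (ren_ident s)) in IHtyped by auto.
      rewrite map_map in IHtyped; auto.
  - rewrite map_names_app; apply t_par; auto.
  - apply t_if; auto; apply (in_dom_map_names (ren_name s) G (NId _)); auto.
  - apply t_rec; auto.
    + apply unrestricted_map_names; auto.
    + rewrite dom_map_names, in_map_iff; intros ([|] & Hu & HI); simpl in Hu; congruence.
  - constructor.
  - apply t_free; auto.
  - apply t_alloc with Ts; auto.
    rewrite dom_map_names, in_map_iff; intros ([[|]|] & Hu & HI); simpl in Hu; congruence.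
  - constructor.
  - eapply t_str; [apply IHtyped; auto|apply prec_map_names; auto].
Qed.

(** * The channels and variables of a typed process *)

Lemma in_dom_bindings us Ts u : same_length us Ts -> In u us ->
  In (NId u) (dom (bindings us Ts)).
Proof.
  unfold same_length; revert Ts; induction us as [|v us IH]; intros [|T Ts] Hl; simpl;
    try discriminate; intros []; subst; auto.
  right; apply IH; auto.
Qed.

Lemma ren_ident_agree s t u G :
  (forall c, In (NId (Ch c)) (dom G) -> s c = t c) ->
  In (NId u) (dom G) -> ren_ident s u = ren_ident t u.
Proof. intros H; destruct u; intros; simpl; auto; rewrite H; auto. Qed.

Lemma in_dom_decr c u Ts a D : decr u Ts a = Some D -> In c (dom D) -> c = NId u.
Proof.
  destruct a as [| |[|i]]; simpl; intros HD; inversion HD; subst; simpl;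
    tauto || intros [|[]]; auto.
Qed.

Lemma in_dom_bindings_var c xs : forall Ts,
  ~ In (NId (Ch c)) (dom (bindings (map Var xs) Ts)).
Proof.
  induction xs as [|x xs IH]; intros [|T Ts]; simpl; auto.
  intros [|H]; [discriminate|]. eapply IH; eauto.
Qed.

(** Every channel that occurs in a typed process has an assumption in its environment. This is what
    lets a renaming leave a typed context alone. *)
Lemma ren_agree G P : typed G P -> forall s t,
  (forall c, In (NId (Ch c)) (dom G) -> s c = t c) -> ren s P = ren t P.
Proof.
  induction 1; intros s t HE; simpl.
  - assert (HE' : forall c, In (NId (Ch c)) (dom (D ++ G)) -> s c = t c).
    { intros c; rewrite dom_app, in_app_iff; intros [HI|HI]; apply HE; simpl.
      - left; symmetry; eapply in_dom_decr; eauto.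
      - right; rewrite dom_app, in_app_iff; auto. }
    rewrite (IHtyped s t); auto. f_equal.
    + eapply ren_ident_agree; [exact HE|]; simpl; auto.
    + apply map_ext_in; intros v Hv; eapply ren_ident_agree; [exact HE|]; simpl.
      right; rewrite dom_app, in_app_iff; left; apply in_dom_bindings; auto.
  - rewrite (IHtyped s t); [f_equal|].
    + eapply ren_ident_agree; [exact HE|]; simpl; auto.
    + intros c; rewrite !dom_app, !in_app_iff; intros [HI|[HI|HI]].
      * destruct (in_dom_bindings_var _ _ _ HI).
      * apply HE; simpl; left; symmetry; eapply in_dom_decr; eauto.
      * apply HE; simpl; auto.
  - rewrite (IHtyped1 s t), (IHtyped2 s t); auto;
      intros; apply HE; rewrite dom_app, in_app_iff; auto.
  - rewrite (IHtyped1 s t), (IHtyped2 s t); auto.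
    f_equal; eapply ren_ident_agree; eauto.
  - rewrite (IHtyped s t); auto. simpl; intros c [|]; [discriminate|auto].
  - auto.
  - rewrite (IHtyped s t); [f_equal|].
    + eapply ren_ident_agree; [exact HE|]; simpl; auto.
    + intros; apply HE; simpl; auto.
  - rewrite (IHtyped s t); auto. simpl; intros c [|]; [discriminate|auto].
  - auto.
  - apply IHtyped; intros; apply HE; eapply prec_dom; eauto.
Qed.

Lemma ident_closed_dom G xs u :
  (forall x, In (NId (Var x)) (dom G) -> In x xs) ->
  In (NId u) (dom G) -> ident_closed xs u.
Proof. destruct u; simpl; auto. Qed.

Lemma in_dom_bindings_inv x us : forall Ts,
  In (NId x) (dom (bindings us Ts)) -> In x us.
Proof.
  induction us as [|v us IH]; intros [|T Ts]; simpl; try tauto.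
  intros [H|H]; [inversion H; auto|right; eapply IH; eauto].
Qed.

Lemma typed_closed_in G P : typed G P -> forall xs ws,
  (forall x, In (NId (Var x)) (dom G) -> In x xs) ->
  (forall w, In (NPv w) (dom G) -> In w ws) -> closed_in xs ws P.
Proof.
  assert (HB : forall w us Ts, ~ In (NPv w) (dom (bindings us Ts))).
  { intros w us; induction us as [|v us IH]; intros [|T Ts]; simpl; auto.
    intros [|HI]; [discriminate|]. eapply IH; eauto. }
  induction 1; intros ys ws HX HW; simpl.
  - repeat split.
    + eapply ident_closed_dom; [exact HX|]; simpl; auto.
    + apply Forall_forall; intros v Hv; eapply ident_closed_dom; [exact HX|]; simpl.
      right; rewrite dom_app, in_app_iff; left; apply in_dom_bindings; auto.
    + apply IHtyped; intros z; rewrite dom_app, in_app_iff; intros [HI|HI].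
      * apply HX; left; symmetry; eapply in_dom_decr; eauto.
      * apply HX; simpl; rewrite dom_app, in_app_iff; auto.
      * apply HW; left; symmetry; eapply in_dom_decr; eauto.
      * apply HW; simpl; rewrite dom_app, in_app_iff; auto.
  - split.
    + eapply ident_closed_dom; [exact HX|]; simpl; auto.
    + apply IHtyped; intros z; rewrite !dom_app, !in_app_iff; intros [HI|[HI|HI]].
      * left; apply in_dom_bindings_inv, in_map_iff in HI as (y & Hy & ?).
        inversion Hy; subst; auto.
      * right; apply HX; left; symmetry; eapply in_dom_decr; eauto.
      * right; apply HX; simpl; auto.
      * destruct (HB _ _ _ HI).
      * apply HW; left; symmetry; eapply in_dom_decr; eauto.
      * apply HW; simpl; auto.
  - split; [apply IHtyped1|apply IHtyped2]; intros z HI;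
      solve [apply HX; rewrite dom_app, in_app_iff; auto
            |apply HW; rewrite dom_app, in_app_iff; auto].
  - repeat split; auto; eapply ident_closed_dom; eauto.
  - apply IHtyped; simpl.
    + intros x [|]; [discriminate|auto].
    + intros w' [HI|]; [inversion HI|]; auto.
  - apply HW; simpl; auto.
  - split.
    + eapply ident_closed_dom; [exact HX|]; simpl; auto.
    + apply IHtyped; intros; [apply HX|apply HW]; simpl; auto.
  - apply IHtyped; simpl.
    + intros y [HI|]; [inversion HI|]; auto.
    + intros w' [HI|]; [inversion HI|]; auto.
  - auto.
  - apply IHtyped; intros; [apply HX|apply HW]; eapply prec_dom; eauto.
Qed.

Definition chan_env (G : env) : Prop :=
  forall u, In u (dom G) -> exists c, u = NId (Ch c).

Lemma chan_env_prec G G' : prec G G' -> chan_env G -> chan_env G'.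
Proof. intros HP H u Hu; apply H; eapply prec_dom; eauto. Qed.

Lemma typed_closed G P : chan_env G -> typed G P -> closed P.
Proof.
  intros HG HT; eapply typed_closed_in; eauto; intros x Hx;
    destruct (HG _ Hx) as [c Hc]; discriminate.
Qed.

(** * Typing under unfolding of recursion *)

Definition other_than (w : pvar) (u : name) : bool :=
  if name_eq_dec u (NPv w) then false else true.

Lemma other_than_id w u : other_than w (NId u) = true.
Proof. unfold other_than; destruct (name_eq_dec _ _); auto; discriminate. Qed.

Lemma keep_ids w G : (forall u, In u (dom G) -> exists v, u = NId v) ->
  keep_names (other_than w) G = G.
Proof.
  induction G as [|[u T] G IH]; intros H; auto; simpl.
  destruct (H u) as [v ->]; simpl; auto. rewrite other_than_id, IH; auto.
  intros; apply H; simpl; auto.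
Qed.

Lemma bindings_ids us u : forall Ts, In u (dom (bindings us Ts)) -> exists v, u = NId v.
Proof.
  induction us as [|x us IH]; intros [|T Ts]; simpl; try tauto.
  intros [<-|H]; eauto; eapply IH; eauto.
Qed.

Lemma decr_ids u Ts a D x : decr u Ts a = Some D -> In x (dom D) -> exists v, x = NId v.
Proof. intros H HI; exists u; eapply in_dom_decr; eauto. Qed.

Lemma keep_notin w G : ~ In (NPv w) (dom G) -> keep_names (other_than w) G = G.
Proof.
  induction G as [|[u T] G IH]; intros H; auto; simpl in *.
  unfold other_than at 1; destruct (name_eq_dec u (NPv w)); [subst; tauto|].
  rewrite IH; auto.
Qed.

(** The assumptions on [w] are filtered out, since [TProc] splits and there may be any number of
    them. [G] is unrestricted so that both halves of a parallel composition get a copy, and it holds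
    only channels so that it clashes with no bound variable. *)
Lemma typed_psubst E P : typed E P -> forall G w R,
  chan_env G -> unrestricted G -> typed G R ->
  typed (G ++ keep_names (other_than w) E) (psubst w R P).
Proof.
  induction 1; intros GR w0 R HC HU HR; simpl.
  - rewrite other_than_id, keep_names_app, (keep_ids _ (bindings _ _))
      by (intros; eapply bindings_ids; eauto).
    eapply typed_perm with (G := assume u Ts a :: bindings vs Ts ++ GR
                                      ++ keep_names (other_than w0) G);
      [|perm].
    eapply t_out; eauto.
    eapply typed_perm; [apply IHtyped; eauto|].
    rewrite keep_names_app, (keep_ids _ D) by (intros; eapply decr_ids; eauto). perm.
  - rewrite other_than_id.
    eapply typed_perm with (G := assume u Ts a :: GR ++ keep_names (other_than w0) G);
      [|perm].
    eapply t_inp; eauto.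
    + intros x Hx; rewrite !dom_app, !in_app_iff; intros [HI|[HI|HI]].
      * eapply H2; eauto; rewrite dom_app, in_app_iff; auto.
      * destruct (HC _ HI); discriminate.
      * eapply H2; eauto; rewrite dom_app, in_app_iff; right.
        eapply in_dom_keep_names; eauto.
    + eapply typed_perm; [apply IHtyped; eauto|].
      rewrite !keep_names_app, (keep_ids _ D) by (intros; eapply decr_ids; eauto).
      rewrite (keep_ids _ (bindings _ _)) by (intros; eapply bindings_ids; eauto).
      perm.
  - rewrite keep_names_app.
    eapply t_str; [apply t_par; [apply IHtyped1|apply IHtyped2]; eauto|].
    eapply prec_trans; [apply prec_frame_r, prec_contract; auto|].
    apply prec_refl; perm.
  - assert (HI : forall z, In (NId z) (dom G) ->
        In (NId z) (dom (GR ++ keep_names (other_than w0) G))).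
    { intros z; rewrite dom_app, in_app_iff; unfold dom; rewrite !in_map_iff.
      intros ([y T] & Hy & HI); simpl in Hy; subst; right; exists (NId z, T); split; auto.
      apply filter_In; split; auto; simpl; apply other_than_id. }
    apply t_if; auto.
  - destruct (Nat.eq_dec w0 w) as [->|Hw].
    + rewrite keep_notin by auto.
      apply t_str with G; [apply t_rec; auto|apply prec_app_l].
    + apply t_rec.
      * unfold unrestricted in *; rewrite Forall_app; split; auto.
        rewrite Forall_forall in *; intros b Hb; apply filter_In in Hb; apply H; tauto.
      * rewrite dom_app, in_app_iff; intros [HI|HI].
        -- destruct (HC _ HI); discriminate.
        -- apply in_dom_keep_names in HI; auto.
      * eapply typed_perm; [apply IHtyped; eauto|]. simpl. unfold other_than at 1.
        destruct (name_eq_dec (NPv w) (NPv w0)); [congruence|]. perm.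
  - unfold other_than. destruct (Nat.eq_dec w0 w) as [->|Hw].
    + destruct (name_eq_dec (NPv w) (NPv w)); [|tauto]. rewrite app_nil_r; auto.
    + destruct (name_eq_dec (NPv w) (NPv w0)); [congruence|].
      eapply t_str; [apply t_pvar|apply prec_app_l].
  - rewrite other_than_id.
    eapply typed_perm with (G := assume u Ts (Uniq 0) :: GR ++ keep_names (other_than w0) G);
      [|perm].
    apply t_free; auto.
  - apply t_alloc with Ts.
    + rewrite dom_app, in_app_iff; intros [HI|HI].
      * destruct (HC _ HI); discriminate.
      * apply in_dom_keep_names in HI; auto.
    + eapply typed_perm; [apply IHtyped; eauto|]. simpl; rewrite other_than_id. perm.
  - rewrite app_nil_r; apply typed_nil.
  - eapply t_str; [apply IHtyped; eauto|apply prec_frame_l, prec_keep_names; auto].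
Qed.

(** One copy of the unrestricted environment types the body, another the inserted recursion. *)
Lemma typed_unfold_rec G w P : chan_env G -> typed G (Rec w P) ->
  typed G (psubst w (Rec w P) P).
Proof.
  intros HC (G' & HP & HU & Hw & HT)%typed_rec_inv.
  assert (HR : typed G' (Rec w P)) by (apply t_rec; auto).
  apply typed_psubst with (G := G') (w := w) (R := Rec w P) in HT;
    [|eapply chan_env_prec; eauto|auto|auto].
  simpl in HT; unfold other_than in HT at 1.
  destruct (name_eq_dec (NPv w) (NPv w)) as [_|]; [|tauto]. rewrite keep_notin in HT by auto.
  eapply t_str; [exact HT|]. eapply prec_trans; [exact HP|apply prec_contract; auto].
Qed.

(** * Resource environments *)

Lemma renv_ext (M N : renv) : (forall c, M c <-> N c) -> M = N.
Proof.
  intros H; apply functional_extensionality; intros c.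
  apply propositional_extensionality, H.
Qed.

Lemma extend_iff M c d : extend M c d <-> M d \/ d = c.
Proof.
  split.
  - intros [x H|x H]; [auto|inversion H; auto].
  - intros [H| ->]; [apply Union_introl; auto|apply Union_intror; constructor].
Qed.

Lemma Im_iff (M : renv) s d : Im channel channel M s d <-> exists c, M c /\ d = s c.
Proof.
  split.
  - intros [c H y ->]; exists c; auto.
  - intros (c & H & ->); apply Im_intro with c; auto.
Qed.

Lemma Im_extend M s c :
  Im channel channel (extend M c) s = extend (Im channel channel M s) (s c).
Proof.
  apply renv_ext; intros d; rewrite extend_iff, !Im_iff; split.
  - intros (x & Hx & ->); apply extend_iff in Hx as [Hx| ->]; eauto.
  - intros [(x & Hx & ->)| ->]; eexists; split; eauto; apply extend_iff; auto.
Qed.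

Lemma Im_comp M s t :
  Im channel channel (Im channel channel M s) t
  = Im channel channel M (fun c => t (s c)).
Proof.
  apply renv_ext; intros d; rewrite !Im_iff; split.
  - intros (x & Hx & ->); apply Im_iff in Hx as (y & Hy & ->); eauto.
  - intros (x & Hx & ->); exists (s x); rewrite Im_iff; eauto.
Qed.

Lemma Im_agree (M : renv) s t :
  (forall c, M c -> s c = t c) -> Im channel channel M s = Im channel channel M t.
Proof.
  intros H; apply renv_ext; intros d; rewrite !Im_iff.
  split; intros (x & Hx & ->); exists x; rewrite H; auto.
Qed.

Lemma Im_id M : Im channel channel M (fun c => c) = M.
Proof.
  apply renv_ext; intros d; rewrite Im_iff; split; [intros (x & ? & ->); auto|eauto].
Qed.

Lemma Im_fresh s (M : renv) c : Injective s -> ~ M c -> ~ Im channel channel M s (s c).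
Proof. intros Hs Hc (x & Hx & E)%Im_iff; apply Hs in E as <-; auto. Qed.

Lemma extend_swap M c d : extend (extend M c) d = extend (extend M d) c.
Proof. apply renv_ext; intros x; rewrite !extend_iff; tauto. Qed.

(** * Structural equivalence, substitution and renaming *)

Lemma struct_subst P Q : struct P Q -> forall f, struct (subst f P) (subst f Q).
Proof. induction 1; intros f; simpl; eauto using struct. Qed.

Lemma struct_psubst_l w R P Q : struct P Q -> struct (psubst w R P) (psubst w R Q).
Proof.
  induction 1; simpl; eauto using struct.
  destruct (Nat.eq_dec w w0); eauto using struct.
Qed.

Lemma struct_psubst_r w R R' P : struct R R' -> struct (psubst w R P) (psubst w R' P).
Proof.
  intros H; induction P; simpl; eauto using struct.
  - destruct (Nat.eq_dec w w0); eauto using struct.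
  - destruct (Nat.eq_dec w w0); eauto using struct.
Qed.

Lemma struct_ren s P Q : struct P Q -> struct (ren s P) (ren s Q).
Proof. induction 1; simpl; eauto using struct. Qed.

Lemma struct_closed_in P Q : struct P Q ->
  forall xs ws, closed_in xs ws P <-> closed_in xs ws Q.
Proof.
  induction 1; intros; simpl; try tauto.
  - symmetry; auto.
  - rewrite IHstruct1; auto.
  - rewrite IHstruct; tauto.
  - rewrite IHstruct; tauto.
  - rewrite IHstruct1, IHstruct2; tauto.
  - rewrite IHstruct; tauto.
  - rewrite IHstruct1, IHstruct2; tauto.
  - rewrite IHstruct; tauto.
  - rewrite IHstruct; tauto.
Qed.

Lemma ren_ident_comp s t u : ren_ident t (ren_ident s u) = ren_ident (fun c => t (s c)) u.
Proof. destruct u; auto. Qed.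

Lemma ren_comp s t P : ren t (ren s P) = ren (fun c => t (s c)) P.
Proof.
  induction P; simpl; rewrite ?ren_ident_comp; try congruence.
  rewrite map_map, IHP; f_equal; apply map_ext; intros; apply ren_ident_comp.
Qed.

Lemma ren_ident_id u : ren_ident (fun c => c) u = u.
Proof. destruct u; auto. Qed.

Lemma ren_id P : ren (fun c => c) P = P.
Proof.
  induction P; simpl; rewrite ?ren_ident_id; try congruence.
  rewrite IHP; f_equal. rewrite <- (map_id vs) at 2; apply map_ext, ren_ident_id.
Qed.

Lemma closed_in_ren s P : forall xs ws, closed_in xs ws (ren s P) <-> closed_in xs ws P.
Proof.
  assert (HI : forall xs u, ident_closed xs (ren_ident s u) <-> ident_closed xs u).
  { intros xs [|]; simpl; tauto. }
  induction P; intros xs' ws'; simpl; rewrite ?HI, ?IHP, ?IHP1, ?IHP2; try tauto.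
  rewrite Forall_map. enough (HF : Forall (fun x => ident_closed xs' (ren_ident s x)) vs
    <-> Forall (ident_closed xs') vs) by tauto.
  rewrite !Forall_forall; split; intros HF x Hx; apply HI, HF; auto.
Qed.

Lemma ren_subst s P : forall f,
  ren s (subst f P) = subst (fun x => ren_ident s (f x)) (ren s P).
Proof.
  assert (HI : forall f u, ren_ident s (subst_ident f u)
                = subst_ident (fun x => ren_ident s (f x)) (ren_ident s u)).
  { intros f [|]; auto. }
  assert (HM : forall xs f, (fun x => ren_ident s (mask xs f x))
                = mask xs (fun x => ren_ident s (f x))).
  { intros xs f; apply functional_extensionality; intros x; unfold mask.
    destruct (in_dec _ _ _); auto. }
  induction P; intros f; simpl; rewrite ?HI, ?IHP, ?IHP1, ?IHP2, ?HM; auto.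
  f_equal; rewrite !map_map; apply map_ext; auto.
Qed.

Lemma ren_to_chans s xs : forall ds,
  (fun x => ren_ident s (to_chans xs ds x)) = to_chans xs (map s ds).
Proof.
  intros ds; apply functional_extensionality; intros y; revert ds.
  induction xs as [|x xs IH]; intros [|d ds]; simpl; auto.
  destruct (Nat.eq_dec x y); simpl; auto.
Qed.

Lemma ren_psubst s w R P : ren s (psubst w R P) = psubst w (ren s R) (ren s P).
Proof.
  induction P; simpl; try congruence.
  - destruct (Nat.eq_dec w w0); simpl; congruence.
  - destruct (Nat.eq_dec w w0); simpl; congruence.
Qed.

Definition ren_label (s : channel -> channel) (mu : label) : label :=
  match mu with
  | LOut c ds => LOut (s c) (map s ds)
  | LInp c ds => LInp (s c) (map s ds)
  | LTau => LTau
  | LAlloc => LAlloc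
  | LFree c => LFree (s c)
  | LEnv => LEnv
  end.

(** * Transitions of processes without an observer *)

(** What remains of [pretrans] without environments. As in [p_com_l], a communication does not ask
    for its channel to be allocated, while [red_com] does; typing bridges this gap in [act_red]. *)
Inductive act : renv -> process -> label -> Z -> renv -> process -> Prop :=
| act_out M c ds P : act M (Out (Ch c) (map Ch ds) P) (LOut c ds) 0 M P
| act_inp M c ds xs P :
    length ds = length xs ->
    act M (Inp (Ch c) xs P) (LInp c ds) 0 M (subst (to_chans xs ds) P)
| act_com_l M c ds P P' Q Q' :
    act M P (LOut c ds) 0 M P' -> act M Q (LInp c ds) 0 M Q' ->
    act M (Par P Q) LTau 0 M (Par P' Q')
| act_com_r M c ds P P' Q Q' :
    act M P (LOut c ds) 0 M P' -> act M Q (LInp c ds) 0 M Q' ->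
    act M (Par Q P) LTau 0 M (Par Q' P')
| act_par_l M P mu k M' P' Q :
    act M P mu k M' P' -> act M (Par P Q) mu k M' (Par P' Q)
| act_par_r M P mu k M' P' Q :
    act M P mu k M' P' -> act M (Par Q P) mu k M' (Par Q P')
| act_rec M w P : act M (Rec w P) LTau 0 M (psubst w (Rec w P) P)
| act_then (M : renv) c P Q : M c -> act M (If (Ch c) (Ch c) P Q) LTau 0 M P
| act_else (M : renv) c d P Q :
    M c -> M d -> c <> d -> act M (If (Ch c) (Ch d) P Q) LTau 0 M Q
| act_alloc (M : renv) x P c :
    ~ M c ->
    act M (Alloc x P) LTau 1 (extend M c) (subst (to_chans [x] [c]) P)
| act_free (M : renv) c P :
    ~ M c -> act (extend M c) (Free (Ch c) P) LTau (-1) M P.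

Lemma act_visible M P mu k M' P' : act M P mu k M' P' -> mu <> LTau ->
  k = 0%Z /\ M' = M /\ forall N, act N P mu 0 N P'.
Proof.
  induction 1; intros Hmu; try congruence.
  - repeat split; constructor.
  - repeat split; constructor; auto.
  - destruct IHact as (-> & -> & ?); auto. repeat split; intros; apply act_par_l; auto.
  - destruct IHact as (-> & -> & ?); auto. repeat split; intros; apply act_par_r; auto.
Qed.

Lemma act_visible_any M P mu k M' P' N :
  act M P mu k M' P' -> mu <> LTau -> act N P mu 0 N P'.
Proof. intros H Hm; apply (act_visible _ _ _ _ _ _ H Hm). Qed.

(** Both directions are proved at once because [struct_sym] exchanges them. For [Rec], the
    equivalence is applied both to the body and to the copies of the recursion inserted into it. *)
Lemma struct_act P Q : struct P Q -> forall M mu k M',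
  (forall P', act M P mu k M' P' -> exists Q', act M Q mu k M' Q' /\ struct P' Q') /\
  (forall Q', act M Q mu k M' Q' -> exists P', act M P mu k M' P' /\ struct P' Q').
Proof.
  induction 1; intros M mu k M'.
  - split; eauto using struct_refl.
  - destruct (IHstruct M mu k M') as [H1 H2]; split.
    + intros P' (Q' & ? & ?)%H2; eauto using struct_sym.
    + intros P' (Q' & ? & ?)%H1; eauto using struct_sym.
  - destruct (IHstruct1 M mu k M') as [H1 H2], (IHstruct2 M mu k M') as [H3 H4]; split.
    + intros P' (Q' & HQ & ?)%H1. destruct (H3 _ HQ) as (R' & ? & ?).
      exists R'; split; auto; eapply struct_trans; eauto.
    + intros R' (Q' & HQ & ?)%H4. destruct (H2 _ HQ) as (P' & ? & ?).
      exists P'; split; auto; eapply struct_trans; eauto.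
  - split; intros X HX; inversion HX; subst;
      (eexists; split; [|apply struct_comm]); eauto using act.
  - split; intros X HX; inversion HX; subst;
      repeat match goal with
      | H : act _ (Par _ _) _ _ _ _ |- _ => inversion H; clear H; subst
      end;
      (eexists; split; [|apply struct_assoc]); eauto 7 using act.
  - split; intros X HX.
    + inversion HX; subst; try match goal with H : act _ Nil _ _ _ _ |- _ => inversion H end.
      eexists; split; [eassumption|apply struct_nil].
    + eexists; split; [apply act_par_l; eauto|apply struct_nil].
  - split; intros X HX; inversion HX; subst; eexists; split; eauto using act.
  - split; intros X HX; inversion HX; subst;
      (eexists; split; [|apply struct_subst; eassumption]); eauto using act.
  - split; intros X HX; inversion HX; subst; eexists; split; eauto using act.
  - split; intros X HX; inversion HX; subst;
      (eexists; split; [apply act_rec|]);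
      (eapply struct_trans; [apply struct_psubst_l; eassumption|]);
      apply struct_psubst_r, struct_rec; assumption.
  - split; intros X HX; inversion HX; subst.
    1-4: repeat match goal with
      | H : act _ ?P _ _ _ _, K : struct ?P _ |- _ =>
          first [ apply (proj1 (IHstruct1 _ _ _ _)) in H as (? & ? & ?)
                | apply (proj1 (IHstruct2 _ _ _ _)) in H as (? & ? & ?) ]
      end; (eexists; split; [|apply struct_par; eauto using struct_refl]); eauto using act.
    all: repeat match goal with
      | H : act _ ?P _ _ _ _, K : struct _ ?P |- _ =>
          first [ apply (proj2 (IHstruct1 _ _ _ _)) in H as (? & ? & ?)
                | apply (proj2 (IHstruct2 _ _ _ _)) in H as (? & ? & ?) ]
      end; (eexists; split; [|apply struct_par; eauto using struct_refl]); eauto using act.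
  - split; intros X HX; inversion HX; subst;
      (eexists; split; [|apply struct_subst; eassumption]); eauto using act.
  - split; intros X HX; inversion HX; subst; eexists; split; eauto using act.
Qed.

Lemma act_struct P Q M mu k M' P' : struct P Q -> act M P mu k M' P' ->
  exists Q', act M Q mu k M' Q' /\ struct P' Q'.
Proof. intros H; apply (proj1 (struct_act _ _ H M mu k M')). Qed.

Lemma act_ren s M P mu k M' P' : Injective s -> act M P mu k M' P' ->
  act (Im channel channel M s) (ren s P) (ren_label s mu) k
      (Im channel channel M' s) (ren s P').
Proof.
  intros Hs; induction 1; cbn [ren ren_label ren_ident] in *;
    rewrite ?ren_subst, ?ren_to_chans, ?ren_psubst, ?Im_extend.
  - rewrite map_map; simpl; rewrite <- (map_map s Ch); constructor.
  - constructor; rewrite length_map; auto.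
  - eapply act_com_l; eauto.
  - eapply act_com_r; eauto.
  - apply act_par_l; auto.
  - apply act_par_r; auto.
  - constructor.
  - constructor; apply Im_iff; eauto.
  - constructor; try (apply Im_iff; eauto). intros E; apply Hs in E; auto.
  - constructor; apply Im_fresh; auto.
  - constructor; apply Im_fresh; auto.
Qed.

Lemma act_resources M P k M' P' : act M P LTau k M' P' ->
  M' = M \/ (exists c, ~ M c /\ M' = extend M c) \/ (exists c, ~ M' c /\ M = extend M' c).
Proof.
  intros H; remember LTau as mu; induction H; try discriminate; eauto 6.
Qed.

(** An extra channel blocks nothing but the allocation of that very channel, which [~ M' c]
    excludes. *)
Lemma act_extend M P k M' P' c : act M P LTau k M' P' -> ~ M c -> ~ M' c ->
  act (extend M c) P LTau k (extend M' c) P'.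
Proof.
  intros H; remember LTau as mu; induction H; try discriminate; intros Hc Hc'; subst.
  - eapply act_com_l; eapply act_visible_any; try eassumption; discriminate.
  - eapply act_com_r; eapply act_visible_any; try eassumption; discriminate.
  - apply act_par_l; auto.
  - apply act_par_r; auto.
  - constructor.
  - constructor; apply extend_iff; auto.
  - constructor; auto; apply extend_iff; auto.
  - rewrite extend_iff in Hc'. rewrite extend_swap. constructor.
    rewrite extend_iff; intros [|]; subst; tauto.
  - rewrite extend_iff in Hc. rewrite extend_swap. constructor.
    rewrite extend_iff; intros [|]; subst; tauto.
Qed.

(** A flat form of [pretrans]: whatever the nesting of parallel compositions and permutations in a
    derivation, it amounts to a step of [act], or to no move of the process at all, together with
    one change of the environment. *)
Definition pretrans_spec (G : env) (S : sys) (mu : label) (k : Z)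
    (G' : env) (S' : sys) : Prop :=
  match mu with
  | LOut c ds =>
      act (res S) (prc S) mu k (res S') (prc S') /\
      exists Ts a D G0, decr (Ch c) Ts a = Some D /\ same_length ds Ts
        /\ Permutation G (assume (Ch c) Ts a :: G0)
        /\ Permutation G' (bindings (map Ch ds) Ts ++ D ++ G0)
  | LInp c ds =>
      act (res S) (prc S) mu k (res S') (prc S') /\
      exists Ts a D G0, decr (Ch c) Ts a = Some D /\ same_length ds Ts
        /\ Permutation G (assume (Ch c) Ts a :: bindings (map Ch ds) Ts ++ G0)
        /\ Permutation G' (D ++ G0)
  | LTau => act (res S) (prc S) mu k (res S') (prc S') /\ Permutation G G'
  | LAlloc =>
      k = 1%Z /\ exists c Ts, ~ res S c /\ S' = extend (res S) c |> prc S
        /\ Permutation G' (assume (Ch c) Ts (Uniq 0) :: G)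
  | LFree c =>
      k = (-1)%Z /\ exists Ts, ~ res S' c /\ S = extend (res S') c |> prc S'
        /\ Permutation G (assume (Ch c) Ts (Uniq 0) :: G')
  | LEnv => k = 0%Z /\ S' = S /\ prec G G'
  end.

Lemma pretrans_inv G S mu k G' S' :
  pretrans G S mu k G' S' -> pretrans_spec G S mu k G' S'.
Proof.
  induction 1; simpl in *.
  - split; [constructor|]. exists Ts, a, D, G; auto.
  - split; [constructor; auto|]. exists Ts, a, D, G; auto.
  - split; auto. eapply act_com_l; [apply IHpretrans1|apply IHpretrans2].
  - split; auto. eapply act_com_r; [apply IHpretrans1|apply IHpretrans2].
  - destruct mu; simpl in *;
      try (destruct IHpretrans; split; auto; apply act_par_l; auto).
    + destruct IHpretrans as (-> & c & Ts & ? & E & ?); inversion E; subst.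
      split; auto; exists c, Ts; auto.
    + destruct IHpretrans as (-> & Ts & ? & E & ?); inversion E; subst.
      split; auto; exists Ts; auto.
    + destruct IHpretrans as (? & E & ?); inversion E; subst; auto.
  - destruct mu; simpl in *;
      try (destruct IHpretrans; split; auto; apply act_par_r; auto).
    + destruct IHpretrans as (-> & c & Ts & ? & E & ?); inversion E; subst.
      split; auto; exists c, Ts; auto.
    + destruct IHpretrans as (-> & Ts & ? & E & ?); inversion E; subst.
      split; auto; exists Ts; auto.
    + destruct IHpretrans as (? & E & ?); inversion E; subst; auto.
  - auto.
  - split; auto; constructor.
  - split; auto; constructor; auto.
  - split; auto; constructor; auto.
  - split; auto; constructor; auto.
  - split; auto. exists c, Ts; auto.
  - split; auto; constructor; auto.
  - split; auto. exists Ts; auto.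
  - destruct mu; simpl in *.
    + destruct IHpretrans as (? & Ts & a & D & G0 & ? & ? & ? & ?); split; auto.
      exists Ts, a, D, G0; repeat split; auto; [rewrite H|rewrite <- H1]; auto.
    + destruct IHpretrans as (? & Ts & a & D & G0 & ? & ? & ? & ?); split; auto.
      exists Ts, a, D, G0; repeat split; auto; [rewrite H|rewrite <- H1]; auto.
    + destruct IHpretrans as [? HP]; split; auto. rewrite H, HP; auto.
    + destruct IHpretrans as (? & c & Ts & ? & ? & HP); split; auto.
      exists c, Ts; repeat split; auto. rewrite <- H1, HP, H; auto.
    + destruct IHpretrans as (? & Ts & ? & ? & HP); split; auto.
      exists Ts; repeat split; auto. rewrite H, HP, H1; auto.
    + destruct IHpretrans as (? & ? & ?); repeat split; auto.
      eapply prec_perm_l; [|eapply prec_perm_r]; eauto.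
Qed.

Lemma act_pretrans_out M P c ds k M' P' : act M P (LOut c ds) k M' P' ->
  forall Ts a D G, decr (Ch c) Ts a = Some D -> same_length ds Ts ->
  pretrans (assume (Ch c) Ts a :: G) (M |> P) (LOut c ds) k
           (bindings (map Ch ds) Ts ++ D ++ G) (M' |> P').
Proof.
  intros H; remember (LOut c ds) as mu; induction H; inversion Heqmu; subst;
    intros; eauto using pretrans.
Qed.

Lemma act_pretrans_inp M P c ds k M' P' : act M P (LInp c ds) k M' P' ->
  forall Ts a D G, decr (Ch c) Ts a = Some D -> same_length ds Ts ->
  pretrans (assume (Ch c) Ts a :: bindings (map Ch ds) Ts ++ G) (M |> P) (LInp c ds) k
           (D ++ G) (M' |> P').
Proof.
  intros H; remember (LInp c ds) as mu; induction H; inversion Heqmu; subst;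
    intros; eauto using pretrans.
Qed.

Lemma act_pretrans_tau M P k M' P' : act M P LTau k M' P' ->
  forall G, pretrans G (M |> P) LTau k G (M' |> P').
Proof.
  intros H; remember LTau as mu; induction H; inversion Heqmu; subst;
    intros; eauto using pretrans.
  - eapply p_com_l.
    (* The premises of [p_com_l] may use any environment. The attribute [One] makes the decrement
       defined and empty; [chanT [] One] is just some object type, repeated to the right length. *)
    + eapply (act_pretrans_out _ _ _ _ _ _ _ H (repeat (chanT [] One) (length ds)) One _ []);
        [reflexivity|]. unfold same_length; rewrite repeat_length; auto.
    + eapply (act_pretrans_inp _ _ _ _ _ _ _ H0 (repeat (chanT [] One) (length ds)) One _ []);
        [reflexivity|]. unfold same_length; rewrite repeat_length; auto.
  - eapply p_com_r.
    + eapply (act_pretrans_out _ _ _ _ _ _ _ H (repeat (chanT [] One) (length ds)) One _ []);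
        [reflexivity|]. unfold same_length; rewrite repeat_length; auto.
    + eapply (act_pretrans_inp _ _ _ _ _ _ _ H0 (repeat (chanT [] One) (length ds)) One _ []);
        [reflexivity|]. unfold same_length; rewrite repeat_length; auto.
Qed.

Lemma pretrans_intro G S mu k G' S' :
  pretrans_spec G S mu k G' S' -> pretrans G S mu k G' S'.
Proof.
  destruct S as [M P], S' as [M' P'], mu; simpl.
  - intros (HA & Ts & a & D & G0 & ? & ? & ? & ?).
    eapply p_perm; [eauto|apply act_pretrans_out; eauto|symmetry; auto].
  - intros (HA & Ts & a & D & G0 & ? & ? & ? & ?).
    eapply p_perm; [eauto|apply act_pretrans_inp; eauto|symmetry; auto].
  - intros (HA & ?).
    eapply p_perm; [apply Permutation_refl|apply act_pretrans_tau; eauto|auto].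
  - intros (-> & c & Ts & ? & E & ?); inversion E; subst.
    eapply p_perm; [apply Permutation_refl|apply p_alloc_env; eauto|symmetry; eauto].
  - intros (-> & Ts & ? & E & ?); inversion E; subst.
    eapply p_perm; [eauto|apply p_free_env; eauto|auto].
  - intros (-> & E & ?); inversion E; subst. apply p_env; auto.
Qed.

Lemma ren_env_bindings s ds Ts :
  ren_env s (bindings (map Ch ds) Ts) = bindings (map Ch (map s ds)) Ts.
Proof.
  unfold ren_env; rewrite (map_names_bindings _ (ren_ident s)) by auto.
  rewrite !map_map; auto.
Qed.

Lemma Permutation_ren_env s G G' :
  Permutation G G' -> Permutation (ren_env s G) (ren_env s G').
Proof. apply Permutation_map. Qed.

Lemma pretrans_ren s G S mu k G' S' : Injective s -> pretrans G S mu k G' S' ->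
  pretrans (ren_env s G) (ren_sys s S) (ren_label s mu) k (ren_env s G') (ren_sys s S').
Proof.
  intros Hs H%pretrans_inv. apply pretrans_intro. destruct mu; simpl in *.
  - destruct H as (HA & Ts & a & D & G0 & HD & Hl & HP1 & HP2); split.
    + apply (act_ren s) in HA; auto.
    + exists Ts, a, (ren_env s D), (ren_env s G0); repeat split.
      * apply (map_names_decr (ren_name s) (ren_ident s) (Ch c)); auto.
      * unfold same_length; rewrite length_map; auto.
      * apply (Permutation_ren_env s) in HP1; auto.
      * apply (Permutation_ren_env s) in HP2; rewrite HP2.
        unfold ren_env; rewrite !map_names_app; fold (ren_env s (bindings (map Ch ds) Ts)).
        rewrite ren_env_bindings; auto.
  - destruct H as (HA & Ts & a & D & G0 & HD & Hl & HP1 & HP2); split.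
    + apply (act_ren s) in HA; auto.
    + exists Ts, a, (ren_env s D), (ren_env s G0); repeat split.
      * apply (map_names_decr (ren_name s) (ren_ident s) (Ch c)); auto.
      * unfold same_length; rewrite length_map; auto.
      * apply (Permutation_ren_env s) in HP1; rewrite HP1. simpl; apply perm_skip.
        unfold ren_env; rewrite !map_names_app; fold (ren_env s (bindings (map Ch ds) Ts)).
        rewrite ren_env_bindings; auto.
      * apply (Permutation_ren_env s) in HP2; rewrite HP2.
        unfold ren_env; rewrite !map_names_app; auto.
  - destruct H; split; [apply (act_ren s) in H; auto|apply Permutation_ren_env; auto].
  - destruct H as (-> & c & Ts & Hc & -> & HP); split; auto.
    exists (s c), Ts; repeat split.
    + apply Im_fresh; auto.
    + unfold ren_sys; simpl; rewrite Im_extend; auto.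
    + apply (Permutation_ren_env s) in HP; auto.
  - destruct H as (-> & Ts & Hc & -> & HP); split; auto. exists Ts; repeat split.
    + apply Im_fresh; auto.
    + unfold ren_sys; simpl; rewrite Im_extend; auto.
    + apply (Permutation_ren_env s) in HP; auto.
  - destruct H as (-> & -> & HP); repeat split; auto. apply prec_map_names; auto.
Qed.

(** * Subject reduction for the observer *)

(** [P] itself is typed again in the split environment, so that an observer can restructure first
    and communicate afterwards. *)
Lemma typed_act_out M P c ds k M' P' G : act M P (LOut c ds) k M' P' -> typed G P ->
  exists Ts a D G0, prec G (assume (Ch c) Ts a :: bindings (map Ch ds) Ts ++ G0)
    /\ decr (Ch c) Ts a = Some D /\ same_length ds Ts
    /\ typed (assume (Ch c) Ts a :: bindings (map Ch ds) Ts ++ G0) P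
    /\ typed (D ++ G0) P'.
Proof.
  intros H; remember (LOut c ds) as mu; revert G; induction H; inversion Heqmu; subst;
    intros G HT.
  - apply typed_out_inv in HT as (Ts & a & D & G0 & ? & ? & Hl & ?).
    exists Ts, a, D, G0; repeat split; auto; [|eapply t_out; eauto].
    unfold same_length in *; rewrite length_map in Hl; auto.
  - apply typed_par_inv in HT as (G1 & G2 & HP & H1 & H2).
    destruct (IHact eq_refl _ H1) as (Ts & a & D & G0 & HP' & ? & ? & ? & ?).
    exists Ts, a, D, (G0 ++ G2); repeat split; auto.
    + eapply prec_trans; [exact HP|]. eapply prec_perm_r; [apply prec_frame_r; eauto|perm].
    + eapply typed_perm; [apply t_par; eauto|perm].
    + rewrite app_assoc; apply t_par; auto.
  - apply typed_par_inv in HT as (G1 & G2 & HP & H1 & H2).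
    destruct (IHact eq_refl _ H2) as (Ts & a & D & G0 & HP' & ? & ? & ? & ?).
    exists Ts, a, D, (G1 ++ G0); repeat split; auto.
    + eapply prec_trans; [exact HP|]. eapply prec_perm_r; [apply prec_frame_l; eauto|perm].
    + eapply typed_perm; [apply t_par; eauto|perm].
    + eapply typed_perm; [apply t_par; eauto|perm].
Qed.

Lemma typed_act_inp M P c ds k M' P' G : act M P (LInp c ds) k M' P' -> typed G P ->
  exists Ts a D G0, prec G (assume (Ch c) Ts a :: G0)
    /\ decr (Ch c) Ts a = Some D /\ same_length ds Ts
    /\ typed (assume (Ch c) Ts a :: G0) P
    /\ typed (bindings (map Ch ds) Ts ++ D ++ G0) P'.
Proof.
  intros H; remember (LInp c ds) as mu; revert G; induction H; inversion Heqmu; subst;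
    intros G HT.
  - apply typed_inp_inv in HT as (Ts & a & D & G0 & ? & ? & Hl & HN & HF & ?).
    exists Ts, a, D, G0; repeat split; auto.
    + unfold same_length in *; congruence.
    + eapply t_inp; eauto.
    + apply typed_subst_chans; auto.
  - apply typed_par_inv in HT as (G1 & G2 & HP & H1 & H2).
    destruct (IHact eq_refl _ H1) as (Ts & a & D & G0 & HP' & ? & ? & ? & ?).
    exists Ts, a, D, (G0 ++ G2); repeat split; auto.
    + eapply prec_trans; [exact HP|]. eapply prec_perm_r; [apply prec_frame_r; eauto|perm].
    + eapply typed_perm; [apply t_par; eauto|perm].
    + eapply typed_perm; [apply t_par; eauto|perm].
  - apply typed_par_inv in HT as (G1 & G2 & HP & H1 & H2).
    destruct (IHact eq_refl _ H2) as (Ts & a & D & G0 & HP' & ? & ? & ? & ?).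
    exists Ts, a, D, (G1 ++ G0); repeat split; auto.
    + eapply prec_trans; [exact HP|]. eapply prec_perm_r; [apply prec_frame_l; eauto|perm].
    + eapply typed_perm; [apply t_par; eauto|perm].
    + eapply typed_perm; [apply t_par; eauto|perm].
Qed.

Lemma typed_com P Q c ds P' Q' M G1 G2 :
  consistent (G1 ++ G2) -> typed G1 P -> typed G2 Q ->
  act M P (LOut c ds) 0 M P' -> act M Q (LInp c ds) 0 M Q' ->
  exists G1' G2', prec (G1 ++ G2) (G1' ++ G2') /\ typed G1' P' /\ typed G2' Q'.
Proof.
  intros HC HP HQ AP AQ.
  destruct (typed_act_out _ _ _ _ _ _ _ _ AP HP)
    as (Ts1 & a1 & D1 & H1 & Pr1 & De1 & L1 & _ & T1).
  destruct (typed_act_inp _ _ _ _ _ _ _ _ AQ HQ)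
    as (Ts2 & a2 & D2 & H2 & Pr2 & De2 & L2 & _ & T2).
  exists (D1 ++ H1), (bindings (map Ch ds) Ts2 ++ D2 ++ H2); repeat split; auto.
  assert (HPr : prec (G1 ++ G2) (assume (Ch c) Ts1 a1 :: assume (Ch c) Ts2 a2
                   :: bindings (map Ch ds) Ts1 ++ H1 ++ H2)).
  { eapply prec_trans; [apply prec_app; eauto|]. apply prec_refl; perm. }
  eapply prec_trans; [exact HPr|]. eapply prec_trans; [eapply prec_com; eauto|].
  - eapply consistent_prec; [exact HC|]. eapply prec_trans; [exact HPr|].
    apply prec_cons, prec_cons, prec_app_l.
  - apply prec_refl; perm.
Qed.

(* What a step of the observing process asks of the observed systems: nothing
   but a restructuring of the environment, an allocation or a deallocation. *)
Definition observer_step (G : env) (M : renv) (P : process) (k : Z)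
    (M' : renv) (P' : process) : Prop :=
  (k = 0%Z /\ M' = M /\ exists G', prec G G' /\ typed G' P' /\
     forall N : renv, (forall c, In (NId (Ch c)) (dom G) -> N c) -> act N P LTau 0 N P') \/
  (k = 1%Z /\ exists c Ts, ~ M c /\ M' = extend M c
     /\ typed (assume (Ch c) Ts (Uniq 0) :: G) P'
     /\ forall N : renv, ~ N c -> act N P LTau 1 (extend N c) P') \/
  (k = (-1)%Z /\ exists c Ts G', ~ M' c /\ M = extend M' c
     /\ prec G (assume (Ch c) Ts (Uniq 0) :: G')
     /\ typed (assume (Ch c) Ts (Uniq 0) :: G') P /\ typed G' P'
     /\ forall N : renv, ~ N c -> act (extend N c) P LTau (-1) N P').

(** [F] stands for adding an idle component, typed in [G2], on either side of a parallel
    composition. *)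
Lemma observer_step_context (F : process -> process) G G1 G2 M P k M' P' :
  prec G (G1 ++ G2) -> (forall H X, typed H X -> typed (H ++ G2) (F X)) ->
  (forall N X k N' X', act N X LTau k N' X' -> act N (F X) LTau k N' (F X')) ->
  observer_step G1 M P k M' P' -> observer_step G M (F P) k M' (F P').
Proof.
  intros HP HF HA [(-> & -> & G' & ? & ? & HN)|[(-> & c & Ts & ? & -> & HT & HN)
    |(-> & c & Ts & G' & ? & -> & HG & HT & HT' & HN)]].
  - left; repeat split. exists (G' ++ G2); repeat split; auto.
    + eapply prec_trans; [exact HP|apply prec_frame_r; auto].
    + intros N HD; apply HA, HN. intros d Hd; apply HD.
      eapply prec_dom; [exact HP|]. rewrite dom_app, in_app_iff; auto.
  - right; left; split; auto. exists c, Ts; repeat split; auto.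
    eapply t_str; [apply (HF _ _ HT)|]. apply prec_cons; auto.
  - right; right; split; auto. exists c, Ts, (G' ++ G2); repeat split; auto.
    + eapply prec_trans; [exact HP|]. apply (prec_frame_r G2) in HG; exact HG.
    + apply (HF _ _ HT).
Qed.

(** The step is offered in every resource environment [N] that allows it, since the context has to
    repeat it next to the second system, whose resources may differ from [M]. *)
Lemma typed_act_tau M P k M' P' : act M P LTau k M' P' -> forall G,
  consistent G -> chan_env G -> typed G P -> observer_step G M P k M' P'.
Proof.
  intros H; remember LTau as mu; induction H; inversion Heqmu; subst;
    intros G HC HE HT.
  - apply typed_par_inv in HT as (G1 & G2 & HP & H1 & H2).
    destruct (typed_com P Q c ds P' Q' M G1 G2) as (G1' & G2' & HP' & ? & ?); auto.
    { eapply consistent_prec; eauto. }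
    left; repeat split; exists (G1' ++ G2'); repeat split.
    + eapply prec_trans; eauto.
    + apply t_par; auto.
    + intros; eapply act_com_l; eapply act_visible_any; try eassumption; discriminate.
  - apply typed_par_inv in HT as (G1 & G2 & HP & H1 & H2).
    destruct (typed_com P Q c ds P' Q' M G2 G1) as (G1' & G2' & HP' & ? & ?); auto.
    { eapply consistent_prec; eauto. eapply prec_perm_r; [exact HP|perm]. }
    left; repeat split; exists (G2' ++ G1'); repeat split.
    + eapply prec_trans; [exact HP|]. eapply prec_perm_l; [apply Permutation_app_comm|].
      eapply prec_perm_r; [exact HP'|perm].
    + apply t_par; auto.
    + intros; eapply act_com_r; eapply act_visible_any; try eassumption; discriminate.
  - apply typed_par_inv in HT as (G1 & G2 & HP & H1 & H2).
    assert (HP1 : prec G G1) by (eapply prec_trans; [exact HP|apply prec_app_r]).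
    apply (observer_step_context (fun X => Par X Q)) with G1 G2; auto using act_par_l.
    + intros; apply t_par; auto.
    + apply IHact; auto; [eapply consistent_prec|eapply chan_env_prec]; eauto.
  - apply typed_par_inv in HT as (G1 & G2 & HP & H1 & H2).
    assert (HP2 : prec G G2) by (eapply prec_trans; [exact HP|apply prec_app_l]).
    apply (observer_step_context (Par Q)) with G2 G1; auto using act_par_r.
    + eapply prec_perm_r; [exact HP|apply Permutation_app_comm].
    + intros; eapply typed_perm; [apply t_par; eauto|apply Permutation_app_comm].
    + apply IHact; auto; [eapply consistent_prec|eapply chan_env_prec]; eauto.
  - left; repeat split; exists G; repeat split.
    + apply prec_refl; auto.
    + apply typed_unfold_rec; auto.
    + intros; constructor.
  - apply typed_if_inv in HT as (G' & HP & Hu & Hv & H1 & H2).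
    left; repeat split; exists G'; repeat split; auto.
    intros N HN; constructor; apply HN; eapply prec_dom; eauto.
  - apply typed_if_inv in HT as (G' & HP & Hu & Hv & H3 & H4).
    left; repeat split; exists G'; repeat split; auto.
    intros N HN; constructor; auto; apply HN; eapply prec_dom; eauto.
  - apply typed_alloc_inv in HT as (Ts & G' & HP & Hx & HT).
    right; left; split; auto; exists c, Ts; repeat split; auto.
    + eapply t_str; [|apply prec_cons; exact HP].
      apply (typed_subst_chans [x] [c] [chanT Ts (Uniq 0)]); auto.
      * constructor; [simpl; auto|constructor].
      * intros y [<-|[]]; auto.
    + intros; constructor; auto.
  - apply typed_free_inv in HT as (Ts & G' & HP & HT).
    right; right; split; auto; exists c, Ts, G'; repeat split; auto.
    + apply t_free; auto.
    + intros; constructor; auto.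
Qed.

(** * Systems up to renaming and structural equivalence *)

Definition dom_le (G' G : env) : Prop :=
  forall c, In (NId (Ch c)) (dom G') -> In (NId (Ch c)) (dom G).

Lemma dom_le_prec G G' : prec G G' -> dom_le G' G.
Proof. intros H c; apply prec_dom; auto. Qed.

Lemma dom_le_perm G G' : Permutation G G' -> dom_le G' G.
Proof. intros H; apply dom_le_prec, prec_refl; auto. Qed.

Ltac dom_perm := apply dom_le_perm; first [assumption | symmetry; assumption].

Lemma dom_le_app_l G H : dom_le G (G ++ H).
Proof. intros c; rewrite dom_app, in_app_iff; auto. Qed.

Lemma dom_le_app_r G H : dom_le H (G ++ H).
Proof. intros c; rewrite dom_app, in_app_iff; auto. Qed.

Lemma dom_le_trans G1 G2 G3 : dom_le G1 G2 -> dom_le G2 G3 -> dom_le G1 G3.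
Proof. intros H1 H2 c Hc; apply H2, H1, Hc. Qed.

Lemma Bijective_Injective {A B} (s : A -> B) : Bijective s -> Injective s.
Proof. intros (t & H1 & _) x y E; rewrite <- (H1 x), <- (H1 y), E; auto. Qed.

Lemma renaming_id G : renaming G (fun c => c).
Proof. split; auto. exists (fun c => c); auto. Qed.

Lemma renaming_comp G s t : renaming G s -> renaming G t -> renaming G (fun c => t (s c)).
Proof.
  intros [(s' & S1 & S2) Hs] [(t' & T1 & T2) Ht]; split.
  - exists (fun c => s' (t' c)); split; intros x; [rewrite T1|rewrite S2]; auto.
  - intros c Hc; rewrite Hs; auto.
Qed.

Lemma renaming_inv G s : renaming G s ->
  exists t, renaming G t /\ (forall x, t (s x) = x) /\ (forall x, s (t x) = x).
Proof.
  intros [(t & H1 & H2) Hs]; exists t; split; auto; split.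
  - exists s; auto.
  - intros c Hc; rewrite <- (Hs c Hc) at 1; auto.
Qed.

Lemma renaming_dom_le G G' s : dom_le G' G -> renaming G s -> renaming G' s.
Proof. intros H [? ?]; split; auto. Qed.

Lemma ren_sys_comp s t S : ren_sys t (ren_sys s S) = ren_sys (fun c => t (s c)) S.
Proof. unfold ren_sys; simpl; rewrite Im_comp, ren_comp; auto. Qed.

Lemma ren_sys_id s S : (forall c, s c = c) -> ren_sys s S = S.
Proof.
  intros H; replace s with (fun c : channel => c)
    by (apply functional_extensionality; auto).
  destruct S; unfold ren_sys; simpl; rewrite Im_id, ren_id; auto.
Qed.

(** A renaming followed by [struct] is enough for an equivalence: renaming preserves [struct], and
    the renamings modulo [G] form a group. *)
Definition eqv (G : env) (S S' : sys) : Prop :=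
  exists s, renaming G s /\ res S' = Im channel channel (res S) s
    /\ struct (ren s (prc S)) (prc S').

Lemma eqv_ren G s S : renaming G s -> eqv G S (ren_sys s S).
Proof. intros H; exists s; repeat split; try apply H; apply struct_refl. Qed.

Lemma eqv_struct G M P Q : struct P Q -> eqv G (M |> P) (M |> Q).
Proof.
  intros H; exists (fun c => c); simpl; rewrite Im_id, ren_id.
  split; auto using renaming_id.
Qed.

Lemma eqv_refl G S : eqv G S S.
Proof. destruct S; apply eqv_struct, struct_refl. Qed.

Lemma eqv_sym G S S' : eqv G S S' -> eqv G S' S.
Proof.
  intros (s & Hs & HM & HP). destruct (renaming_inv _ _ Hs) as (t & Ht & H1 & H2).
  exists t; repeat split; try apply Ht.
  - rewrite HM, Im_comp, (Im_agree _ _ (fun c => c)), Im_id; auto.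
  - apply struct_sym. apply (struct_ren t) in HP; rewrite ren_comp in HP.
    replace (fun c => t (s c)) with (fun c : channel => c) in HP
      by (apply functional_extensionality; auto).
    rewrite ren_id in HP; auto.
Qed.

Lemma eqv_trans G S1 S2 S3 : eqv G S1 S2 -> eqv G S2 S3 -> eqv G S1 S3.
Proof.
  intros (s & Hs & HM & HP) (t & Ht & HN & HQ).
  exists (fun c => t (s c)); split; [apply renaming_comp; auto|]; split.
  - rewrite HN, HM, Im_comp; auto.
  - rewrite <- ren_comp. eapply struct_trans; [apply struct_ren; eauto|auto].
Qed.

Lemma eqv_dom_le G G' S S' : dom_le G' G -> eqv G S S' -> eqv G' S S'.
Proof.
  intros H (s & Hs & ?); exists s; split; auto; eapply renaming_dom_le; eauto.
Qed.

Lemma pretrans_struct G M P Q mu k G' S' : struct P Q ->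
  pretrans G (M |> P) mu k G' S' ->
  exists S'', pretrans G (M |> Q) mu k G' S'' /\ eqv G' S' S''.
Proof.
  intros HS H%pretrans_inv. destruct S' as [M' P'].
  assert (HA : forall Q', struct P' Q' -> pretrans_spec G (M |> Q) mu k G' (M' |> Q') ->
    exists S'', pretrans G (M |> Q) mu k G' S'' /\ eqv G' (M' |> P') S'').
  { intros Q' HQ HH; exists (M' |> Q'); split; [apply pretrans_intro|apply eqv_struct]; auto. }
  destruct mu; simpl in H.
  - destruct H as [(Q' & ? & ?)%(act_struct _ _ _ _ _ _ _ HS) ?].
    apply (HA Q'); simpl; auto.
  - destruct H as [(Q' & ? & ?)%(act_struct _ _ _ _ _ _ _ HS) ?].
    apply (HA Q'); simpl; auto.
  - destruct H as [(Q' & ? & ?)%(act_struct _ _ _ _ _ _ _ HS) ?].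
    apply (HA Q'); simpl; auto.
  - destruct H as (-> & c & Ts & ? & E & ?); inversion E; subst.
    apply (HA Q); auto. simpl; split; auto; exists c, Ts; auto.
  - destruct H as (-> & Ts & ? & E & ?); inversion E; subst.
    apply (HA Q); auto. simpl; split; auto; exists Ts; auto.
  - destruct H as (-> & E & ?); inversion E; subst. apply (HA Q); simpl; auto.
Qed.

(** The renaming is exposed instead of being hidden in [trans]: next to a context it has to be
    applied to the context as well. *)
Lemma eqv_pretrans G S S' mu k G' T' : eqv G S S' -> pretrans G S' mu k G' T' ->
  exists s T, renaming G s /\ pretrans G (ren_sys s S) mu k G' T /\ eqv G' T T'.
Proof.
  intros (s & Hs & HM & HP) H. destruct S' as [M' P']; simpl in *; subst M'.
  eapply pretrans_struct in H as (T & HT & HE); [|apply struct_sym; exact HP].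
  exists s, T; repeat split; auto; try apply Hs. apply eqv_sym; auto.
Qed.

Lemma eqv_trans_step G S S' mu k G' T' : eqv G S S' -> trans G S' mu k G' T' ->
  exists T, trans G S mu k G' T /\ eqv G' T T'.
Proof.
  intros HE (t & Ht & H).
  destruct (eqv_pretrans G S _ mu k G' T' (eqv_trans _ _ _ _ HE (eqv_ren _ _ _ Ht)) H)
    as (s & T & Hs & HT & HE').
  exists T; split; auto; exists s; auto.
Qed.

Lemma pretrans_trans G S mu k G' S' : pretrans G S mu k G' S' -> trans G S mu k G' S'.
Proof.
  intros H; exists (fun c => c); split; [apply renaming_id|]. rewrite ren_sys_id; auto.
Qed.

Lemma consistent_ren s G : Injective s -> consistent G -> consistent (ren_env s G).
Proof.
  intros Hs (G' & HN & HP); exists (ren_env s G'); split.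
  - unfold ren_env; rewrite dom_map_names. apply Injective_map_NoDup; auto.
    intros [[c|x]|w] [[d|y]|v]; simpl; intros E; inversion E; auto.
    f_equal; f_equal; apply Hs; auto.
  - apply prec_map_names; auto.
Qed.

Lemma config_ren s G S : Bijective s -> config G S -> config (ren_env s G) (ren_sys s S).
Proof.
  intros Hs ((HF & HC) & HD & D & HK & HT & HD' & HK').
  assert (HR : forall H, dom_sub H (res S) ->
            dom_sub (ren_env s H) (res (ren_sys s S))).
  { intros H HH u; unfold ren_env; rewrite dom_map_names, in_map_iff.
    intros (v & <- & Hv). destruct (HH _ Hv) as (c & -> & Hc).
    exists (s c); split; auto. apply Im_iff; eauto. }
  pose proof (Bijective_Injective _ Hs) as Hi.
  split; [split|split; [auto|]].
  - intros HF'; apply HF. destruct Hs as (t & H1 & H2).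
    (* The inverse of [s] maps the complement of the renamed resources onto that of the original
       ones, so finiteness would carry over. *)
    replace (Complement channel (res S))
      with (Im channel channel (Complement channel (res (ren_sys s S))) t).
    { apply finite_image; auto. }
    apply renv_ext; intros c; rewrite Im_iff; split.
    + intros (d & Hd & ->) Hc. apply Hd; apply Im_iff; exists (t d); split; auto.
    + intros Hc; exists (s c); rewrite H1; split; auto.
      intros (x & Hx & E)%Im_iff; apply Hi in E as <-; apply Hc; auto.
  - apply closed_in_ren; auto.
  - exists (ren_env s D); split.
    + unfold ren_env; rewrite <- map_names_app. apply consistent_ren; auto.
    + split; [apply typed_ren; auto|]. split; auto. apply consistent_ren; auto.
Qed.

Lemma ren_env_fixed G s : chan_env G -> renaming G s -> ren_env s G = G.
Proof.
  intros HG [_ Hs]; apply map_names_id; intros u Hu.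
  destruct (HG _ Hu) as [c ->]; simpl; rewrite Hs; auto.
Qed.

Lemma config_chan_env G S : config G S -> chan_env G.
Proof. intros (_ & HD & _) u Hu; destruct (HD _ Hu) as (c & -> & _); eauto. Qed.

Lemma config_struct G M P Q : struct P Q -> config G (M |> P) -> config G (M |> Q).
Proof.
  intros HS ((HF & HC) & HD & D & HK & HT & HD' & HK').
  split; [split; auto|split; auto].
  - apply (struct_closed_in _ _ HS); auto.
  - exists D; split; auto; split; auto. apply (typed_struct _ _ HS); auto.
Qed.

Lemma config_eqv G S S' : eqv G S S' -> config G S -> config G S'.
Proof.
  intros (s & Hs & HM & HP) HC. destruct S' as [M' P']; simpl in *; subst M'.
  eapply config_struct; [exact HP|]. pose proof (config_ren s _ _ (proj1 Hs) HC) as H.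
  rewrite ren_env_fixed in H; auto. eapply config_chan_env; eauto.
Qed.

Lemma dom_sub_perm G G' M : Permutation G G' -> dom_sub G M -> dom_sub G' M.
Proof.
  intros HP H u Hu; apply H; eapply prec_dom; [apply prec_refl; exact HP|auto].
Qed.

Lemma config_perm G G' S : Permutation G G' -> config G S -> config G' S.
Proof.
  intros HP (HS & HD & D & HK & HT); split; auto; split.
  - eapply dom_sub_perm; eauto.
  - exists D; split; auto. eapply consistent_prec; [exact HK|].
    apply prec_refl, Permutation_app_tail; auto.
Qed.

(* The free channels of a configuration are allocated. *)
Lemma config_ren_agree G M P s t : config G (M |> P) ->
  (forall c, M c -> s c = t c) -> ren s P = ren t P.
Proof.
  intros (_ & _ & D & _ & HT & HD & _) H. eapply ren_agree; [exact HT|].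
  intros c Hc; apply H. destruct (HD _ Hc) as (d & E & Hd); inversion E; subst; auto.
Qed.

(** * Weak transitions *)

(** Weak steps that may use [eqv] at any point and keep the environment fixed, so that answers
    compose freely; [wk_wtau] and [wk_reds] push the equivalences to the end. *)
Inductive wk (G : env) : sys -> Z -> sys -> Prop :=
| wk_eqv S S' : eqv G S S' -> wk G S 0 S'
| wk_tau S k S' : act (res S) (prc S) LTau k (res S') (prc S') -> wk G S k S'
| wk_trans S1 k S2 l S3 : wk G S1 k S2 -> wk G S2 l S3 -> wk G S1 (k + l) S3.

Lemma wk_dom_le G G' S k S' : dom_le G' G -> wk G S k S' -> wk G' S k S'.
Proof.
  intros H; induction 1.
  - apply wk_eqv; eapply eqv_dom_le; eauto.
  - apply wk_tau; auto.
  - eapply wk_trans; eauto.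
Qed.

Definition wkh (G : env) (S : sys) (mu : label) (k : Z) (G' : env) (S' : sys) : Prop :=
  match mu with
  | LTau => Permutation G G' /\ wk G S k S'
  | _ => exists k1 S1 k2 S2 k3, wk G S k1 S1 /\ pretrans G S1 mu k2 G' S2
           /\ wk G' S2 k3 S' /\ k = (k1 + k2 + k3)%Z
  end.

Lemma wkh_visible G S mu k G' S' : mu <> LTau -> wkh G S mu k G' S' ->
  exists k1 S1 k2 S2 k3, wk G S k1 S1 /\ pretrans G S1 mu k2 G' S2
    /\ wk G' S2 k3 S' /\ k = (k1 + k2 + k3)%Z.
Proof. destruct mu; simpl; tauto. Qed.

Lemma wkh_intro G S k1 S1 mu k2 G' S2 k3 S' k :
  wk G S k1 S1 -> pretrans G S1 mu k2 G' S2 -> wk G' S2 k3 S' ->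
  k = (k1 + k2 + k3)%Z -> wkh G S mu k G' S'.
Proof.
  intros H1 H2 H3 ->. destruct mu; simpl; eauto 10.
  apply pretrans_inv in H2 as [HA HP]; split; auto.
  eapply wk_trans; [eapply wk_trans; [exact H1|apply wk_tau; eauto]|].
  eapply wk_dom_le; [|exact H3]. dom_perm.
Qed.

Lemma wkh_prefix G S k S1 mu l G' S' :
  wk G S k S1 -> wkh G S1 mu l G' S' -> wkh G S mu (k + l) G' S'.
Proof.
  intros H; assert (HV : forall mu, mu <> LTau -> wkh G S1 mu l G' S' ->
                      wkh G S mu (k + l) G' S').
  { intros m Hm (k1 & S2 & k2 & S3 & k3 & H1 & H2 & H3 & ->)%wkh_visible; auto.
    eapply wkh_intro; [eapply wk_trans; [exact H|exact H1]|eauto..|]; lia. }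
  destruct mu; try (apply HV; discriminate). simpl. intros [HP Hw]; split; auto.
  eapply wk_trans; eauto.
Qed.

Lemma wtau_wk G S k G' S' : wtau G S k G' S' -> Permutation G G' /\ wk G S k S'.
Proof.
  induction 1 as [|G1 S1 k G2 S2 l G3 S3 (s & Hs & HT) _ [HP HW]].
  - split; auto; apply wk_eqv, eqv_refl.
  - apply pretrans_inv in HT as [HA HP']. split; [rewrite HP'; auto|].
    eapply wk_trans.
    + rewrite <- (Z.add_0_l k). eapply wk_trans; [apply wk_eqv, eqv_ren; eauto|].
      apply wk_tau; eauto.
    + eapply wk_dom_le; [|exact HW]. dom_perm.
Qed.

Lemma pretrans_perm G1 G S mu k G' G1' S' : Permutation G1 G -> Permutation G' G1' ->
  pretrans G S mu k G' S' -> pretrans G1 S mu k G1' S'.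
Proof. intros; eapply p_perm; eauto. Qed.

Lemma trans_perm_l G1 G S mu k G' S' : Permutation G1 G ->
  trans G S mu k G' S' -> trans G1 S mu k G' S'.
Proof.
  intros HP (s & Hs & H); exists s; split.
  - eapply renaming_dom_le; [|exact Hs]. dom_perm.
  - eapply pretrans_perm; eauto.
Qed.

Lemma wtau_perm_l G1 G S k G' S' : Permutation G1 G ->
  wtau G S k G' S' -> wtau G1 S k G' S'.
Proof.
  intros HP H; revert G1 HP; induction H; intros G0 HP.
  - apply wtau_refl; rewrite HP; auto.
  - eapply wtau_step; [eapply trans_perm_l|]; eauto.
Qed.

Lemma wtau_trans G S k G' S' l G'' S'' :
  wtau G S k G' S' -> wtau G' S' l G'' S'' -> wtau G S (k + l) G'' S''.
Proof.
  induction 1; intros HW.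
  - rewrite Z.add_0_l; eapply wtau_perm_l; eauto.
  - rewrite <- Z.add_assoc; eapply wtau_step; eauto.
Qed.

Lemma wk_wtau G S k S' : wk G S k S' -> forall S0, eqv G S0 S ->
  exists S1, wtau G S0 k G S1 /\ eqv G S1 S'.
Proof.
  induction 1 as [S S' HE|[M P] k [M' P'] HA|S1 k S2 l S3 _ IH1 _ IH2]; intros S0 H0.
  - exists S0; split; [apply wtau_refl; auto|eapply eqv_trans; eauto].
  - destruct (eqv_trans_step G S0 (M |> P) LTau k G (M' |> P')) as (T & HT & HE); auto.
    { apply pretrans_trans, pretrans_intro; simpl; auto. }
    exists T; split; auto. rewrite <- (Z.add_0_r k).
    eapply wtau_step; [exact HT|apply wtau_refl; auto].
  - destruct (IH1 _ H0) as (T1 & HW1 & HE1), (IH2 _ HE1) as (T2 & HW2 & HE2).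
    exists T2; split; auto; eapply wtau_trans; eauto.
Qed.

Lemma wtrans_hat_wkh G S mu k G' S' : wtrans_hat G S mu k G' S' -> wkh G S mu k G' S'.
Proof.
  assert (HV : forall mu, wtrans G S mu k G' S' -> wkh G S mu k G' S').
  { intros m [G1 S1 k1 G2 S2 k2 k3 H1 (s & Hs & H2) H3 ->].
    apply wtau_wk in H1 as [HP1 HW1], H3 as [HP2 HW2].
    apply wkh_intro with (k1 + 0)%Z (ren_sys s S1) k2 S2 k3.
    - eapply wk_trans; [exact HW1|]. apply wk_eqv, eqv_ren.
      eapply renaming_dom_le; [|exact Hs]. dom_perm.
    - eapply pretrans_perm; eauto.
    - eapply wk_dom_le; [|exact HW2]. dom_perm.
    - lia. }
  destruct mu; try exact (HV _); exact (wtau_wk _ _ _ _ _).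
Qed.

Lemma wkh_wtrans_hat G S mu k G' S' : wkh G S mu k G' S' ->
  exists S1, wtrans_hat G S mu k G' S1 /\ eqv G' S1 S'.
Proof.
  assert (HV : forall mu, mu <> LTau -> wkh G S mu k G' S' ->
    exists S1, wtrans G S mu k G' S1 /\ eqv G' S1 S').
  { intros m Hm (k1 & S1 & k2 & S2 & k3 & H1 & H2 & H3 & ->)%wkh_visible; auto.
    destruct (wk_wtau _ _ _ _ H1 S (eqv_refl _ _)) as (T1 & W1 & E1).
    destruct (eqv_trans_step _ _ _ _ _ _ _ E1 (pretrans_trans _ _ _ _ _ _ H2))
      as (T2 & W2 & E2).
    destruct (wk_wtau _ _ _ _ H3 _ E2) as (T3 & W3 & E3).
    exists T3; split; auto; econstructor; eauto. }
  intros H; destruct mu; try (apply HV in H; [exact H|discriminate]).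
  destruct H as [HP HW]; destruct (wk_wtau _ _ _ _ HW S (eqv_refl _ _)) as (T1 & W1 & E1).
  exists T1; split.
  - rewrite <- (Z.add_0_r k). eapply wtau_trans; [exact W1|apply wtau_refl; auto].
  - eapply eqv_dom_le; [|exact E1]. dom_perm.
Qed.

(** The renaming [t] is conjugated by [s]. *)
Lemma eqv_image s G S S' : Bijective s -> eqv G S S' ->
  eqv (ren_env s G) (ren_sys s S) (ren_sys s S').
Proof.
  intros (s' & H1 & H2) (t & Ht & HM & HP).
  exists (fun c => s (t (s' c))); split; [split|split]; simpl.
  - destruct Ht as [(t' & T1 & T2) _].
    exists (fun c => s (t' (s' c))); split; intros x; rewrite ?H1, ?T1, ?T2, ?H1; auto.
  - intros c; unfold ren_env; rewrite dom_map_names, in_map_iff.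
    intros ([[d|]|] & E & Hd); inversion E; subst. rewrite H1.
    f_equal; apply Ht; auto.
  - rewrite HM, !Im_comp; apply Im_agree; intros c _; rewrite H1; auto.
  - rewrite ren_comp. apply (struct_ren s) in HP; rewrite ren_comp in HP.
    replace (fun c => s (t (s' (s c)))) with (fun c => s (t c)); auto.
    apply functional_extensionality; intros c; rewrite H1; auto.
Qed.

Lemma wk_ren s G S k S' : Bijective s -> wk G S k S' ->
  wk (ren_env s G) (ren_sys s S) k (ren_sys s S').
Proof.
  intros Hs; induction 1 as [S S' HE|S k S' HA|].
  - apply wk_eqv, eqv_image; auto.
  - apply wk_tau. apply (act_ren s) in HA; auto. apply Bijective_Injective; auto.
  - eapply wk_trans; eauto.
Qed.

Lemma wkh_ren s G S mu k G' S' : Bijective s -> wkh G S mu k G' S' ->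
  wkh (ren_env s G) (ren_sys s S) (ren_label s mu) k (ren_env s G') (ren_sys s S').
Proof.
  intros Hs; assert (HV : mu <> LTau -> wkh G S mu k G' S' ->
    wkh (ren_env s G) (ren_sys s S) (ren_label s mu) k (ren_env s G') (ren_sys s S')).
  { intros Hm (k1 & S1 & k2 & S2 & k3 & H1 & H2 & H3 & ->)%wkh_visible; auto.
    eapply wkh_intro; eauto using wk_ren.
    apply pretrans_ren; eauto using Bijective_Injective. }
  destruct mu; try (apply HV; discriminate). simpl. intros [HP HW]; split.
  - apply Permutation_ren_env; auto.
  - apply wk_ren; auto.
Qed.

(** * Amortised bisimulations *)

(** Integer credits turn the updates along an answer into ring identities; [am_credit] brings them
    back to the naturals. *)
Definition zrel := env -> Z -> sys -> sys -> Prop.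

Definition zflip (B : zrel) : zrel := fun G z S T => B G z T S.

(* With [e = 1] the mover is the first system, with [e = -1] (applied to
   [zflip]) the second: the credit then moves the other way. *)
Definition sim (e : Z) (B : zrel) : Prop := forall G z S T, B G z S T ->
  forall mu k G' S', pretrans G S mu k G' S' ->
  exists l T', wkh G T mu l G' T' /\ B G' (z + e * (l - k))%Z S' T'.

(** Only pre-transitions have to be answered: closure under [eqv] absorbs the renaming that starts a
    transition and the difference between [wkh] and [wtrans_hat]. *)
Record amortised (B : zrel) : Prop := {
  am_credit : forall G z S T, B G z S T -> (0 <= z)%Z;
  am_perm : forall G G' z S T, Permutation G G' -> B G z S T -> B G' z S T;
  am_config : forall G z S T, B G z S T -> config G S /\ config G T;
  am_eqv : forall G z S T S' T', B G z S T -> eqv G S S' -> eqv G T T' -> B G z S' T';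
  am_sim : sim 1 B;
  am_sim_flip : sim (-1) (zflip B) }.

Lemma amortised_bis B G n S T : amortised B -> B G (Z.of_nat n) S T -> bis G n S T.
Proof.
  intros HB H. exists (fun G n S T => B G (Z.of_nat n) S T); split; auto.
  split; [split|].
  - intros; eapply am_config; eauto.
  - intros; eapply am_perm; eauto.
  - clear G n S T H; intros G n S T H; split.
    + intros mu k G' S' (s & Hs & HT).
      assert (H' : B G (Z.of_nat n) (ren_sys s S) T)
        by (eapply am_eqv; eauto using eqv_ren, eqv_refl).
      destruct (am_sim B HB _ _ _ _ H' _ _ _ _ HT) as (l & T' & HW & H1).
      apply wkh_wtrans_hat in HW as (T1 & HW & HE).
      exists l, T1; split; auto. pose proof (am_credit B HB _ _ _ _ H1) as Hz.
      exists (Z.to_nat (Z.of_nat n + 1 * (l - k))); rewrite Z2Nat.id by auto; split; [lia|].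
      eapply am_eqv; eauto using eqv_refl, eqv_sym.
    + intros mu k G' S' (s & Hs & HT).
      assert (H' : zflip B G (Z.of_nat n) (ren_sys s T) S)
        by (unfold zflip; eapply am_eqv; eauto using eqv_ren, eqv_refl).
      destruct (am_sim_flip B HB _ _ _ _ H' _ _ _ _ HT) as (l & T' & HW & H1).
      apply wkh_wtrans_hat in HW as (T1 & HW & HE).
      exists l, T1; split; auto. pose proof (am_credit B HB _ _ _ _ H1) as Hz.
      exists (Z.to_nat (Z.of_nat n + -1 * (l - k))); rewrite Z2Nat.id by auto; split; [lia|].
      eapply am_eqv; eauto using eqv_refl, eqv_sym.
Qed.

Lemma bis_bisimulation : amortised_bisimulation bis.
Proof.
  split; [split|].
  - intros G n S T (R & ((HC & _) & _) & H); eauto.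
  - intros G G' n S T HP (R & HR & H); exists R; split; auto.
    destruct HR as ((_ & HR) & _); eauto.
  - intros G n S T (R & HR & H). pose proof HR as (_ & HS).
    destruct (HS _ _ _ _ H) as [H1 H2]; split.
    + intros mu k G' S' (l & T' & ? & m & ? & ?)%H1.
      exists l, T'; split; auto; exists m; split; auto; exists R; auto.
    + intros mu k G' S' (l & T' & ? & m & ? & ?)%H2.
      exists l, T'; split; auto; exists m; split; auto; exists R; auto.
Qed.

(** Closed under [eqv] by construction; that [bis] itself has this closure follows only once [zbis]
    is known to be [amortised]. *)
Definition zbis : zrel := fun G z S T =>
  exists n S0 T0, z = Z.of_nat n /\ bis G n S0 T0 /\ eqv G S0 S /\ eqv G T0 T.

Lemma zbis_bis G n S T : bis G n S T -> zbis G (Z.of_nat n) S T.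
Proof. intros H; exists n, S, T; auto using eqv_refl. Qed.

Lemma amortised_zbis : amortised zbis.
Proof.
  destruct bis_bisimulation as ((HC & HP) & HS). split.
  - intros G z S T (n & S0 & T0 & -> & _); lia.
  - intros G G' z S T Hp (n & S0 & T0 & -> & H & HE1 & HE2).
    exists n, S0, T0; split; auto; split; [eapply HP; eauto|].
    split; (eapply eqv_dom_le; [|eassumption]); dom_perm.
  - intros G z S T (n & S0 & T0 & -> & H & HE1 & HE2).
    split; (eapply config_eqv; [eassumption|]); apply (HC _ _ _ _ H).
  - intros G z S T S' T' (n & S0 & T0 & -> & H & HE1 & HE2) H1 H2.
    exists n, S0, T0; repeat split; auto; eapply eqv_trans; eauto.
  - intros G z S T (n & S0 & T0 & -> & H & HE1 & HE2) mu k G' S' HT%pretrans_trans.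
    destruct (eqv_trans_step _ _ _ _ _ _ _ HE1 HT) as (S1 & HT1 & HE).
    destruct (proj1 (HS _ _ _ _ H) _ _ _ _ HT1) as (l & T1 & HW & m & Hm & HB).
    exists l, T1; split.
    + rewrite <- (Z.add_0_l l). eapply wkh_prefix; [apply wk_eqv, eqv_sym; exact HE2|].
      apply wtrans_hat_wkh; auto.
    + exists m, S1, T1; repeat split; auto using eqv_refl; lia.
  - intros G z S T (n & S0 & T0 & -> & H & HE1 & HE2) mu k G' S' HT%pretrans_trans.
    destruct (eqv_trans_step _ _ _ _ _ _ _ HE2 HT) as (S1 & HT1 & HE).
    destruct (proj2 (HS _ _ _ _ H) _ _ _ _ HT1) as (l & T1 & HW & m & Hm & HB).
    exists l, T1; split.
    + rewrite <- (Z.add_0_l l). eapply wkh_prefix; [apply wk_eqv, eqv_sym; exact HE1|].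
      apply wtrans_hat_wkh; auto.
    + exists m, T1, S1; repeat split; auto using eqv_refl; lia.
Qed.

Lemma bis_eqv G n S T S' T' : bis G n S T -> eqv G S S' -> eqv G T T' -> bis G n S' T'.
Proof.
  intros H H1 H2. apply (amortised_bis zbis); [apply amortised_zbis|].
  exists n, S, T; auto.
Qed.

(** The coinduction principle for [zbis]. *)
Lemma amortised_zbis_sub B G z S T : amortised B -> B G z S T -> zbis G z S T.
Proof.
  intros HB H. pose proof (am_credit B HB _ _ _ _ H) as Hz.
  rewrite <- (Z2Nat.id z) by auto. apply zbis_bis, (amortised_bis B); auto.
  rewrite Z2Nat.id; auto.
Qed.

Lemma ren_env_inverse s t G : (forall c, s (t c) = c) -> ren_env s (ren_env t G) = G.
Proof.
  intros H; unfold ren_env; rewrite map_names_comp; apply map_names_id.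
  intros [[c|]|] _; simpl; rewrite ?H; auto.
Qed.

Lemma ren_sys_inverse s t S : (forall c, s (t c) = c) -> ren_sys s (ren_sys t S) = S.
Proof. intros H; rewrite ren_sys_comp; apply ren_sys_id; auto. Qed.

Lemma ren_label_inverse s t mu : (forall c, s (t c) = c) -> ren_label s (ren_label t mu) = mu.
Proof.
  intros H. assert (HM : forall l, map s (map t l) = l).
  { intros l; rewrite map_map; rewrite <- (map_id l) at 2; apply map_ext; auto. }
  destruct mu; simpl; rewrite ?H, ?HM; auto.
Qed.

Lemma sim_image e B s t : sim e B ->
  (forall c, s (t c) = c) -> (forall c, t (s c) = c) ->
  sim e (fun G z S T => B (ren_env t G) z (ren_sys t S) (ren_sys t T)).
Proof.
  intros HS H1 H2 G z S T HB mu k G' S' HT.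
  assert (Bs : Bijective s) by (exists t; auto).
  assert (Bt : Bijective t) by (exists s; auto).
  apply (pretrans_ren t) in HT; [|apply Bijective_Injective; auto].
  destruct (HS _ _ _ _ HB _ _ _ _ HT) as (l & T' & HW & HB').
  apply (wkh_ren s) in HW; auto.
  rewrite !ren_env_inverse, ren_sys_inverse, ren_label_inverse in HW by auto.
  exists l, (ren_sys s T'); split; auto. rewrite ren_sys_inverse; auto.
Qed.

(** In contrast with [eqv], [s] may move the channels of [G], so the environment is renamed too. The
    image of [zbis] under [s] is again [amortised], hence contained in [zbis]. *)
Lemma zbis_ren s G z S T : Bijective s -> zbis G z S T ->
  zbis (ren_env s G) z (ren_sys s S) (ren_sys s T).
Proof.
  intros (t & H1 & H2) H. pose proof amortised_zbis as HZ.
  assert (Bs : Bijective s) by (exists t; auto).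
  assert (Bt : Bijective t) by (exists s; auto).
  apply (amortised_zbis_sub
    (fun G z S T => zbis (ren_env t G) z (ren_sys t S) (ren_sys t T))).
  2: rewrite ren_env_inverse, !ren_sys_inverse; auto.
  clear G z S T H; split.
  - intros G z S T; apply (am_credit _ HZ).
  - intros G G' z S T HP; apply (am_perm _ HZ), Permutation_ren_env; auto.
  - intros G z S T H; apply (am_config _ HZ) in H as [HC1 HC2].
    apply (config_ren s) in HC1, HC2; auto.
    rewrite ren_env_inverse, !ren_sys_inverse in * by auto; auto.
  - intros G z S T S' T' H HE1 HE2.
    apply (am_eqv _ HZ _ _ _ _ _ _ H); apply eqv_image; auto.
  - apply (sim_image 1 zbis s t); auto; apply (am_sim _ HZ).
  - apply (sim_image (-1) (zflip zbis) s t); auto; apply (am_sim_flip _ HZ).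
Qed.

(** What the closure arguments use about a relation when its first system moves. [os_sim] says
    nothing about the states inside a weak answer, so [os_reach] records that they are
    configurations. *)
Record one_sided (e : Z) (B : zrel) : Prop := {
  os_perm : forall G G' z S T, Permutation G G' -> B G z S T -> B G' z S T;
  os_config : forall G z S T, B G z S T -> config G S;
  os_eqv : forall G z S T S' T', B G z S T -> eqv G S S' -> eqv G T T' -> B G z S' T';
  os_ren : forall s G z S T, Bijective s -> B G z S T ->
    B (ren_env s G) z (ren_sys s S) (ren_sys s T);
  os_reach : forall G z S T k T', B G z S T -> wk G T k T' -> config G T';
  os_sim : sim e B }.

(** [os_reach] comes from the opposite half of the bisimulation: each silent step of the second
    system is a challenge that the first one answers, so every state passed through is related to
    some state and is a configuration. *)
Lemma one_sided_zbis : one_sided 1 zbis.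
Proof.
  destruct amortised_zbis as [Z1 Z2 Z3 Z4 Z5 Z6]; split; auto using zbis_ren.
  - intros; apply (Z3 _ _ _ _ H).
  - assert (HR : forall G T k T', wk G T k T' -> forall z S, zbis G z S T ->
              exists z' S', zbis G z' S' T').
    { induction 1 as [T T' HE|T k T' HA|T1 k T2 l T3 _ IH1 _ IH2]; intros z S HB.
      - exists z, S; eapply Z4; eauto using eqv_refl.
      - destruct (Z6 G z T S HB LTau k G T') as (l & S' & _ & HB').
        { apply pretrans_intro; simpl; auto. }
        eexists _, S'; exact HB'.
      - destruct (IH1 _ _ HB) as (z1 & S1 & HB1); eauto. }
    intros G z S T k T' HB HW; destruct (HR _ _ _ _ HW _ _ HB) as (z' & S' & HB').
    apply (Z3 _ _ _ _ HB').
Qed.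

Lemma one_sided_zflip : one_sided (-1) (zflip zbis).
Proof.
  destruct amortised_zbis as [Z1 Z2 Z3 Z4 Z5 Z6]; unfold zflip in *.
  split; eauto using zbis_ren.
  - intros; apply (Z3 _ _ _ _ H).
  - assert (HR : forall G S k S', wk G S k S' -> forall z T, zbis G z S T ->
              exists z' T', zbis G z' S' T').
    { induction 1 as [T T' HE|T k T' HA|T1 k T2 l T3 _ IH1 _ IH2]; intros z S HB.
      - exists z, S; eapply Z4; eauto using eqv_refl.
      - destruct (Z5 G z T S HB LTau k G T') as (l & S' & _ & HB').
        { apply pretrans_intro; simpl; auto. }
        eexists _, S'; exact HB'.
      - destruct (IH1 _ _ HB) as (z1 & S1 & HB1); eauto. }
    intros G z S T k T' HB HW; destruct (HR _ _ _ _ HW _ _ HB) as (z' & S' & HB').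
    apply (Z3 _ _ _ _ HB').
Qed.

(** * Parallel contexts *)

Definition par_sys (S : sys) (C : process) : sys := res S |> Par (prc S) C.

(** The renaming leaves [C] unchanged because it fixes the channels of [G2] along with those of
    [G]. *)
Lemma eqv_par G0 G G2 S S' C : eqv G0 S S' -> typed G2 C -> dom_le (G ++ G2) G0 ->
  eqv G (par_sys S C) (par_sys S' C).
Proof.
  intros (s & Hs & HM & HP) HT HD; exists s; split; [|split; auto; simpl].
  - eapply renaming_dom_le; [|exact Hs].
    eapply dom_le_trans; [apply dom_le_app_l|exact HD].
  - apply struct_par; auto. rewrite <- (ren_id C) at 2.
    rewrite (ren_agree _ _ HT s (fun c => c)); [apply struct_refl|].
    intros c Hc; apply Hs, HD, dom_le_app_r; auto.
Qed.

Lemma wk_par G0 G G2 S k S' C : wk G0 S k S' -> typed G2 C -> dom_le (G ++ G2) G0 ->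
  wk G (par_sys S C) k (par_sys S' C).
Proof.
  intros H HT HD; induction H.
  - apply wk_eqv; eapply eqv_par; eauto.
  - apply wk_tau; simpl; apply act_par_l; auto.
  - eapply wk_trans; eauto.
Qed.

(** The outer equivalences are taken modulo [G] alone: to the observer of the composition, channels
    that only the context knows are as private as those of the systems. *)
Definition par_closure (B : zrel) : zrel := fun G z S T =>
  exists G0 G2 C S0 T0, B G0 z S0 T0 /\ prec G0 (G ++ G2) /\ typed G2 C
    /\ eqv G (par_sys S0 C) S /\ eqv G (par_sys T0 C) T.

(* A step in the context is answered by the step [mu'] of the component. *)
Lemma par_answer e B G0 z S T mu' k G0' S1 G G2 C mu G' G2' C' : one_sided e B ->
  B G0 z S T -> mu' <> LTau -> pretrans G0 S mu' k G0' S1 ->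
  prec G0 (G ++ G2) -> typed G2 C -> prec G0' (G' ++ G2') -> typed G2' C' ->
  (forall T1 k1 T2, config G0 T1 -> pretrans G0 T1 mu' k1 G0' T2 ->
     pretrans G (par_sys T1 C) mu k1 G' (par_sys T2 C')) ->
  exists l T', wkh G (par_sys T C) mu l G' T'
    /\ par_closure B G' (z + e * (l - k))%Z (par_sys S1 C') T'.
Proof.
  intros HO HB Hm HS HP HC HP' HC' HA.
  destruct (os_sim _ _ HO _ _ _ _ HB _ _ _ _ HS) as (l & T' & HW & HB').
  exists l, (par_sys T' C'); split.
  - apply wkh_visible in HW as (k1 & T1 & k2 & T2 & k3 & W1 & W2 & W3 & ->); auto.
    eapply wkh_intro; [..|reflexivity].
    + eapply wk_par; eauto using dom_le_prec.
    + apply HA; eauto. eapply os_reach; eauto.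
    + eapply wk_par; eauto using dom_le_prec.
  - exists G0', G2', C', S1, T'; auto using eqv_refl.
Qed.

(** The split of the environment has to be explicit before a step can be examined. Offering it as an
    [LEnv] challenge may already make the second system take silent steps, whose cost is [l]. *)
Lemma par_env e B G0 z S T G G2 C : one_sided e B ->
  B G0 z S T -> prec G0 (G ++ G2) -> typed G2 C ->
  exists l T', wk G (par_sys T C) l (par_sys T' C) /\ B (G ++ G2) (z + e * l)%Z S T'.
Proof.
  intros HO HB HP HC. destruct S as [M P].
  destruct (os_sim _ _ HO _ _ _ _ HB LEnv 0%Z (G ++ G2) (M |> P)) as (l & T' & HW & HB').
  { apply p_env; auto. }
  exists l, T'; split; [|rewrite <- (Z.sub_0_r l); auto].
  apply wkh_visible in HW as (k1 & T1 & k2 & T2 & k3 & W1 & W2 & W3 & ->); [|discriminate].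
  apply pretrans_inv in W2 as (-> & -> & _).
  rewrite Z.add_0_r. eapply wk_trans.
  - eapply wk_par; eauto using dom_le_prec.
  - eapply wk_par; eauto. intros c; auto.
Qed.

(** The environment after an allocation by the observer names the new channel, so the answering
    system is forced to extend its resources by the same one; this extracts the equality. *)
Lemma Permutation_head {A} (a b : A) l : Permutation (a :: l) (b :: l) -> a = b.
Proof.
  intros H; apply (Permutation_app_inv_r l [a] [b]), Permutation_length_1 in H; auto.
Qed.

Lemma assume_inj u Ts a v Us b : assume u Ts a = assume v Us b -> u = v.
Proof. intros H; inversion H; auto. Qed.

Lemma act_par_inv M P C mu k M' X : act M (Par P C) mu k M' X ->
  (exists P', X = Par P' C /\ act M P mu k M' P') \/
  (exists C', X = Par P C' /\ act M C mu k M' C') \/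
  (mu = LTau /\ k = 0%Z /\ M' = M /\ exists c ds P' C', X = Par P' C' /\
     (act M P (LOut c ds) 0 M P' /\ act M C (LInp c ds) 0 M C' \/
      act M P (LInp c ds) 0 M P' /\ act M C (LOut c ds) 0 M C')).
Proof. intros H; inversion H; subst; eauto; right; right; repeat split; eauto 10. Qed.

Lemma par_sim_core e B G z S T G2 C mu k G' S' : one_sided e B ->
  B (G ++ G2) z S T -> typed G2 C -> pretrans G (par_sys S C) mu k G' S' ->
  exists l T', wkh G (par_sys T C) mu l G' T'
    /\ par_closure B G' (z + e * (l - k))%Z S' T'.
Proof.
  intros HO HB HC HT%pretrans_inv.
  assert (HPR : prec (G ++ G2) (G ++ G2)) by (apply prec_refl; auto).
  assert (HK : consistent (G ++ G2) /\ chan_env (G ++ G2)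
               /\ forall N Q, config (G ++ G2) (N |> Q) ->
                    forall c, In (NId (Ch c)) (dom G2) -> N c).
  { destruct (os_config _ _ HO _ _ _ _ HB) as (_ & HD & D & HK & _).
    split; [|split].
    - eapply consistent_prec; [exact HK|apply prec_app_r].
    - intros u Hu; destruct (HD u Hu) as (c & -> & _); eauto.
    - intros N Q (_ & HD' & _) c Hc. destruct (HD' (NId (Ch c))) as (d & E & Hd).
      + rewrite dom_app, in_app_iff; auto.
      + inversion E; subst; auto. }
  destruct HK as (HK & HCE & HDN).
  destruct S as [M P], S' as [M' P']; simpl in HT; destruct mu; simpl in HT.
  - destruct HT as (HA & Ts & a & D & G0 & De & Le & Hp & Hp').
    apply act_par_inv in HA as [(P1 & -> & HAP)|[(C' & -> & HAC)|(E & _)]];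
      [| |discriminate].
    + change (M' |> Par P1 C) with (par_sys (M' |> P1) C).
      apply (par_answer e B (G ++ G2) z (M |> P) T (LOut c ds) k (G' ++ G2) (M' |> P1)
               G G2 C (LOut c ds) G' G2 C); auto; try discriminate.
      * apply pretrans_intro; simpl; split; auto. exists Ts, a, D, (G0 ++ G2).
        repeat split; auto; [rewrite Hp|rewrite Hp']; perm.
      * apply prec_refl; auto.
      * intros T1 k1 T2 _ [HA1 _]%pretrans_inv; apply pretrans_intro; simpl; split.
        -- apply act_par_l; auto.
        -- exists Ts, a, D, G0; auto.
    (* The context sends to the observer. For [M |> P] both are parts of one observer, and
       [prec_com] moves the objects from the context's share to the observer's: an [LEnv]
       challenge. *)
    + destruct (act_visible _ _ _ _ _ _ HAC) as (-> & -> & HAN); [discriminate|].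
      destruct (typed_act_out _ _ _ _ _ _ _ _ HAC HC)
        as (Ts2 & a2 & D2 & H2 & Pr2 & De2 & L2 & _ & T2).
      change (M |> Par P C') with (par_sys (M |> P) C').
      assert (HPr : prec (G ++ G2) (assume (Ch c) Ts2 a2 :: assume (Ch c) Ts a
                       :: bindings (map Ch ds) Ts2 ++ G0 ++ H2)).
      { eapply prec_trans; [apply prec_app; [apply prec_refl, Hp|exact Pr2]|].
        apply prec_refl; perm. }
      apply (par_answer e B (G ++ G2) z (M |> P) T LEnv 0 (G' ++ D2 ++ H2) (M |> P)
               G G2 C (LOut c ds) G' (D2 ++ H2) C'); auto; try discriminate.
      * apply p_env. eapply prec_trans; [exact HPr|].
        eapply prec_trans; [eapply prec_com; eauto|].
        -- eapply consistent_prec; [exact HK|]. eapply prec_trans; [exact HPr|].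
           apply prec_cons, prec_cons, prec_app_l.
        -- apply prec_refl; rewrite Hp'; perm.
      * apply prec_refl; auto.
      * intros T1 k1 T3 _ (-> & -> & _)%pretrans_inv; apply pretrans_intro; simpl; split.
        -- apply act_par_r; auto.
        -- exists Ts, a, D, G0; auto.
  - destruct HT as (HA & Ts & a & D & G0 & De & Le & Hp & Hp').
    apply act_par_inv in HA as [(P1 & -> & HAP)|[(C' & -> & HAC)|(E & _)]];
      [| |discriminate].
    + change (M' |> Par P1 C) with (par_sys (M' |> P1) C).
      apply (par_answer e B (G ++ G2) z (M |> P) T (LInp c ds) k (G' ++ G2) (M' |> P1)
               G G2 C (LInp c ds) G' G2 C); auto; try discriminate.
      * apply pretrans_intro; simpl; split; auto. exists Ts, a, D, (G0 ++ G2).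
        repeat split; auto; [rewrite Hp|rewrite Hp']; perm.
      * apply prec_refl; auto.
      * intros T1 k1 T2 _ [HA1 _]%pretrans_inv; apply pretrans_intro; simpl; split.
        -- apply act_par_l; auto.
        -- exists Ts, a, D, G0; auto.
    (* The context receives from the observer: the roles in [prec_com] are exchanged, and the
       objects move to the context's share. *)
    + destruct (act_visible _ _ _ _ _ _ HAC) as (-> & -> & HAN); [discriminate|].
      destruct (typed_act_inp _ _ _ _ _ _ _ _ HAC HC)
        as (Ts2 & a2 & D2 & H2 & Pr2 & De2 & L2 & _ & T2).
      change (M |> Par P C') with (par_sys (M |> P) C').
      assert (HPr : prec (G ++ G2) (assume (Ch c) Ts a :: assume (Ch c) Ts2 a2
                       :: bindings (map Ch ds) Ts ++ G0 ++ H2)).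
      { eapply prec_trans; [apply prec_app; [apply prec_refl, Hp|exact Pr2]|].
        apply prec_refl; perm. }
      apply (par_answer e B (G ++ G2) z (M |> P) T LEnv 0
               (G' ++ bindings (map Ch ds) Ts2 ++ D2 ++ H2) (M |> P)
               G G2 C (LInp c ds) G' (bindings (map Ch ds) Ts2 ++ D2 ++ H2) C');
        auto; try discriminate.
      * apply p_env. eapply prec_trans; [exact HPr|].
        eapply prec_trans; [eapply prec_com; eauto|].
        -- eapply consistent_prec; [exact HK|]. eapply prec_trans; [exact HPr|].
           apply prec_cons, prec_cons, prec_app_l.
        -- apply prec_refl; rewrite Hp'; perm.
      * apply prec_refl; auto.
      * intros T1 k1 T3 _ (-> & -> & _)%pretrans_inv; apply pretrans_intro; simpl; split.
        -- apply act_par_r; auto.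
        -- exists Ts, a, D, G0; auto.
  - destruct HT as [HA Hp].
    assert (HPp : forall H, prec (G ++ H) (G' ++ H)).
    { intros H; apply prec_refl, Permutation_app_tail; auto. }
    apply act_par_inv in HA as [(P1 & -> & HAP)|[(C' & -> & HAC)
      |(_ & -> & -> & c & ds & P1 & C' & -> & [[HAP HAC]|[HAP HAC]])]].
    (* [P] sends and the context receives. The context's share is first restructured to show an
       assumption on [c], so that the output can be offered as a challenge; its answer is combined
       with the input of [C] into a communication. *)
    3: {
      destruct (typed_act_inp _ _ _ _ _ _ _ _ HAC HC)
        as (Ts & a & D & H2 & Pr & De & Le & HC1 & HC2).
      destruct (par_env e B (G ++ G2) z (M |> P) T G (assume (Ch c) Ts a :: H2) C)
        as (l1 & T1 & HW1 & HB1); auto.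
      { apply prec_frame_l; auto. }
      change (M |> Par P1 C') with (par_sys (M |> P1) C').
      destruct (par_answer e B _ _ _ _ (LOut c ds) 0
        (G' ++ bindings (map Ch ds) Ts ++ D ++ H2) (M |> P1)
        G (assume (Ch c) Ts a :: H2) C LTau G' (bindings (map Ch ds) Ts ++ D ++ H2) C'
        HO HB1) as (l2 & T2 & HW2 & HB2); auto; try discriminate.
      * apply pretrans_intro; simpl; split; auto. exists Ts, a, D, (G ++ H2).
        repeat split; auto; [|rewrite <- Hp]; perm.
      * apply prec_refl; auto.
      * apply prec_refl; auto.
      * intros T3 k3 T4 _ [HA1 _]%pretrans_inv; apply pretrans_intro; simpl; split; auto.
        destruct (act_visible _ _ _ _ _ _ HA1) as (-> & E & _); [discriminate|].
        rewrite E in *. eapply act_com_l; [eauto|].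
        eapply act_visible_any; [exact HAC|discriminate].
      * exists (l1 + l2)%Z, T2; split; [eapply wkh_prefix; eauto|].
        replace (z + e * (l1 + l2 - 0))%Z with (z + e * l1 + e * (l2 - 0))%Z by ring; auto. }
    (* The mirror case: the context sends, and the [LInp] challenge takes the objects out of its
       share. *)
    3: {
      destruct (typed_act_out _ _ _ _ _ _ _ _ HAC HC)
        as (Ts & a & D & H2 & Pr & De & Le & HC1 & HC2).
      destruct (par_env e B (G ++ G2) z (M |> P) T G
        (assume (Ch c) Ts a :: bindings (map Ch ds) Ts ++ H2) C)
        as (l1 & T1 & HW1 & HB1); auto.
      { apply prec_frame_l; auto. }
      change (M |> Par P1 C') with (par_sys (M |> P1) C').
      destruct (par_answer e B _ _ _ _ (LInp c ds) 0
        (G' ++ D ++ H2) (M |> P1)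
        G (assume (Ch c) Ts a :: bindings (map Ch ds) Ts ++ H2) C LTau G' (D ++ H2) C'
        HO HB1) as (l2 & T2 & HW2 & HB2); auto; try discriminate.
      * apply pretrans_intro; simpl; split; auto. exists Ts, a, D, (G ++ H2).
        repeat split; auto; [|rewrite <- Hp]; perm.
      * apply prec_refl; auto.
      * apply prec_refl; auto.
      * intros T3 k3 T4 _ [HA1 _]%pretrans_inv; apply pretrans_intro; simpl; split; auto.
        destruct (act_visible _ _ _ _ _ _ HA1) as (-> & E & _); [discriminate|].
        rewrite E in *. eapply act_com_r; [|eauto].
        eapply act_visible_any; [exact HAC|discriminate].
      * exists (l1 + l2)%Z, T2; split; [eapply wkh_prefix; eauto|].
        replace (z + e * (l1 + l2 - 0))%Z with (z + e * l1 + e * (l2 - 0))%Z by ring; auto. }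
    + destruct (os_sim _ _ HO _ _ _ _ HB LTau k (G ++ G2) (M' |> P1)) as (l & T' & HW & HB').
      { apply pretrans_intro; simpl; auto. }
      exists l, (par_sys T' C); split.
      * destruct HW as [_ HW]; split; auto. eapply wk_par; eauto. intros c; auto.
      * exists (G ++ G2), G2, C, (M' |> P1), T'; repeat split; auto using eqv_refl.
    + destruct (typed_act_tau _ _ _ _ _ HAC G2) as
        [(-> & -> & G2' & HP2 & HC' & HN)|[(-> & c & Ts & Hc & -> & HC' & HN)
        |(-> & c & Ts & G2' & Hc & -> & HP2 & HC1 & HC' & HN)]]; auto.
      * eapply consistent_prec; [exact HK|apply prec_app_l].
      * eapply chan_env_prec; [apply prec_app_l|exact HCE].
      * change (M |> Par P C') with (par_sys (M |> P) C').
        apply (par_answer e B (G ++ G2) z (M |> P) T LEnv 0 (G' ++ G2') (M |> P)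
               G G2 C LTau G' G2' C'); auto; try discriminate.
        -- apply p_env. eapply prec_trans; [apply HPp|apply prec_frame_l; auto].
        -- apply prec_refl; auto.
        (* A conditional in the context needs its channels allocated in [N]; they are, because the
           answering state is a configuration for [G ++ G2]. *)
        -- intros [N Q] k1 T2 HCf (-> & -> & _)%pretrans_inv; apply pretrans_intro; simpl.
           split; auto. apply act_par_r, HN. eapply HDN; eauto.
      * change (extend M c |> Par P C') with (par_sys (extend M c |> P) C').
        apply (par_answer e B (G ++ G2) z (M |> P) T LAlloc 1
               (assume (Ch c) Ts (Uniq 0) :: G ++ G2) (extend M c |> P)
               G G2 C LTau G' (assume (Ch c) Ts (Uniq 0) :: G2) C'); auto; try discriminate.
        -- apply p_alloc_env; auto.
        -- apply prec_refl; rewrite Hp; perm.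
        -- intros [N Q] k1 T2 _ (-> & d & Us & Hd & -> & E)%pretrans_inv.
           apply Permutation_head, assume_inj in E; inversion E; subst d.
           apply pretrans_intro; simpl; split; auto. apply act_par_r, HN; auto.
      (* Deallocation needs the unique assumption on [c] in the open, hence a restructuring before
         the [LFree] challenge. *)
      * destruct (par_env e B (G ++ G2) z (extend M' c |> P) T G
          (assume (Ch c) Ts (Uniq 0) :: G2') C) as (l1 & T1 & HW1 & HB1); auto.
        { apply prec_frame_l; auto. }
        change (M' |> Par P C') with (par_sys (M' |> P) C').
        destruct (par_answer e B _ _ _ _ (LFree c) (-1) (G' ++ G2') (M' |> P)
          G (assume (Ch c) Ts (Uniq 0) :: G2') C LTau G' G2' C'
          HO HB1) as (l2 & T2 & HW2 & HB2); auto; try discriminate.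
        -- apply pretrans_intro; simpl; split; auto. exists Ts; repeat split; auto.
           rewrite <- Hp; perm.
        -- apply prec_refl; auto.
        -- apply prec_refl; auto.
        -- intros [N Q] k1 [N' Q'] _ (-> & Us & Hd & E & _)%pretrans_inv.
           inversion E; subst. apply pretrans_intro; simpl; split; auto.
           apply act_par_r, HN; auto.
        -- exists (l1 + l2)%Z, T2; split; [eapply wkh_prefix; eauto|].
           replace (z + e * (l1 + l2 - -1))%Z with (z + e * l1 + e * (l2 - -1))%Z by ring.
           auto.
  - destruct HT as (-> & c & Ts & Hc & E & Hp); inversion E; subst.
    change (extend M c |> Par P C) with (par_sys (extend M c |> P) C).
    apply (par_answer e B (G ++ G2) z (M |> P) T LAlloc 1
             (assume (Ch c) Ts (Uniq 0) :: G ++ G2) (extend M c |> P)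
             G G2 C LAlloc G' G2 C); auto; try discriminate.
    + apply p_alloc_env; auto.
    + apply prec_refl; rewrite Hp; perm.
    + intros [N Q] k1 T2 _ (-> & d & Us & Hd & -> & E')%pretrans_inv.
      apply Permutation_head, assume_inj in E'; inversion E'; subst d.
      apply pretrans_intro; simpl; split; auto. exists c, Ts; auto.
  - destruct HT as (-> & Ts & Hc & E & Hp); inversion E; subst.
    change (M' |> Par P C) with (par_sys (M' |> P) C).
    apply (par_answer e B (G ++ G2) z (extend M' c |> P) T (LFree c) (-1)
             (G' ++ G2) (M' |> P) G G2 C (LFree c) G' G2 C); auto; try discriminate.
    + apply pretrans_intro; simpl; split; auto. exists Ts; repeat split; auto.
      rewrite Hp; perm.
    + apply prec_refl; auto.
    + intros [N Q] k1 [N' Q'] _ (-> & Us & Hd & E' & _)%pretrans_inv.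
      inversion E'; subst. apply pretrans_intro; simpl; split; auto. exists Ts; auto.
  - destruct HT as (-> & E & Hp); inversion E; subst.
    change (M |> Par P C) with (par_sys (M |> P) C).
    apply (par_answer e B (G ++ G2) z (M |> P) T LEnv 0 (G' ++ G2) (M |> P)
             G G2 C LEnv G' G2 C); auto; try discriminate.
    + apply p_env, prec_frame_r; auto.
    + apply prec_refl; auto.
    + intros [N Q] k1 T2 _ (-> & -> & _)%pretrans_inv; apply p_env; auto.
Qed.

(** The step is made by a renamed copy of the composition, up to [eqv]. The renaming fixes [G] but
    may move channels known to the context, so the related pair, its environment and [C] are all
    renamed before [par_sim_core] applies. *)
Lemma sim_par_closure e B : one_sided e B -> sim e (par_closure B).
Proof.
  intros HO G z S T (G0 & G2 & C & S0 & T0 & HB & HP & HC & HE1 & HE2) mu k G' S' HT.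
  destruct (eqv_pretrans _ _ _ _ _ _ _ HE1 HT) as (s & S1 & Hs & HT1 & HES).
  assert (HG : ren_env s G = G).
  { apply ren_env_fixed; auto.
    eapply chan_env_prec; [|eapply config_chan_env, os_config; eauto].
    eapply prec_trans; [exact HP|apply prec_app_r]. }
  apply (os_ren _ _ HO s) in HB; [|apply Hs].
  apply (prec_map_names (ren_name s)) in HP; rewrite map_names_app in HP.
  fold (ren_env s G0) (ren_env s G) (ren_env s G2) in HP; rewrite HG in HP.
  apply (typed_ren s) in HC.
  destruct (par_env _ _ _ _ _ _ _ _ _ HO HB HP HC) as (l1 & T1 & HW1 & HB1).
  destruct (par_sim_core _ _ _ _ _ _ _ _ _ _ _ _ HO HB1 HC HT1) as (l2 & T2 & HW2 & HB2).
  (* The two zeros are the costs of the equivalences leading from [T] to the renamed composition. *)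
  exists (0 + (0 + (l1 + l2)))%Z, T2; split.
  - eapply wkh_prefix; [apply wk_eqv, eqv_sym; exact HE2|].
    eapply wkh_prefix; [apply wk_eqv, (eqv_ren G s); auto|].
    eapply wkh_prefix; [exact HW1|exact HW2].
  - replace (z + e * (0 + (0 + (l1 + l2)) - k))%Z with (z + e * l1 + e * (l2 - k))%Z by ring.
    destruct HB2 as (G3 & G4 & C' & S3 & T3 & ? & ? & ? & HE3 & ?).
    exists G3, G4, C', S3, T3; repeat split; auto. eapply eqv_trans; eauto.
Qed.

Lemma config_par G0 G G2 S C : config G0 S -> prec G0 (G ++ G2) -> typed G2 C ->
  config G (par_sys S C).
Proof.
  intros ((HF & HCl) & HD & D & HK & HT & HD' & HK') HP HC.
  assert (HDG : dom_sub (G ++ G2) (res S)).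
  { intros u Hu; apply HD; eapply prec_dom; eauto. }
  assert (HK1 : consistent (G ++ G2 ++ D)).
  { rewrite app_assoc; eapply consistent_prec; [exact HK|apply prec_frame_r; auto]. }
  split; [split; auto|split].
  - split; auto. eapply typed_closed; [|exact HC].
    intros u Hu; destruct (HDG u) as (c & -> & _); eauto.
    rewrite dom_app, in_app_iff; auto.
  - intros u Hu; apply HDG; rewrite dom_app, in_app_iff; auto.
  (* The context's share of the environment now belongs to the system. *)
  - exists (G2 ++ D); split; auto. split; [|split].
    + eapply typed_perm; [apply t_par; eauto|apply Permutation_app_comm].
    + intros u; rewrite dom_app, in_app_iff; intros [Hu|Hu]; [apply HDG|auto].
      rewrite dom_app, in_app_iff; auto.
    + eapply consistent_prec; [exact HK1|apply prec_app_l].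
Qed.

Lemma amortised_par_closure : amortised (par_closure zbis).
Proof.
  pose proof amortised_zbis as HZ. split.
  - intros G z S T (G0 & G2 & C & S0 & T0 & HB & _); apply (am_credit _ HZ _ _ _ _ HB).
  - intros G G' z S T Hp (G0 & G2 & C & S0 & T0 & HB & HP & HC & HE1 & HE2).
    exists G0, G2, C, S0, T0; repeat split; auto.
    + eapply prec_perm_r; [exact HP|apply Permutation_app_tail; auto].
    + eapply eqv_dom_le; [|exact HE1]; dom_perm.
    + eapply eqv_dom_le; [|exact HE2]; dom_perm.
  - intros G z S T (G0 & G2 & C & S0 & T0 & HB & HP & HC & HE1 & HE2).
    apply (am_config _ HZ) in HB as [HC1 HC2].
    split; (eapply config_eqv; [eassumption|]); eapply config_par; eauto.
  - intros G z S T S' T' (G0 & G2 & C & S0 & T0 & HB & HP & HC & HE1 & HE2) H1 H2.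
    exists G0, G2, C, S0, T0; repeat split; auto; eapply eqv_trans; eauto.
  - apply sim_par_closure, one_sided_zbis.
  - intros G z T S (G0 & G2 & C & S0 & T0 & HB & HP & HC & HE1 & HE2) mu k G' T' HT.
    destruct (sim_par_closure _ _ one_sided_zflip G z T S) with mu k G' T'
      as (l & S' & HW & G3 & G4 & C' & S3 & T3 & ? & ? & ? & ? & ?); auto.
    + exists G0, G2, C, T0, S0; auto.
    + exists l, S'; split; auto. exists G3, G4, C', T3, S3; auto.
Qed.

Lemma bis_par G0 n M P N Q G G2 C :
  bis G0 n (M |> P) (N |> Q) -> prec G0 (G ++ G2) -> typed G2 C ->
  bis G n (M |> Par P C) (N |> Par Q C).
Proof.
  intros HB HP HC; apply (amortised_bis _ _ _ _ _ amortised_par_closure).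
  exists G0, G2, C, (M |> P), (N |> Q); repeat split; auto using zbis_bis, eqv_refl.
Qed.

(** * Allocating a shared channel *)

Definition add_chan (S : sys) (c : channel) : sys := extend (res S) c |> prc S.

Definition swap (a b x : channel) : channel :=
  if Nat.eq_dec x a then b else if Nat.eq_dec x b then a else x.

Lemma swap_invol a b x : swap a b (swap a b x) = x.
Proof.
  unfold swap; repeat (destruct (Nat.eq_dec _ _); subst; try tauto; try congruence).
Qed.

Lemma swap_l a b : swap a b a = b.
Proof. unfold swap; destruct (Nat.eq_dec a a); tauto. Qed.

Lemma swap_other a b x : x <> a -> x <> b -> swap a b x = x.
Proof. unfold swap; intros; destruct (Nat.eq_dec x a), (Nat.eq_dec x b); tauto. Qed.

Lemma swap_Bijective a b : Bijective (swap a b).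
Proof. exists (swap a b); split; apply swap_invol. Qed.

Lemma config_dom G S c : config G S -> In (NId (Ch c)) (dom G) -> res S c.
Proof. intros (_ & HD & _) Hc; destruct (HD _ Hc) as (d & E & H); inversion E; auto. Qed.

(** Otherwise the unallocated channels would all lie in the singleton of [c]. *)
Lemma infinite_pick (M : renv) c : ~ Finite channel (Complement channel M) ->
  exists d, ~ M d /\ d <> c.
Proof.
  intros HF; apply NNPP; intros HN; apply HF.
  apply Finite_downward_closed with (Singleton channel c); [apply Singleton_is_finite|].
  intros d Hd. destruct (Nat.eq_dec d c) as [->|]; [constructor|].
  destruct HN; exists d; auto.
Qed.

Lemma eqv_act G S S0 k S' : eqv G S S0 -> act (res S) (prc S) LTau k (res S') (prc S') ->
  exists S1, act (res S0) (prc S0) LTau k (res S1) (prc S1) /\ eqv G S' S1.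
Proof.
  intros (s & Hs & HM & HP) HA.
  apply (act_ren s) in HA; [|apply Bijective_Injective, Hs].
  destruct (act_struct _ _ _ _ _ _ _ HP HA) as (Q & HQ & HE).
  exists (Im channel channel (res S') s |> Q); split; [rewrite HM; auto|].
  exists s; auto.
Qed.

(** The given renaming may move [c], which the swap of [s c] and [c] repairs. Images of allocated
    channels are unaffected: they differ from [s c] by injectivity, and from [c] because [c] is not
    allocated in [S']. *)
Lemma eqv_add_chan G S S' c b : fst b = NId (Ch c) -> eqv G S S' -> config G S ->
  ~ res S c -> ~ res S' c -> eqv (b :: G) (add_chan S c) (add_chan S' c).
Proof.
  intros Hb (s & Hs & HM & HP) HC Hc Hc'.
  assert (Hagree : forall x, res S x -> swap (s c) c (s x) = s x).
  { intros x Hx; apply swap_other.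
    - intros E; apply (Bijective_Injective _ (proj1 Hs)) in E; subst; auto.
    - intros E; apply Hc'; rewrite HM; apply Im_iff; exists x; auto. }
  exists (fun x => swap (s c) c (s x)); split; [split|split]; simpl.
  - apply (renaming_comp [] s (swap (s c) c)); split; try apply Hs; try apply swap_Bijective;
      intros ? [].
  - rewrite Hb; intros x [E|Hx]; [inversion E; apply swap_l|].
    rewrite Hagree by (eapply config_dom; eauto). apply Hs; auto.
  - rewrite Im_extend, swap_l, HM. f_equal. apply Im_agree; intros; symmetry; auto.
  - destruct S as [M P]; simpl in *.
    rewrite (config_ren_agree _ _ _ _ s HC); auto.
Qed.

(** On its way the system may allocate [c] itself for private use. An equivalent path that avoids
    [c] can carry it as an extra allocated channel from the start. *)
Lemma wk_fresh G b c S k S' : fst b = NId (Ch c) -> wk G S k S' ->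
  (forall k T, wk G S k T -> config G T) ->
  forall S0, eqv G S S0 -> ~ res S0 c ->
  exists S0', eqv G S' S0' /\ ~ res S0' c
    /\ wk (b :: G) (add_chan S0 c) k (add_chan S0' c).
Proof.
  intros Hb; induction 1 as [S S' HE|S k S' HA|S1 k S2 l S3 HW IH1 _ IH2];
    intros HR S0 H0 Hc.
  - exists S0; repeat split; auto; [|apply wk_eqv, eqv_refl].
    eapply eqv_trans; [apply eqv_sym; exact HE|auto].
  - assert (HC0 : config G S0).
    { eapply config_eqv; [exact H0|]. eapply HR, wk_eqv, eqv_refl. }
    destruct (eqv_act _ _ _ _ _ H0 HA) as (S1 & HA1 & HE1).
    destruct (classic (res S1 c)) as [Hc1|Hc1].
    + destruct (act_resources _ _ _ _ _ HA1) as [E|[(d & Hd & E)|(d & Hd & E)]].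
      * rewrite E in Hc1; tauto.
      * assert (d = c) as ->.
        { rewrite E in Hc1; apply extend_iff in Hc1 as [|]; [tauto|auto]. }
        (* The step allocates [c] and is redirected to another unallocated channel [x]. Swapping the
           two fixes all channels of [S0], and the target changes only up to [eqv]. *)
        destruct (infinite_pick (res S0) c (proj1 (proj1 HC0))) as (x & Hx & Hxc).
        assert (HS : forall y, res S0 y -> swap c x y = y).
        { intros y Hy; apply swap_other; intros ->; auto. }
        apply (act_ren (swap c x)) in HA1; [|apply Bijective_Injective, swap_Bijective].
        destruct S0 as [M0 P0]; simpl in *.
        rewrite (Im_agree M0 _ (fun y => y)), Im_id in HA1 by auto.
        rewrite (config_ren_agree _ _ _ _ (fun y => y) HC0), ren_id in HA1 by auto.
        assert (Hfr : ~ res (ren_sys (swap c x) S1) c).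
        { simpl; rewrite E, Im_extend, extend_iff, swap_l, Im_iff.
          intros [(y & Hy & Ey)|Ey]; [|congruence].
          rewrite HS in Ey by auto; subst; auto. }
        exists (ren_sys (swap c x) S1); repeat split; auto.
        -- eapply eqv_trans; [exact HE1|]. apply eqv_ren; split; [apply swap_Bijective|].
           intros y Hy; apply HS, (config_dom _ _ _ HC0 Hy).
        -- apply wk_tau. simpl; apply act_extend; auto.
      * destruct Hc; rewrite E; apply extend_iff; auto.
    + exists S1; repeat split; auto. apply wk_tau; simpl; apply act_extend; auto.
  - destruct (IH1 HR _ H0 Hc) as (T1 & HE1 & Hc1 & HW1).
    destruct (IH2 (fun k T H => HR _ T (wk_trans _ _ _ _ _ _ HW H)) _ HE1 Hc1)
      as (T2 & HE2 & Hc2 & HW2).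
    exists T2; repeat split; auto; eapply wk_trans; eauto.
Qed.

(** [B] itself is included because a single answer leads from the second disjunct back into it. *)
Definition ext_closure (B : zrel) : zrel := fun G z S T =>
  B G z S T \/
  exists G0 c Ts S0 T0, Permutation G (assume (Ch c) Ts (Uniq 0) :: G0)
    /\ ~ res S0 c /\ ~ res T0 c /\ B G0 z S0 T0
    /\ eqv G (add_chan S0 c) S /\ eqv G (add_chan T0 c) T.

(* The answer to the allocation of [c] by the observer brings the second system
   into a state related to the first one extended with [c], from where it can
   answer anything. *)
Lemma sim_ext_closure e B : one_sided e B -> sim e (ext_closure B).
Proof.
  intros HO G z S T [HB|(G0 & c & Ts & S0 & T0 & Hp & HS & HT & HB & HE1 & HE2)]
    mu k G' S' Hmu.
  - destruct (os_sim _ _ HO _ _ _ _ HB _ _ _ _ Hmu) as (l & T' & ? & ?).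
    exists l, T'; split; [|left]; auto.
  - destruct (os_sim _ _ HO _ _ _ _ HB LAlloc 1%Z (assume (Ch c) Ts (Uniq 0) :: G0)
      (add_chan S0 c)) as (l & T1 & HW & HB1).
    { destruct S0; apply p_alloc_env; auto. }
    apply wkh_visible in HW as (k1 & Ta & k2 & Tb & k3 & W1 & W2 & W3 & ->);
      [|discriminate].
    apply pretrans_inv in W2 as (-> & d & Us & Hd & -> & E).
    apply Permutation_head, assume_inj in E; inversion E; subst d.
    assert (HR : forall k T, wk G0 T0 k T -> config G0 T).
    { intros; eapply os_reach; eauto. }
    (* The silent steps that precede the allocation in the answer are replayed with [c] present from
       the start. *)
    destruct (wk_fresh _ (assume (Ch c) Ts (Uniq 0)) c _ _ _ eq_refl W1 HR
      _ (eqv_refl _ _) HT) as (Ta' & HEa & Hca & HWa).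
    assert (HEb : eqv (assume (Ch c) Ts (Uniq 0) :: G0) (add_chan Ta' c) (add_chan Ta c)).
    { apply eqv_add_chan; auto; [apply eqv_sym; auto|].
      eapply config_eqv; [exact HEa|]; eauto. }
    assert (HDP : dom_le G (assume (Ch c) Ts (Uniq 0) :: G0)) by dom_perm.
    (* Both systems pay 1 for the allocation, so it leaves the credit unchanged; what counts is the
       cost [k1 + k3] of the silent steps around it. *)
    assert (HB2 : B G (z + e * (k1 + 1 + k3 - 1))%Z S T1).
    { eapply os_eqv; [exact HO| |exact HE1|apply eqv_refl].
      eapply os_perm; [exact HO|symmetry; exact Hp|exact HB1]. }
    destruct (os_sim _ _ HO _ _ _ _ HB2 _ _ _ _ Hmu) as (l & T2 & HW2 & HB3).
    exists (0 + (k1 + (0 + (k3 + l))))%Z, T2; split.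
    + eapply wkh_prefix; [apply wk_eqv, eqv_sym; exact HE2|].
      eapply wkh_prefix; [eapply wk_dom_le; [exact HDP|exact HWa]|].
      eapply wkh_prefix; [apply wk_eqv; eapply eqv_dom_le; [exact HDP|exact HEb]|].
      eapply wkh_prefix; [eapply wk_dom_le; [exact HDP|exact W3]|exact HW2].
    + left. replace (z + e * (0 + (k1 + (0 + (k3 + l))) - k))%Z
        with (z + e * (k1 + 1 + k3 - 1) + e * (l - k))%Z by ring. auto.
Qed.

Lemma config_add_chan G S c Ts : config G S -> ~ res S c ->
  config (assume (Ch c) Ts (Uniq 0) :: G) (add_chan S c).
Proof.
  intros ((HF & HCl) & HD & D & (G' & HN & HP) & HT & HD' & HK') Hc.
  assert (HE : forall H, dom_sub H (res S) -> dom_sub H (extend (res S) c)).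
  { intros H HH u Hu; destruct (HH _ Hu) as (d & -> & Hd).
    exists d; split; auto; apply extend_iff; auto. }
  assert (Hfresh : forall H, dom_sub H (res S) -> ~ In (NId (Ch c)) (dom H)).
  { intros H HH Hu; destruct (HH _ Hu) as (d & E & Hd); inversion E; subst; auto. }
  split; [split|split]; auto.
  - simpl; intros HF'; apply HF.
    replace (Complement channel (res S))
      with (Ensembles.Add channel (Complement channel (extend (res S) c)) c).
    { apply Add_preserves_Finite; auto. }
    apply renv_ext; intros d; fold (extend (Complement channel (extend (res S) c)) c).
    rewrite extend_iff; unfold Complement, Ensembles.In; rewrite extend_iff.
    destruct (Nat.eq_dec d c) as [->|]; tauto.
  - simpl; intros u [<-|Hu]; [|apply (HE G HD); auto].
    exists c; split; auto; apply extend_iff; auto.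
  - exists D; split; [|split; [exact HT|split; [exact (HE D HD')|exact HK']]].
    (* [G'] witnesses the consistency of [G ++ D] but may mention [c]; such an assumption is removed
       before the unique one is added. *)
    set (p := fun u => if name_eq_dec u (NId (Ch c)) then false else true).
    assert (Hkeep : forall H, ~ In (NId (Ch c)) (dom H) -> keep_names p H = H).
    { induction H as [|[u T] H IH]; intros Hu; auto; simpl in *.
      unfold p at 1; destruct (name_eq_dec u (NId (Ch c))); [subst; tauto|].
      rewrite IH; auto. }
    exists (assume (Ch c) Ts (Uniq 0) :: keep_names p G'); split.
    + simpl; constructor.
      * unfold dom; rewrite in_map_iff; intros ([u T] & E & Hu); simpl in E; subst u.
        apply filter_In in Hu as [_ Hu]; unfold p in Hu; simpl in Hu.
        destruct (name_eq_dec _ _); [discriminate|tauto].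
      * clear -HN; induction G' as [|[u T] G' IH]; simpl; [constructor|].
        inversion HN; subst. destruct (p u); simpl; auto. constructor; auto.
        intros HI; apply in_dom_keep_names in HI; auto.
    + simpl; apply prec_cons. apply (prec_keep_names p) in HP.
      rewrite (Hkeep (G ++ D)) in HP; auto.
      rewrite dom_app, in_app_iff; intros [HI|HI];
        [apply (Hfresh G HD HI)|apply (Hfresh D HD' HI)].
Qed.

Lemma amortised_ext_closure : amortised (ext_closure zbis).
Proof.
  pose proof amortised_zbis as HZ. split.
  - intros G z S T [H|(G0 & c & Ts & S0 & T0 & _ & _ & _ & H & _)];
      apply (am_credit _ HZ _ _ _ _ H).
  - intros G G' z S T HP [H|(G0 & c & Ts & S0 & T0 & Hp & ? & ? & H & HE1 & HE2)].
    + left; eapply am_perm; eauto.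
    + right; exists G0, c, Ts, S0, T0; repeat split; auto.
      * rewrite <- HP; auto.
      * eapply eqv_dom_le; [|exact HE1]; dom_perm.
      * eapply eqv_dom_le; [|exact HE2]; dom_perm.
  - intros G z S T [H|(G0 & c & Ts & S0 & T0 & Hp & ? & ? & H & HE1 & HE2)].
    + apply (am_config _ HZ _ _ _ _ H).
    + apply (am_config _ HZ) in H as [HC1 HC2].
      split; (eapply config_eqv; [eassumption|]);
        (eapply config_perm; [symmetry; exact Hp|]); apply config_add_chan; auto.
  - intros G z S T S' T' [H|(G0 & c & Ts & S0 & T0 & Hp & ? & ? & H & HE1 & HE2)]
      HS HT.
    + left; eapply am_eqv; eauto.
    + right; exists G0, c, Ts, S0, T0; repeat split; auto; eapply eqv_trans; eauto.
  - apply sim_ext_closure, one_sided_zbis.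
  - intros G z T S H mu k G' T' HT.
    destruct (sim_ext_closure _ _ one_sided_zflip G z T S) with mu k G' T'
      as (l & S' & HW & HB); auto.
    + destruct H as [H|(G0 & c & Ts & S0 & T0 & ? & ? & ? & ? & ? & ?)]; [left; auto|].
      right; exists G0, c, Ts, T0, S0; auto 6.
    + exists l, S'; split; auto.
      destruct HB as [HB|(G0 & c & Ts & S0 & T0 & ? & ? & ? & ? & ? & ?)]; [left; auto|].
      right; exists G0, c, Ts, T0, S0; auto 6.
Qed.

Lemma bis_extend G n M P N Q c Ts : bis G n (M |> P) (N |> Q) -> ~ M c -> ~ N c ->
  bis (assume (Ch c) Ts (Uniq 0) :: G) n (extend M c |> P) (extend N c |> Q).
Proof.
  intros HB HM HN; apply (amortised_bis _ _ _ _ _ amortised_ext_closure).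
  right; exists G, c, Ts, (M |> P), (N |> Q); repeat split; auto using zbis_bis;
    apply eqv_refl.
Qed.

(** * Reductions and barbs *)

(** [act] has no rule for [struct]; the equivalences used in a reduction are postponed to its
    target. *)
Lemma red_act S k S' : red S k S' ->
  exists P', act (res S) (prc S) LTau k (res S') P' /\ struct P' (prc S').
Proof.
  induction 1; simpl in *.
  - eexists; split; [|apply struct_refl].
    eapply act_com_l; [apply act_out|apply act_inp; auto].
  - eexists; split; [constructor; auto|apply struct_refl].
  - eexists; split; [constructor; auto|apply struct_refl].
  - eexists; split; [constructor; auto|apply struct_refl].
  - eexists; split; [constructor; auto|apply struct_refl].
  - eexists; split; [constructor; auto|apply struct_refl].
  - destruct IHred as (X & ? & ?). exists (Par X R); split.
    + apply act_par_l; auto.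
    + apply struct_par; auto using struct_refl.
  - destruct IHred as (X & ? & ?). exists (Par R X); split.
    + apply act_par_r; auto.
    + apply struct_par; auto using struct_refl.
  - destruct IHred as (X & HX & HE).
    destruct (act_struct _ _ _ _ _ _ _ (struct_sym _ _ H) HX) as (Y & HY & HE').
    exists Y; split; auto. eapply struct_trans; [apply struct_sym; exact HE'|].
    eapply struct_trans; [exact HE|auto].
Qed.

Lemma struct_par_r P Q R : struct P Q -> struct (Par R P) (Par R Q).
Proof. intros; apply struct_par; auto using struct_refl. Qed.

Lemma struct_par_l P Q R : struct P Q -> struct (Par P R) (Par Q R).
Proof. intros; apply struct_par; auto using struct_refl. Qed.

Lemma struct_par_swap P Q R : struct (Par P (Par Q R)) (Par Q (Par P R)).
Proof.
  eapply struct_trans; [apply struct_assoc|].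
  eapply struct_trans; [apply struct_par_l, struct_comm|].
  apply struct_sym, struct_assoc.
Qed.

Lemma struct_par_r_inside R P X Q : struct P (Par X Q) -> struct (Par R P) (Par X (Par R Q)).
Proof.
  intros H; eapply struct_trans; [apply struct_par_r, H|apply struct_par_swap].
Qed.

Lemma struct_par_l_inside R P X Q : struct P (Par X Q) -> struct (Par P R) (Par X (Par Q R)).
Proof.
  intros H; eapply struct_trans; [apply struct_par_l, H|apply struct_sym, struct_assoc].
Qed.

(** Structural equivalence brings the acting prefix to the top, where it meets the communication
    axiom of [red] and the form required of a barb. *)
Lemma act_out_struct M P c ds k M' P' : act M P (LOut c ds) k M' P' ->
  exists P1 R, struct P (Par (Out (Ch c) (map Ch ds) P1) R) /\ struct P' (Par P1 R).
Proof.
  intros H; remember (LOut c ds) as mu; induction H; inversion Heqmu; subst.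
  - exists P, Nil; split; apply struct_sym, struct_nil.
  - destruct IHact as (P1 & R & ? & ?); auto.
    exists P1, (Par R Q); split; apply struct_par_l_inside; auto.
  - destruct IHact as (P1 & R & ? & ?); auto.
    exists P1, (Par Q R); split; apply struct_par_r_inside; auto.
Qed.

Lemma act_inp_struct M P c ds k M' P' : act M P (LInp c ds) k M' P' ->
  exists xs P1 R, length ds = length xs
    /\ struct P (Par (Inp (Ch c) xs P1) R)
    /\ struct P' (Par (subst (to_chans xs ds) P1) R).
Proof.
  intros H; remember (LInp c ds) as mu; induction H; inversion Heqmu; subst.
  - exists xs, P, Nil; repeat split; auto; apply struct_sym, struct_nil.
  - destruct IHact as (xs & P1 & R & ? & ? & ?); auto.
    exists xs, P1, (Par R Q); repeat split; auto; apply struct_par_l_inside; auto.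
  - destruct IHact as (xs & P1 & R & ? & ? & ?); auto.
    exists xs, P1, (Par Q R); repeat split; auto; apply struct_par_r_inside; auto.
Qed.

Lemma struct_interchange P Q R1 R2 :
  struct (Par (Par P R1) (Par Q R2)) (Par (Par P Q) (Par R1 R2)).
Proof.
  eapply struct_trans; [apply struct_sym, struct_assoc|].
  eapply struct_trans; [apply struct_par_r, struct_par_swap|apply struct_assoc].
Qed.

Lemma act_com_red (M : renv) P Q c ds P' Q' : M c ->
  act M P (LOut c ds) 0 M P' -> act M Q (LInp c ds) 0 M Q' ->
  red (M |> Par P Q) 0 (M |> Par P' Q').
Proof.
  intros Hc (P1 & R1 & HP & HP')%act_out_struct (xs & Q1 & R2 & Hl & HQ & HQ')%act_inp_struct.
  eapply red_struct.
  - eapply struct_trans; [apply struct_par; eassumption|apply struct_interchange].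
  - apply red_par_l, red_com; eauto.
  - eapply struct_trans; [apply struct_sym, struct_interchange|].
    apply struct_par; apply struct_sym; auto.
Qed.

(** A communication in [red] requires its channel to be allocated. Typing supplies this: the sender
    has an assumption on the channel, and the channels of the environment lie in [M]. *)
Lemma act_red M P k M' P' : act M P LTau k M' P' -> forall G, typed G P ->
  (forall c, In (NId (Ch c)) (dom G) -> M c) -> red (M |> P) k (M' |> P').
Proof.
  intros H; remember LTau as mu; induction H; inversion Heqmu; subst; intros G HT HG.
  - eapply act_com_red; eauto. apply typed_par_inv in HT as (G1 & G2 & HP & HT1 & HT2).
    destruct (typed_act_out _ _ _ _ _ _ _ _ H HT1) as (Ts & a & D & G0 & Pr & _).
    apply HG. eapply prec_dom; [exact HP|]. rewrite dom_app, in_app_iff; left.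
    eapply prec_dom; [exact Pr|]; simpl; auto.
  - eapply red_struct; [apply struct_comm| |apply struct_comm].
    eapply act_com_red; eauto. apply typed_par_inv in HT as (G1 & G2 & HP & HT1 & HT2).
    destruct (typed_act_out _ _ _ _ _ _ _ _ H HT2) as (Ts & a & D & G0 & Pr & _).
    apply HG. eapply prec_dom; [exact HP|]. rewrite dom_app, in_app_iff; right.
    eapply prec_dom; [exact Pr|]; simpl; auto.
  - apply typed_par_inv in HT as (G1 & G2 & HP & HT1 & HT2).
    apply red_par_l; eapply IHact; eauto. intros c Hc; apply HG.
    eapply prec_dom; [exact HP|]. rewrite dom_app, in_app_iff; auto.
  - apply typed_par_inv in HT as (G1 & G2 & HP & HT1 & HT2).
    apply red_par_r; eapply IHact; eauto. intros c Hc; apply HG.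
    eapply prec_dom; [exact HP|]. rewrite dom_app, in_app_iff; auto.
  - constructor.
  - constructor; auto.
  - constructor; auto.
  - constructor; auto.
  - constructor; auto.
Qed.

Lemma reds_trans S1 k S2 l S3 : reds S1 k S2 -> reds S2 l S3 -> reds S1 (k + l) S3.
Proof.
  induction 1; intros HR; [rewrite Z.add_0_l; auto|].
  rewrite <- Z.add_assoc; eapply reds_step; eauto.
Qed.

(** A reduction involves no renaming, so the path is rebuilt from [S0] and the equivalences are
    collected in the final one. The states have to be configurations for [act_red] to apply. *)
Lemma wk_reds G S k S' : wk G S k S' -> (forall k T, wk G S k T -> config G T) ->
  forall S0, eqv G S S0 -> exists S1, reds S0 k S1 /\ eqv G S' S1.
Proof.
  induction 1 as [S S' HE|S k S' HA|S1 k S2 l S3 HW IH1 _ IH2]; intros HR S0 H0.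
  - exists S0; split; [constructor|]. eapply eqv_trans; [apply eqv_sym; exact HE|auto].
  - destruct (eqv_act _ _ _ _ _ H0 HA) as (S1 & HA1 & HE1).
    exists S1; split; auto. rewrite <- (Z.add_0_r k). eapply reds_step; [|constructor].
    assert (HC0 : config G S0).
    { eapply config_eqv; [exact H0|]. eapply HR, wk_eqv, eqv_refl. }
    destruct HC0 as (_ & _ & D & _ & HT & HD & _), S0, S1; simpl in *.
    eapply act_red; eauto. intros c Hc; destruct (HD _ Hc) as (d & E & ?).
    inversion E; subst; auto.
  - destruct (IH1 HR _ H0) as (T1 & HR1 & HE1).
    destruct (IH2 (fun k T H => HR _ T (wk_trans _ _ _ _ _ _ HW H)) _ HE1) as (T2 & HR2 & HE2).
    exists T2; split; auto; eapply reds_trans; eauto.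
Qed.

Lemma one_sided_red e B G z S T k S' : one_sided e B -> B G z S T -> red S k S' ->
  exists l T', wk G T l T' /\ B G (z + e * (l - k))%Z S' T'.
Proof.
  intros HO HB (P' & HA & HE)%red_act. destruct S' as [M' Q']; simpl in *.
  destruct (os_sim _ _ HO _ _ _ _ HB LTau k G (M' |> P')) as (l & T' & [_ HW] & HB').
  { apply pretrans_intro; simpl; auto. }
  exists l, T'; split; auto. eapply os_eqv; eauto using eqv_struct, eqv_refl.
Qed.

(** The credit reached is left open: this serves only for barbs, which ignore costs. *)
Lemma one_sided_reds e B G S k S' : one_sided e B -> reds S k S' -> forall z T,
  B G z S T -> exists z' l T', wk G T l T' /\ B G z' S' T'.
Proof.
  intros HO; induction 1 as [S|S1 k S2 l S3 HR _ IH]; intros z T HB.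
  - exists z, 0%Z, T; split; auto; apply wk_eqv, eqv_refl.
  - destruct (one_sided_red _ _ _ _ _ _ _ _ HO HB HR) as (l1 & T1 & HW1 & HB1).
    destruct (IH _ _ HB1) as (z2 & l2 & T2 & HW2 & HB2).
    exists z2, (l1 + l2)%Z, T2; split; auto; eapply wk_trans; eauto.
Qed.

Lemma one_sided_cost e B G z S T k S' : one_sided e B -> B G z S T -> red S k S' ->
  exists l T', reds T l T' /\ B G (z + e * (l - k))%Z S' T'.
Proof.
  intros HO HB HR.
  destruct (one_sided_red _ _ _ _ _ _ _ _ HO HB HR) as (l & T' & HW & HB').
  destruct (wk_reds _ _ _ _ HW (fun k T H => os_reach _ _ HO _ _ _ _ k T HB H)
    T (eqv_refl _ _)) as (T1 & HR1 & HE1).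
  exists l, T1; split; auto. eapply os_eqv; eauto using eqv_refl.
Qed.

(* An observer that knows [c] can receive on it whenever the system sends:
   consistency makes the two assumptions on [c] agree. *)
Lemma one_sided_barb e B G z S T c : one_sided e B -> B G z S T ->
  barb G S c -> barb G T c.
Proof.
  intros HO HB ((k & M & P & P1 & ds & P2 & HR & HS) & Hc); split; auto.
  destruct (one_sided_reds _ _ _ _ _ _ HO HR _ _ HB) as (z1 & l1 & T1 & HW1 & HB1).
  assert (HA : exists X, act M P (LOut c ds) 0 M X).
  { destruct (act_struct _ _ M (LOut c ds) 0%Z M (Par P1 P2) (struct_sym _ _ HS))
      as (X & ? & _).
    - apply act_par_r, act_out.
    - eauto. }
  destruct HA as (X & HA).
  destruct (os_config _ _ HO _ _ _ _ HB1) as (_ & _ & D & HK & HT & _).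
  destruct (typed_act_out _ _ _ _ _ _ _ _ HA HT) as (Ts & a & D' & G0 & Pr & De & Le & _).
  unfold dom in Hc; apply in_map_iff in Hc as ([u U] & Hu & HI); simpl in Hu; subst u.
  apply in_split in HI as (Ga & Gb & ->).
  (* The two assumptions on [c] are the observer's [U] and the one with which the process sends. *)
  destruct (consistent_pair (NId (Ch c)) U Ts a (Ga ++ Gb)) as (a1 & HU & _ & Hcomp).
  { eapply consistent_prec; [exact HK|].
    eapply prec_trans; [apply prec_frame_l; exact Pr|].
    apply prec_trans with ((bindings (map Ch ds) Ts ++ G0)
      ++ (NId (Ch c), U) :: assume (Ch c) Ts a :: Ga ++ Gb).
    - apply prec_refl; perm.
    - apply prec_app_l. }
  (* The decrement is undefined only for [Uniq 0], which would exclude the process's own assumption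
     on [c]. *)
  assert (HD1 : exists D1, decr (Ch c) Ts a1 = Some D1).
  { destruct a1 as [| |[|i]]; simpl; eauto. destruct a as [| |j]; compat. }
  destruct HD1 as (D1 & HD1).
  set (G := Ga ++ (NId (Ch c), U) :: Gb) in *.
  set (Ge := assume (Ch c) Ts a1 :: Ga ++ Gb).
  assert (Hle : dom_le G Ge).
  { apply dom_le_trans with ((NId (Ch c), U) :: Ga ++ Gb).
    - apply dom_le_perm; unfold G; perm.
    - intros d; simpl; auto. }
  (* [U] need not literally be a [chanT] with object types [Ts]; an [LEnv] challenge replaces it by
     one, so that the output can be observed. *)
  destruct (os_sim _ _ HO _ _ _ _ HB1 LEnv 0%Z Ge (M |> P)) as (l2 & T2 & HW2 & HB2).
  { apply p_env. apply prec_perm_l with ((NId (Ch c), U) :: Ga ++ Gb).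
    - unfold G; perm.
    - apply prec_eq; auto. }
  destruct (os_sim _ _ HO _ _ _ _ HB2 (LOut c ds) 0%Z
    (bindings (map Ch ds) Ts ++ D1 ++ Ga ++ Gb) (M |> X)) as (l3 & T3 & HW3 & _).
  { apply act_pretrans_out; auto. }
  apply wkh_visible in HW2 as (k4 & T4 & k5 & T5 & k6 & W4 & W5 & W6 & _); [|discriminate].
  apply wkh_visible in HW3 as (k7 & T7 & k8 & T8 & k9 & W7 & W8 & _ & _); [|discriminate].
  apply pretrans_inv in W5 as (-> & -> & _). apply pretrans_inv in W8 as [HA8 _].
  assert (HW : wk G T (l1 + (k4 + (k6 + k7))) T7).
  { eapply wk_trans; [exact HW1|]. eapply wk_trans; [exact W4|].
    eapply wk_trans; (eapply wk_dom_le; [exact Hle|]); eauto. }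
  destruct (wk_reds _ _ _ _ HW (fun k T H => os_reach _ _ HO _ _ _ _ k T HB H)
    T (eqv_refl _ _)) as ([N Q] & HR1 & s & Hs & HM & HP); simpl in *.
  apply (act_ren s) in HA8; [|apply Bijective_Injective, Hs].
  destruct (act_struct _ _ _ _ _ _ _ HP HA8) as (Y & HY & _). simpl in HY.
  (* The renaming fixes [c], which the observer knows, but may move the objects; hence [map s ds] in
     the witness of the barb. *)
  rewrite (proj2 Hs) in HY by (unfold G; rewrite dom_app, in_app_iff; simpl; auto).
  apply act_out_struct in HY as (Q1 & R & HQ & _).
  exists (l1 + (k4 + (k6 + k7)))%Z, N, Q, R, (map s ds), Q1; split; auto.
  eapply struct_trans; [exact HQ|apply struct_comm].
Qed.

Lemma zbis_at_credit G z S T : zbis G z S T -> at_credit bis G z S T.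
Proof.
  intros (n & S0 & T0 & -> & H & HE1 & HE2); exists n; split; auto.
  eapply bis_eqv; eauto.
Qed.

Theorem theorem5p10 (G : env) (n : nat) (M N : renv) (P Q : process)
    (hS : is_system (M |> P)) (hT : is_system (N |> Q)) :
  bis G n (M |> P) (N |> Q) -> behav G n (M |> P) (N |> Q).
Proof.
  intros HB; exists bis; split; [apply bis_bisimulation|].
  split; [|split; [|split; [|exact HB]]].
  - intros G' m S T H%zbis_bis c; split.
    + apply (one_sided_barb _ _ _ _ _ _ _ one_sided_zbis H).
    + apply (one_sided_barb _ _ _ _ _ _ _ one_sided_zflip H).
  - intros G' m S T H%zbis_bis; split.
    + intros k S' HR.
      destruct (one_sided_cost _ _ _ _ _ _ _ _ one_sided_zbis H HR) as (l & T' & HT & HZ).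
      exists l, T'; split; auto. apply zbis_at_credit.
      replace (Z.of_nat m + l - k)%Z with (Z.of_nat m + 1 * (l - k))%Z by ring; auto.
    + intros k S' HR.
      destruct (one_sided_cost _ _ _ _ _ _ _ _ one_sided_zflip H HR) as (l & T' & HT & HZ).
      exists l, T'; split; auto. apply zbis_at_credit.
      replace (Z.of_nat m + k - l)%Z with (Z.of_nat m + -1 * (l - k))%Z by ring; auto.
  - intros G' m M' P' N' Q' H; split.
    + intros; apply bis_extend; auto.
    + intros G1 G2 C HP HC; split; [eapply bis_par; eauto|].
      (* A context on the left reduces to one on the right by commutativity, as [bis] is closed
         under [eqv]. *)
      eapply bis_eqv; [eapply bis_par; eauto|apply eqv_struct, struct_comm..].
Qed.
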